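(* Let $r,k\in\mathbb Z$ with $0\le k\le r$ and suppose Assumptions (A1), (A2), (A3) hold. Let $u$ be the (sufficiently smooth) solution of the initial value problem and $U$ the solution of the method (M). Suppose that, for $\tau$ sufficiently small, the global error $\sup_{t\in I}\|(u-U)(t)\|$, as well as $U$ and all its derivatives on each mesh interval, are bounded independently of the mesh. Then $$\|(u-U)(t_N^-)\|\le C(f,u)\Big(\sup_{t\in I}\|(u-U)(t)\|^2+\tau^{\min\{2r-k+1,\ r^{\mathscr I,\mathcal I}_{\rm var}+1,\ \max\{r^{\mathscr I}_{\rm ex}+1,\min\{r,r^{\mathscr I}_{\mathcal I}+1\}\}\}}\Big),$$ where $r^{\mathscr I,\mathcal I}_{\rm var}:=\min_{0\le i\le r-k}\{r^{\mathscr I}_{\mathcal I,i}+i\}$ and $C(f,u)$ is independent of the mesh.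
   Context: Problem: $u'(t)=f(t,u(t))$, $u(t_0)=u_0\in\mathbb R^d$, on $I=(t_0,t_0+T]$, $f$ smooth. Mesh $t_0<\dots<t_N=t_0+T$, $I_n=(t_{n-1},t_n]$, $\tau_n=t_n-t_{n-1}\le1$, $\tau=\max_n\tau_n$; one-sided limits $v(t_n^\pm)$, $[v]_n=v(t_n^+)-v(t_n^-)$. $T_n(\hat t)=\frac{t_n+t_{n-1}}{2}+\frac{\tau_n}{2}\hat t$. $\|\cdot\|$, $(\cdot,\cdot)$ Euclidean norm/inner product; $P_s$ polynomials of degree $\le s$, $P_{-1}:=\{0\}$; $\delta_{i,j}$ Kronecker symbol. Operators: $\widehat{\mathscr I}$ linear functional, $\widehat{\mathcal I}$ linear operator; $k_{\mathscr I},k_{\mathcal I}\ge0$ smallest integers with well-definedness on $C^{k_{\mathscr I}}([-1,1])$ resp. $C^{k_{\mathcal I}}([-1,1])$; $\widehat{\mathcal I}\hat v\in C^l$ whenever $\hat v\in C^{\max\{k_{\mathcal I},l\}}$. Local: $\mathscr I_n[\varphi]=\frac{\tau_n}{2}\widehat{\mathscr I}[\varphi\circ T_n]$, $\mathcal I_n\psi=(\widehat{\mathcal I}(\psi\circ T_n))\circ T_n^{-1}$, componentwise. $k_{\mathcal J}:=\max\{\lfloor k/2\rfloor-1,k_{\mathscr I},k_{\mathcal I}\}$. Method (M): given $U(t_{n-1}^-)$ ($U(t_0^-)=u_0$), find $U\in P_r(I_n,\mathbb R^d)$ with: if $k\ge1$, $U(t_{n-1}^+)=U(t_{n-1}^-)$;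 if $k\ge2$, $U^{(i+1)}(t_n^-)=\frac{d^i}{dt^i}f(t,U(t))|_{t_n^-}$, $i=0,\dots,\lfloor k/2\rfloor-1$; if $k\ge3$, $U^{(i+1)}(t_{n-1}^+)=\frac{d^i}{dt^i}f(t,U(t))|_{t_{n-1}^+}$, $i=0,\dots,\lfloor (k-1)/2\rfloor-1$; and $\mathscr I_n[(U',\varphi)]+\delta_{0,k}([U]_{n-1},\varphi(t_{n-1}^+))=\mathscr I_n[(\mathcal I_nf(\cdot,U(\cdot)),\varphi)]$ for all $\varphi\in P_{r-k}(I_n,\mathbb R^d)$. Approximation orders (values in $\mathbb N_0\cup\{-1,\infty\}$): $r^{\mathscr I}_{\rm ex}$ largest with $\int_{I_n}\varphi\,dt=\mathscr I_n[\varphi]$ for all $\varphi\in P_{r^{\mathscr I}_{\rm ex}}(I_n)$; $r^{\mathscr I}_{\mathcal I,i}$ largest with $\mathscr I_n[\varphi\psi]=\mathscr I_n[(\mathcal I_n\varphi)\psi]$ for all $\varphi\in P_{r^{\mathscr I}_{\mathcal I,i}}(I_n)$, $\psi\in P_i(I_n)$; $r^{\mathscr I}_{\mathcal I}:=r^{\mathscr I}_{\mathcal I,r-k}$. (A1): if $\hat\psi\in P_{r-\max\{1,k\}}([-1,1])$ and $\widehat{\mathscr I}[(1-\hat t)^{\lfloor k/2\rfloor}(1+\hat t)^{|\lfloor (k-1)/2\rfloor|}\hat\psi\hat\varphi]=0$ for all $\hat\varphi\in P_{r-\max\{1,k\}}([-1,1])$, then $\hat\psi\equiv0$. (A2): $\|\widehat{\mathscr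 I}[\hat\varphi]\|\le\mathfrak C_0\sum_{j=0}^{k_{\mathscr I}}\sup_{[-1,1]}\|\hat\varphi^{(j)}\|$ for all $\hat\varphi\in C^{k_{\mathscr I}}([-1,1],\mathbb R^d)$. (A3): for $0\le l\le k_{\mathscr I}$, $\sup_{[-1,1]}\|(\widehat{\mathcal I}\hat\varphi)^{(l)}\|\le\mathfrak C_1\sum_{j=0}^{\max\{k_{\mathcal I},l\}}\sup_{[-1,1]}\|\hat\varphi^{(j)}\|$ for all $\hat\varphi\in C^{\max\{k_{\mathcal I},l\}}([-1,1],\mathbb R^d)$. *)

(* Defs.v *)
From Stdlib Require Import Reals Lra Lia ZArith List.
From Coquelicot Require Import Coquelicot.
From mathcomp Require Import ssreflect ssrfun ssrbool eqtype ssrnat seq fintype bigop.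
Set Implicit Arguments. Unset Strict Implicit.
Open Scope R_scope.

Definition vec (d : nat) := 'I_d -> R.
Definition vsum (d : nat) (F : 'I_d -> R) : R := \big[Rplus/0]_(j < d) F j.
Definition vdot (d : nat) (v w : vec d) : R := vsum (fun j => v j * w j).
Definition vnorm (d : nat) (v : vec d) : R := sqrt (vdot v v).

Definition sum_upto (m : nat) (S : nat -> R) : R := \big[Rplus/0]_(l < m.+1) S l.

(* ---------- polynomials of degree <= s (s : Z, s >= -1; P_{-1} = {0}) ---------- *)
Definition is_poly_le (s : Z) (p : R -> R) : Prop :=
  exists c : nat -> R, forall x, p x = \big[Rplus/0]_(m < Z.to_nat (s + 1)) (c m * x ^ m).

Definition upd (d : nat) (y : vec d) (i : 'I_d) (s : R) : vec d :=
  fun j => if j == i then s else y j.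

Definition pd (d : nat) (G : R -> vec d -> R) (e : option 'I_d) : R -> vec d -> R :=
  match e with
  | None => fun t y => Derive (fun s => G s y) t
  | Some i => fun t y => Derive (fun s => G t (upd y i s)) (y i)
  end.

Definition ex_pd (d : nat) (G : R -> vec d -> R) (e : option 'I_d) : Prop :=
  match e with
  | None => forall t y, ex_derive (fun s => G s y) t
  | Some i => forall t y, ex_derive (fun s => G t (upd y i s)) (y i)
  end.

Fixpoint iter_pd (d : nat) (G : R -> vec d -> R) (l : list (option 'I_d)) : R -> vec d -> R :=
  match l with
  | nil => G
  | e :: l' => pd (iter_pd G l') e
  end.

Definition jcont (d : nat) (G : R -> vec d -> R) : Prop :=
  forall t y eps, 0 < eps -> exists delta, 0 < delta /\
    forall t' y', Rabs (t' - t) < delta -> (forall j, Rabs (y' j - y j) < delta) ->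
      Rabs (G t' y' - G t y) < eps.

Definition smooth_scalar (d : nat) (G : R -> vec d -> R) : Prop :=
  forall l, jcont (iter_pd G l) /\ forall e, ex_pd (iter_pd G l) e.

Definition smooth_f (d : nat) (f : R -> vec d -> vec d) : Prop :=
  forall j, smooth_scalar (fun t y => f t y j).

Definition has_deriv_on (a b : R) (phi psi : R -> R) : Prop :=
  forall x, a <= x <= b -> forall eps, 0 < eps -> exists delta, 0 < delta /\
    forall y, a <= y <= b -> y <> x -> Rabs (y - x) < delta ->
      Rabs ((phi y - phi x) / (y - x) - psi x) < eps.

Definition cont_on (a b : R) (g : R -> R) : Prop :=
  forall x, a <= x <= b -> forall eps, 0 < eps -> exists delta, 0 < delta /\
    forall y, a <= y <= b -> Rabs (y - x) < delta -> Rabs (g y - g x) < eps.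

Definition derivs_on (a b : R) (m : nat) (phi : R -> R) (D : nat -> R -> R) : Prop :=
  (forall x, a <= x <= b -> D 0%nat x = phi x) /\
  (forall l, (l < m)%nat -> has_deriv_on a b (D l) (D l.+1)) /\
  cont_on a b (D m).

Definition Cm_on (a b : R) (m : nat) (phi : R -> R) : Prop :=
  exists D, derivs_on a b m phi D.

Definition vderivs_on (d : nat) (a b : R) (m : nat) (phi : R -> vec d)
  (D : nat -> R -> vec d) : Prop :=
  forall j, derivs_on a b m (fun s => phi s j) (fun l s => D l s j).

Definition Tmap (a b s : R) : R := (a + b) / 2 + (b - a) / 2 * s.
Definition Tinv (a b t : R) : R := (2 * t - a - b) / (b - a).

Definition Iloc (Ihat : (R -> R) -> R) (a b : R) (g : R -> R) : R :=
  (b - a) / 2 * Ihat (fun s => g (Tmap a b s)).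

Definition Ioploc (Iop : (R -> R) -> (R -> R)) (a b : R) (psi : R -> R) : R -> R :=
  fun t => Iop (fun s => psi (Tmap a b s)) (Tinv a b t).

(* ---------- extended integers Z U {+oo} (None = +oo) ---------- *)
Definition ext := option Z.
Definition emin (x y : ext) : ext :=
  match x, y with None, _ => y | _, None => x | Some a, Some b => Some (Z.min a b) end.
Definition emax (x y : ext) : ext :=
  match x, y with Some a, Some b => Some (Z.max a b) | _, _ => None end.
Definition eaddZ (x : ext) (z : Z) : ext :=
  match x with None => None | Some a => Some (a + z)%Z end.
Definition ext_to_nat (x : ext) : nat :=
  match x with None => 0%nat | Some a => Z.to_nat a end.

Definition is_largest (P : Z -> Prop) (o : ext) : Prop :=
  match o with
  | None => forall s, (-1 <= s)%Z -> P s
  | Some z => (-1 <= z)%Z /\ P z /\ forall s, (-1 <= s)%Z -> P s -> (s <= z)%Z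
  end.

Definition exact_deg (Ihat : (R -> R) -> R) (s : Z) : Prop :=
  forall a b, a < b -> forall phi, is_poly_le s phi -> RInt phi a b = Iloc Ihat a b phi.

Definition interp_deg (Ihat : (R -> R) -> R) (Iop : (R -> R) -> (R -> R))
  (i : nat) (s : Z) : Prop :=
  forall a b, a < b -> forall phi psi, is_poly_le s phi -> is_poly_le (Z.of_nat i) psi ->
    Iloc Ihat a b (fun t => phi t * psi t) =
    Iloc Ihat a b (fun t => Ioploc Iop a b phi t * psi t).

Definition r_var (rI : nat -> ext) (r k : nat) : ext :=
  foldr emin None (map (fun i => eaddZ (rI i) (Z.of_nat i)) (iota 0 (r - k).+1)).

Definition conv_exponent (rex : ext) (rI : nat -> ext) (r k : nat) : nat :=
  ext_to_nat
    (emin (Some (2 * Z.of_nat r - Z.of_nat k + 1)%Z)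
      (emin (eaddZ (r_var rI r k) 1)
        (emax (eaddZ rex 1) (emin (Some (Z.of_nat r)) (eaddZ (rI (r - k)%nat) 1))))).

Definition is_mesh (t0 T : R) (N : nat) (tm : nat -> R) : Prop :=
  (0 < N)%nat /\ tm 0%nat = t0 /\ tm N = t0 + T /\
  forall n, (n < N)%nat -> tm n < tm n.+1 /\ tm n.+1 - tm n <= 1.

Definition mesh_tau (N : nat) (tm : nat -> R) : R :=
  foldr Rmax 0 (map (fun n => tm n.+1 - tm n) (iota 0 N)).

(* Up n : the polynomial U|_{I_n}, n = 1..N;  U(t_m^-) with U(t_0^-) = u0 *)
Definition Uminus (d : nat) (u0 : vec d) (tm : nat -> R) (Up : nat -> R -> vec d)
  (m : nat) : vec d :=
  if m == 0%nat then u0 else Up m (tm m).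

Definition solves_M (d : nat) (f : R -> vec d -> vec d) (u0 : vec d) (r k : nat)
  (Ihat : (R -> R) -> R) (Iop : (R -> R) -> (R -> R))
  (N : nat) (tm : nat -> R) (Up : nat -> R -> vec d) : Prop :=
  forall n, (1 <= n <= N)%nat ->
    let a := tm n.-1 in let b := tm n in
    (forall j, is_poly_le (Z.of_nat r) (fun t => Up n t j)) /\
    ((1 <= k)%nat -> forall j, Up n a j = Uminus u0 tm Up n.-1 j) /\
    (forall i, (i < k./2)%nat -> forall j,
       Derive_n (fun t => Up n t j) i.+1 b = Derive_n (fun t => f t (Up n t) j) i b) /\
    (forall i, (i < (k.-1)./2)%nat -> forall j,
       Derive_n (fun t => Up n t j) i.+1 a = Derive_n (fun t => f t (Up n t) j) i a) /\
    (forall phi : R -> vec d,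
       (forall j, is_poly_le (Z.of_nat (r - k)) (fun t => phi t j)) ->
       Iloc Ihat a b (fun t => vsum (fun j => Derive (fun s => Up n s j) t * phi t j))
       + (if k == 0%nat then vsum (fun j => (Up n a j - Uminus u0 tm Up n.-1 j) * phi a j)
          else 0)
       = Iloc Ihat a b (fun t => vsum (fun j =>
             Ioploc Iop a b (fun s => f s (Up n s) j) t * phi t j))).

Definition Assumption_A1 (Ihat : (R -> R) -> R) (r k : nat) : Prop :=
  let deg := (Z.of_nat r - Z.of_nat (maxn 1 k))%Z in
  let e2 := if k == 0%nat then 1%nat else (k.-1)./2 in
  forall psi, is_poly_le deg psi ->
    (forall phi, is_poly_le deg phi ->
       Ihat (fun s => (1 - s) ^ (k./2) * (1 + s) ^ e2 * psi s * phi s) = 0) ->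
    forall x, psi x = 0.

Definition Assumption_A2 (d : nat) (Ihat : (R -> R) -> R) (kI : nat) : Prop :=
  exists C0, forall (phi : R -> vec d) D, vderivs_on (-1) 1 kI phi D ->
    forall S : nat -> R,
      (forall l x, (l <= kI)%nat -> -1 <= x <= 1 -> vnorm (D l x) <= S l) ->
      vnorm (fun j => Ihat (fun s => phi s j)) <= C0 * sum_upto kI S.

Definition Assumption_A3 (d : nat) (Iop : (R -> R) -> (R -> R)) (kI kIop : nat) : Prop :=
  exists C1, forall l, (l <= kI)%nat ->
    forall (phi : R -> vec d) D E,
      vderivs_on (-1) 1 (maxn kIop l) phi D ->
      vderivs_on (-1) 1 l (fun s j => Iop (fun x => phi x j) s) E ->
      forall S : nat -> R,
        (forall m x, (m <= maxn kIop l)%nat -> -1 <= x <= 1 -> vnorm (D m x) <= S m) ->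
        forall x, -1 <= x <= 1 -> vnorm (E l x) <= C1 * sum_upto (maxn kIop l) S.

Definition Ihat_ok (Ihat : (R -> R) -> R) (kI : nat) : Prop :=
  forall alpha beta phi psi, Cm_on (-1) 1 kI phi -> Cm_on (-1) 1 kI psi ->
    Ihat (fun s => alpha * phi s + beta * psi s) = alpha * Ihat phi + beta * Ihat psi.

Definition Iop_ok (Iop : (R -> R) -> (R -> R)) (kIop : nat) : Prop :=
  (forall alpha beta phi psi, Cm_on (-1) 1 kIop phi -> Cm_on (-1) 1 kIop psi ->
     forall x, -1 <= x <= 1 ->
       Iop (fun s => alpha * phi s + beta * psi s) x = alpha * Iop phi x + beta * Iop psi x) /\
  (forall l phi, Cm_on (-1) 1 (maxn kIop l) phi -> Cm_on (-1) 1 l (Iop phi)).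

Definition is_ode_solution (d : nat) (f : R -> vec d -> vec d) (u0 : vec d)
  (t0 T : R) (u : R -> vec d) : Prop :=
  u t0 = u0 /\
  forall j, has_deriv_on t0 (t0 + T) (fun t => u t j) (fun t => f t (u t) j).

(* Main.v *)
Require Import Defs.
From Stdlib Require Import Reals ZArith Lra Lia FunctionalExtensionality Classical ClassicalEpsilon.
From Coquelicot Require Import Coquelicot.
From HB Require Import structures.
From mathcomp Require Import ssreflect ssrfun ssrbool eqtype ssrnat seq fintype bigop.
From mathcomp.zify Require Import zify_ssreflect.
Set Implicit Arguments. Unset Strict Implicit.
Open Scope R_scope.

(* On a mesh interval [[a, b]] of length [tau] one linearises about the polynomial [U] rather than
   about [u] and tests the error equation with an approximate dual solution [z], a Picard iterate
   with [z a] a unit vector and [z' + A^T z = O(tau^p)].  This gives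
     [u(b) - U(b) = u(a) - U(a^-) + O(tau |u(b) - U(b)|) + O(tau E^2) + defect],
   where the defect is the integral of the residual [rho = f(t, U) - U'] against [z], corrected by
   the jump when [k = 0]; a discrete Gronwall argument then sums the steps.

   The method determines [U'] from [f(t, U)] by end point and moment conditions that are unisolvent
   by (A1); hence [rho] is, in all derivatives on the reference interval, of order [tau^q] with
   [q = min(r, r_{I,r-k} + 1)].  If [p <= q] the defect is bounded directly.  Otherwise
   [p <= r_ex + 1], so the integral may be replaced by the quadrature; the Taylor polynomial of [z]
   of degree [r - k] is an admissible test function, and leaves only interpolation errors of order
   [r_var], while the remainder of [z] contributes [tau^(q + r - k + 1)]. *)

(** Linearising about [U] keeps the regularity of the exact solution out of the argument: the
    coefficients [f_y(t, U(t))] are smooth on the whole line because [U] is a polynomial, and their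
    derivatives are bounded uniformly by hypothesis, while of [u] only its differential equation is
    used. The quadratic remainder is the source of [E ^ 2]. An approximate dual solution is enough
    because its residual is multiplied by the bounded error [u - U]; hence no existence or
    regularity theory for the dual equation is needed. It is normalised at the left end, so that the
    error carried over from the previous step enters with factor one; the price is the implicit term
    at [b], which a small [tau] absorbs. The obstacle that shapes the proof is uniformity: one
    constant has to serve all steps of all meshes. All admissible steps are therefore collected in
    one type [step], and functions are replaced by families indexed by it, whose derivatives of
    every order are bounded relative to a weight such as [tau ^ q]. *)

HB.instance Definition _ := Monoid.isComLaw.Build R 0 Rplus
  (fun x y z => Logic.eq_sym (Rplus_assoc x y z)) Rplus_comm Rplus_0_l.

(** * Finite sums and Euclidean norms *)

Lemma Rsum_scal (I : Type) (s : seq I) (P : pred I) (c : R) (F : I -> R) :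
  c * \big[Rplus/0]_(i <- s | P i) F i = \big[Rplus/0]_(i <- s | P i) (c * F i).
Proof. by elim/big_rec2: _ => [|i x y _ <-]; ring. Qed.

Lemma Rsum_le (I : Type) (s : seq I) (P : pred I) (F G : I -> R) :
  (forall i, P i -> F i <= G i) ->
  \big[Rplus/0]_(i <- s | P i) F i <= \big[Rplus/0]_(i <- s | P i) G i.
Proof. by move=> H; elim/big_rec2: _ => [|i x y /H]; lra. Qed.

Lemma Rsum_abs (I : Type) (s : seq I) (P : pred I) (F : I -> R) :
  Rabs (\big[Rplus/0]_(i <- s | P i) F i) <= \big[Rplus/0]_(i <- s | P i) Rabs (F i).
Proof.
elim/big_rec2: _ => [|i x y _ H]; first by rewrite Rabs_R0; lra.
by have := Rabs_triang (F i) y; lra.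
Qed.

Lemma Rsum_abs_le (I : Type) (s : seq I) (P : pred I) (F G : I -> R) :
  (forall i, P i -> Rabs (F i) <= G i) ->
  Rabs (\big[Rplus/0]_(i <- s | P i) F i) <= \big[Rplus/0]_(i <- s | P i) G i.
Proof. by move=> H; apply: Rle_trans (Rsum_abs _ _ _) _; apply: Rsum_le. Qed.

Lemma Rsum_ge0 (I : Type) (s : seq I) (P : pred I) (F : I -> R) :
  (forall i, P i -> 0 <= F i) -> 0 <= \big[Rplus/0]_(i <- s | P i) F i.
Proof. by move=> H; elim/big_rec: _ => [|i x /H]; lra. Qed.

Lemma Rsum_const_ord (n : nat) (c : R) : \big[Rplus/0]_(i < n) c = INR n * c.
Proof.
elim: n => [|n IH]; first by rewrite big_ord0 /=; ring.
by rewrite big_ord_recr IH S_INR /=; ring.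
Qed.

Lemma Rsum_term_le (I : finType) (F : I -> R) (i : I) :
  (forall j, 0 <= F j) -> F i <= \big[Rplus/0]_(j : I) F j.
Proof.
move=> H; rewrite (bigD1 i) //=.
by have := @Rsum_ge0 _ (index_enum I) (fun j => j != i) F (fun j _ => H j); lra.
Qed.

Lemma Rsum_delta (I : finType) (F : I -> R) (i : I) :
  \big[Rplus/0]_(j : I) (if j == i then F j else 0) = F i.
Proof.
rewrite (bigD1 i) //= eqxx big1 ?Rplus_0_r // => j /negbTE ->.
by [].
Qed.

Section Vec.
Variable d : nat.
Implicit Type v : vec d.

Lemma coord_le_vnorm v (j : 'I_d) : Rabs (v j) <= vnorm v.
Proof.
rewrite -sqrt_Rsqr_abs; apply: sqrt_le_1_alt.
apply: (@Rsum_term_le _ (fun j => v j * v j)) => i; nra.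
Qed.

Lemma vnorm_le_sum v : vnorm v <= vsum (fun j => Rabs (v j)).
Proof.
have H0 : 0 <= vsum (fun j => Rabs (v j)).
  by apply: Rsum_ge0 => i _; apply: Rabs_pos.
rewrite -(sqrt_Rsqr _ H0); apply: sqrt_le_1_alt; rewrite /Rsqr /vdot /vsum Rsum_scal.
apply: Rsum_le => i _; rewrite Rmult_comm.
have -> : v i * v i = Rabs (v i) * Rabs (v i) by rewrite -Rabs_mult Rabs_pos_eq //; nra.
apply: Rmult_le_compat_l; first exact: Rabs_pos.
by apply: (@Rsum_term_le _ (fun j => Rabs (v j))) => j; apply: Rabs_pos.
Qed.

Lemma vnorm_ge0 v : 0 <= vnorm v.
Proof. exact: sqrt_pos. Qed.

End Vec.

(* Gaussian elimination, one unknown at a time. *)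
Lemma injective_bounded_below (I : finType) (n : nat) (M : I -> nat -> R) :
  (forall v : nat -> R, (forall l, \big[Rplus/0]_(m < n) (M l m * v m) = 0) ->
     forall m, (m < n)%nat -> v m = 0) ->
  exists C, 0 <= C /\ forall (v : nat -> R) delta,
    (forall l, Rabs (\big[Rplus/0]_(m < n) (M l m * v m)) <= delta) ->
    forall m, (m < n)%nat -> Rabs (v m) <= C * delta.
Proof.
elim: n M => [|n IH] M inj; first by exists 0; split; [lra|move=> v dl _ m; rewrite ltn0].
(* A pivot exists in the last column, since otherwise the last unit vector would lie in the
   kernel. *)
have [l0 Hl0] : exists l0, M l0 n <> 0.
  apply: NNPP => H.
  have H1 : 1 = 0; last by lra.
  rewrite -[LHS](_ : (if n == n then 1 else 0) = 1); last by rewrite eqxx.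
  apply: (inj (fun m => if m == n then 1 else 0)) => // l.
  rewrite big_ord_recr /= eqxx big1 => [|i _]; last by rewrite ltn_eqF //; ring.
  have -> : M l n = 0 by apply: NNPP => H'; apply: H; exists l.
  ring.
(* Schur complement: each row is reduced by the multiple of the pivot row that removes unknown
   [n]. *)
pose M' l m := M l m - M l n / M l0 n * M l0 m.
have M'E (v : nat -> R) l : \big[Rplus/0]_(m < n) (M' l m * v m) =
    \big[Rplus/0]_(m < n) (M l m * v m) -
    M l n / M l0 n * \big[Rplus/0]_(m < n) (M l0 m * v m).
  rewrite Rsum_scal /Rminus -[- _]Rmult_1_l -Ropp_mult_distr_r Ropp_mult_distr_l Rsum_scal.
  by rewrite -big_split /=; apply: eq_bigr => i _; rewrite /M'; ring.
have [v Hv m Hm|C [C0 HC]] := IH M'.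
  pose v' m := if m == n then - \big[Rplus/0]_(m < n) (M l0 m * v m) / M l0 n else v m.
  have v'E l : \big[Rplus/0]_(m < n) (M l m * v' m) = \big[Rplus/0]_(m < n) (M l m * v m).
    by apply: eq_bigr => i _; rewrite /v' ltn_eqF.
  have := inj v' _ m (ltnW Hm); rewrite /v' ltn_eqF //; apply=> l.
  rewrite big_ord_recr /= (v'E l) eqxx.
  have := Hv l; rewrite M'E; set S1 := \big[_/_]_(m < n) (M l m * _); set S2 := \big[_/_]_(_ < _) _ => H.
  by apply: eq_trans H; field.
pose K := \big[Rplus/0]_(l : I) Rabs (M l n / M l0 n).
pose K0 := \big[Rplus/0]_(m < n) Rabs (M l0 m).
have HK l : Rabs (M l n / M l0 n) <= K.
  by apply: (@Rsum_term_le _ (fun l => Rabs (M l n / M l0 n))) => j; apply: Rabs_pos.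
have K_ge0 : 0 <= K by apply: Rsum_ge0 => *; apply: Rabs_pos.
have K0_ge0 : 0 <= K0 by apply: Rsum_ge0 => *; apply: Rabs_pos.
have Hi : 0 < / Rabs (M l0 n) by apply: Rinv_0_lt_compat; apply: Rabs_pos_lt.
set i0 := / Rabs (M l0 n) in Hi.
have CK : 0 <= C * (1 + K) by nra.
have CK0 : 0 <= K0 * (C * (1 + K)) by nra.
have CK1 : 0 <= i0 * (1 + K0 * (C * (1 + K))) by nra.
(* A row of [M'] combines two rows of [M] with weights one and at most [K], which gives
   [C * (1 + K)] for the first unknowns; the other summand comes from solving the pivot row for
   [v n]. *)
exists (C * (1 + K) + i0 * (1 + K0 * (C * (1 + K)))); split; first lra.
move=> v delta Hv.
have d0 : 0 <= delta by have := Hv l0; have := Rabs_pos (\big[Rplus/0]_(m < n.+1) (M l0 m * v m)); lra.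
have Hsmall m : (m < n)%nat -> Rabs (v m) <= C * (1 + K) * delta.
  move=> Hm; rewrite Rmult_assoc; apply: HC Hm => l; rewrite M'E.
  have -> : \big[Rplus/0]_(m < n) (M l m * v m) -
    M l n / M l0 n * \big[Rplus/0]_(m < n) (M l0 m * v m) =
    \big[Rplus/0]_(m < n.+1) (M l m * v m) +
    - (M l n / M l0 n) * \big[Rplus/0]_(m < n.+1) (M l0 m * v m).
    by rewrite !big_ord_recr /=; field.
  apply: Rle_trans (Rabs_triang _ _) _; rewrite Rabs_mult Rabs_Ropp.
  have := Hv l; have := Hv l0; have := HK l.
  have := Rabs_pos (M l n / M l0 n); have := Rabs_pos (\big[Rplus/0]_(m < n.+1) (M l0 m * v m)).
  nra.
move=> m; rewrite ltnS leq_eqVlt => /orP[/eqP ->|Hm]; last first.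
  by have := Hsmall m Hm; nra.
have E : v n = (\big[Rplus/0]_(m < n.+1) (M l0 m * v m) - \big[Rplus/0]_(m < n) (M l0 m * v m)) / M l0 n.
  by rewrite big_ord_recr /=; field.
rewrite E /Rdiv Rabs_mult Rabs_inv -/i0.
have H1 : Rabs (\big[Rplus/0]_(m < n) (M l0 m * v m)) <= K0 * (C * (1 + K) * delta).
  apply: Rle_trans (Rsum_abs _ _ _) _; rewrite Rmult_comm Rsum_scal.
  apply: Rsum_le => i _; rewrite Rabs_mult Rmult_comm.
  by apply: Rmult_le_compat_r; [apply: Rabs_pos|apply: Hsmall].
have H2 : Rabs (\big[Rplus/0]_(m < n.+1) (M l0 m * v m) - \big[Rplus/0]_(m < n) (M l0 m * v m))
   <= delta + K0 * (C * (1 + K) * delta).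
  by apply: Rle_trans (Rabs_triang _ _) _; rewrite Rabs_Ropp; have := Hv l0; lra.
have H3 := Rmult_le_compat_r i0 _ _ (Rlt_le _ _ Hi) H2.
apply: Rle_trans H3 _.
have := Rmult_le_pos _ _ CK d0; nra.
Qed.

(** * Polynomials counted by coefficients *)

(** Counting coefficients instead of degrees keeps the index in [nat]: [pn n] is the space of degree
    at most [n - 1], and [pn 0] is the zero space. *)
Definition pn (n : nat) (p : R -> R) : Prop :=
  exists c : nat -> R, forall x, p x = \big[Rplus/0]_(m < n) (c m * x ^ m).

Lemma is_poly_leE (s : Z) (n : nat) p : (Z.to_nat (s + 1) = n)%Z -> is_poly_le s p <-> pn n p.
Proof. by move=> <-. Qed.

Lemma is_poly_le_nat (n : nat) p : is_poly_le (Z.of_nat n) p <-> pn n.+1 p.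
Proof. by apply: is_poly_leE; lia. Qed.

(** Horner form; it serves as the induction principle for the closure properties below. *)
Lemma pnS n p : pn n.+1 p <-> exists c0 p1, pn n p1 /\ forall x, p x = c0 + x * p1 x.
Proof.
split=> [[c Hc]|[c0 [p1 [[c Hc] H]]]].
  exists (c 0%nat), (fun x => \big[Rplus/0]_(m < n) (c m.+1 * x ^ m)); split.
    by exists (fun m => c m.+1).
  move=> x; rewrite Hc big_ord_recl /= Rsum_scal; congr (_ + _); first ring.
  by apply: eq_bigr => i _ /=; rewrite /bump leq0n add1n /= ?add0n; ring.
exists (fun m => if m is m'.+1 then c m' else c0) => x.
rewrite H Hc big_ord_recl /= Rsum_scal; congr (_ + _); first ring.
by apply: eq_bigr => i _; rewrite ?/bump ?leq0n ?add1n /= ?add0n; ring.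
Qed.

Lemma pn0E p : pn 0 p -> forall x, p x = 0.
Proof. by move=> [c H] x; rewrite H big_ord0. Qed.

Lemma pn0 n : pn n (fun _ => 0).
Proof. by exists (fun _ => 0) => x; rewrite big1 // => i _; ring. Qed.

Lemma pn_add n p q : pn n p -> pn n q -> pn n (fun x => p x + q x).
Proof.
move=> [c Hc] [e He]; exists (fun m => c m + e m) => x.
by rewrite Hc He -big_split; apply: eq_bigr => i _ /=; ring.
Qed.

Lemma pn_scal n a p : pn n p -> pn n (fun x => a * p x).
Proof.
move=> [c Hc]; exists (fun m => a * c m) => x.
by rewrite Hc Rsum_scal; apply: eq_bigr => i _; ring.
Qed.

Lemma pn_const n a : pn n.+1 (fun _ => a).
Proof. by apply/pnS; exists a, (fun _ => 0); split; [apply: pn0|move=> x; ring]. Qed.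

Lemma pn_mulX n p : pn n p -> pn n.+1 (fun x => x * p x).
Proof. by move=> H; apply/pnS; exists 0, p; split=> // x; ring. Qed.

Lemma pn_ext n p q : (forall x, p x = q x) -> pn n p -> pn n q.
Proof. by move=> E [c H]; exists c => x; rewrite -E. Qed.

Lemma pn_leq n m p : (n <= m)%nat -> pn n p -> pn m p.
Proof.
elim: n m p => [|n IH] [|m] p //; rewrite ?ltnS => le.
  by move/pn0E => H; apply: (@pn_ext _ (fun _ => 0)); [move=> x; rewrite H|apply: pn0].
move/pnS => [c0 [p1 [H E]]]; apply/pnS; exists c0, p1; split=> //; exact: IH.
Qed.

Lemma pn_mul_affine n p a b : pn n p -> pn n.+1 (fun x => (a + b * x) * p x).
Proof.
move=> H; apply: (@pn_ext _ (fun x => a * p x + b * (x * p x))); first by move=> x; ring.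
by apply: pn_add; apply: pn_scal; [apply: pn_leq H|apply: pn_mulX].
Qed.

Lemma pn_comp_affine n p a b : pn n p -> pn n (fun x => p (a + b * x)).
Proof.
elim: n p => [|n IH] p.
  by move/pn0E => H; apply: (@pn_ext _ (fun _ => 0)); [move=> x; rewrite H|apply: pn0].
move/pnS => [c0 [p1 [H E]]].
apply: (@pn_ext _ (fun x => c0 + (a + b * x) * p1 (a + b * x))); first by move=> x; rewrite E.
by apply: pn_add; [apply: pn_const|apply: pn_mul_affine; apply: IH].
Qed.

Lemma pn_affine_pow m a b : pn m.+1 (fun x => (a + b * x) ^ m).
Proof. by elim: m => [|m IH] /=; [apply: pn_const|apply: pn_mul_affine]. Qed.

Lemma pn_sum (n N : nat) (F : nat -> R -> R) : (forall m, (m < N)%nat -> pn n (F m)) ->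
  pn n (fun x => \big[Rplus/0]_(m < N) F m x).
Proof.
elim: N => [|N IH] H.
  by apply: (@pn_ext _ (fun _ => 0)); [move=> x; rewrite big_ord0|apply: pn0].
apply: (@pn_ext _ (fun x => \big[Rplus/0]_(m < N) F m x + F N x)).
  by move=> x; rewrite big_ord_recr.
by apply: pn_add; [apply: IH => m Hm; apply: H; apply: ltnW|apply: H].
Qed.

(** Powers of [1 + s] are the basis used throughout on the reference interval: they are adapted to
    the left end point, where Taylor expansions are centred and the jump is evaluated. *)
Lemma pn_shifted n p : pn n p ->
  exists v : nat -> R, forall s, p s = \big[Rplus/0]_(m < n) (v m * (1 + s) ^ m).
Proof.
move=> /(@pn_comp_affine n p (-1) 1) [v Hv]; exists v => s.
by rewrite -Hv; congr p; ring.
Qed.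

Lemma pn_derive n p : pn n.+1 p -> exists p', pn n p' /\ forall x, is_derive p x (p' x).
Proof.
elim: n p => [|n IH] p /pnS [c0 [p1 [H E]]].
  exists (fun _ => 0); split; first exact: pn0.
  move=> x; apply: (@is_derive_ext _ _ (fun _ => c0)); last exact: is_derive_const.
  by move=> t; rewrite E (pn0E H) Rmult_0_r Rplus_0_r.
have [p1' [H1 D1]] := IH p1 H.
exists (fun x => p1 x + x * p1' x); split; first by apply: pn_add => //; apply: pn_mulX.
move=> x; apply: (@is_derive_ext _ _ (fun t => c0 + t * p1 t)); first by move=> t; rewrite E.
auto_derive; first by exists (p1' x); apply: D1.
by rewrite (is_derive_unique _ _ _ (D1 x)); ring.
Qed.

Lemma pn_factor n p c : pn n.+1 p -> exists q, pn n q /\ forall x, p x = p c + (x - c) * q x.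
Proof.
elim: n p => [|n IH] p /pnS [c0 [p1 [H E]]].
  exists (fun _ => 0); split; first exact: pn0.
  by move=> x; rewrite !E !(pn0E H); ring.
have [q1 [H1 E1]] := IH p1 H.
exists (fun x => p1 c + x * q1 x); split; first by apply: pn_add; [apply: pn_const|apply: pn_mulX].
by move=> x; rewrite !E (E1 x); ring.
Qed.

(** * Functions with bounded derivatives *)

(* Derivatives are taken along [Dm], while the bounds hold on [Bd]: the outputs of the operator
   are differentiable on [-1, 1] only, everything else on the whole line. *)
Fixpoint cb (Dm Bd : R -> Prop) (m : nat) (B : R) (f : R -> R) : Prop :=
  (forall x, Bd x -> Rabs (f x) <= B) /\
  match m with
  | 0%nat => forall x, Dm x -> limit1_in f Dm (f x) x
  | m'.+1 => exists f', (forall x, Dm x -> D_in f f' Dm x) /\ cb Dm Bd m' B f'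
  end.

Section Cb.
Variables Dm Bd : R -> Prop.

Lemma D_in_cont f f' x : D_in f f' Dm x -> limit1_in f Dm (f x) x.
Proof.
move/cont_deriv => H eps Heps; have [al [Hal H1]] := H eps Heps.
exists al; split=> // y [Hy Hd].
have [->|ne] := Req_dec y x; first by rewrite /= /Rdist Rminus_diag Rabs_R0.
by apply: H1; split=> //; split=> //; apply: not_eq_sym.
Qed.

Lemma cb_S m B f : cb Dm Bd m.+1 B f -> cb Dm Bd m B f.
Proof.
elim: m f => [|m IH] f [H1 [f' [H2 H3]]]; split=> //.
  by move=> x Hx; apply: D_in_cont (H2 x Hx).
by exists f'; split=> //; apply: IH.
Qed.

Lemma cb_le m B B' f : B <= B' -> cb Dm Bd m B f -> cb Dm Bd m B' f.
Proof.
move=> le; elim: m f => [|m IH] f [H1 H2]; split=> //; try by move=> x Hx; have := H1 x Hx; lra.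
by case: H2 => f' [H2 H3]; exists f'; split=> //; apply: IH.
Qed.

Lemma cb_add m B1 B2 f g : cb Dm Bd m B1 f -> cb Dm Bd m B2 g ->
  cb Dm Bd m (B1 + B2) (fun x => f x + g x).
Proof.
elim: m f g => [|m IH] f g [F1 F2] [G1 G2]; split.
- by move=> x Hx; have := F1 x Hx; have := G1 x Hx; have := Rabs_triang (f x) (g x); lra.
- by move=> x Hx; apply: limit_plus; [apply: F2|apply: G2].
- by move=> x Hx; have := F1 x Hx; have := G1 x Hx; have := Rabs_triang (f x) (g x); lra.
- case: F2 => f' [F2 F3]; case: G2 => g' [G2 G3].
  exists (fun x => f' x + g' x); split; last exact: IH.
  by move=> x Hx; apply: Dadd; [apply: F2|apply: G2].
Qed.

Lemma Rabs_mult_le x y B1 B2 : Rabs x <= B1 -> Rabs y <= B2 -> Rabs (x * y) <= B1 * B2.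
Proof. by move=> H1 H2; rewrite Rabs_mult; apply: Rmult_le_compat => //; apply: Rabs_pos. Qed.

(** Every application of the product rule replaces one product by two, whence the factor [2 ^ m]. *)
Lemma cb_mul m B1 B2 f g : 0 <= B1 -> 0 <= B2 -> cb Dm Bd m B1 f -> cb Dm Bd m B2 g ->
  cb Dm Bd m (2 ^ m * (B1 * B2)) (fun x => f x * g x).
Proof.
move=> p1 p2; have p12 : 0 <= B1 * B2 by nra.
elim: m f g => [|m IH] f g F G.
  case: F G => [F1 F2] [G1 G2]; split.
    by move=> x Hx; rewrite /= Rmult_1_l; apply: Rabs_mult_le; [apply: F1|apply: G1].
  by move=> x Hx; apply: limit_mul; [apply: F2|apply: G2].
have HF := cb_S F; have HG := cb_S G.
case: F G => [F1 [f' [F2 F3]]] [G1 [g' [G2 G3]]]; split.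
  move=> x Hx; apply: Rle_trans (Rabs_mult_le (F1 x Hx) (G1 x Hx)) _.
  by have := pow_R1_Rle 2 m.+1 ltac:(lra); nra.
exists (fun x => f' x * g x + f x * g' x); split.
  by move=> x Hx; apply: Dmult; [apply: F2|apply: G2].
rewrite (_ : 2 ^ m.+1 * (B1 * B2) = 2 ^ m * (B1 * B2) + 2 ^ m * (B1 * B2)); last by rewrite /=; ring.
by apply: cb_add; apply: IH.
Qed.

Lemma cb_const m B c : Rabs c <= B -> cb Dm Bd m B (fun _ => c).
Proof.
elim: m c => [|m IH] c H; split=> //.
  by move=> x _; apply: (limit_free (fun _ => c) _ 0).
exists (fun _ => 0); split; first by move=> x _; apply: Dconst.
by apply: IH; rewrite Rabs_R0; have := Rabs_pos c; lra.
Qed.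

Lemma cb_scal m B c f : cb Dm Bd m B f -> cb Dm Bd m (Rabs c * B) (fun x => c * f x).
Proof.
elim: m f => [|m IH] f [F1 F2]; split.
- by move=> x Hx; rewrite Rabs_mult; apply: Rmult_le_compat_l; [apply: Rabs_pos|apply: F1].
- by move=> x Hx; apply: limit_mul; [apply: (limit_free (fun _ => c) _ 0)|apply: F2].
- by move=> x Hx; rewrite Rabs_mult; apply: Rmult_le_compat_l; [apply: Rabs_pos|apply: F1].
- case: F2 => f' [F2 F3]; exists (fun x => c * f' x); split; last exact: IH.
  by move=> x Hx; apply: Dmult_const; apply: F2.
Qed.

End Cb.

Lemma cb_restrict (Dm Dm' Bd Bd' : R -> Prop) m B f :
  (forall x, Dm' x -> Dm x) -> (forall x, Bd' x -> Bd x) ->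
  cb Dm Bd m B f -> cb Dm' Bd' m B f.
Proof.
move=> HD HB; elim: m f => [|m IH] f [F1 F2]; split.
- by move=> x /HB; apply: F1.
- move=> x Hx eps Heps; have [al [Hal H1]] := F2 x (HD x Hx) eps Heps.
  by exists al; split=> // y [Hy Hd]; apply: H1; split=> //; apply: HD.
- by move=> x /HB; apply: F1.
- case: F2 => f' [F2 F3]; exists f'; split; last exact: IH.
  move=> x Hx eps Heps; have [al [Hal H1]] := F2 x (HD x Hx) eps Heps.
  exists al; split=> // y [[Hy Hne] Hd]; apply: H1; split=> //; split=> //; exact: HD.
Qed.

Definition itv (a b x : R) : Prop := a <= x <= b.

(** With [derivs_cb], the passage between [cb], which hides the derivatives existentially, and the
    explicit sequences of derivatives in which the assumptions are phrased. *)
Lemma cb_derivs a b m B f : cb (itv a b) (itv a b) m B f ->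
  exists D, derivs_on a b m f D /\ forall l x, (l <= m)%nat -> a <= x <= b -> Rabs (D l x) <= B.
Proof.
elim: m f => [|m IH] f [F1 F2].
  exists (fun _ => f); split; last by move=> l x _; apply: F1.
  split=> //; split=> // x Hx eps Heps.
  have [al [Hal H1]] := F2 x Hx eps Heps.
  by exists al; split=> // y Hy Hd; apply: H1; split.
case: F2 => f' [F2 /IH [D [[D0 [D1 D2]] DB]]].
exists (fun l => if l is l'.+1 then D l' else f); split; last first.
  by move=> [|l] x Hl Hx; [apply: F1|apply: DB].
split=> //; split; last by [].
move=> [|l] Hl x Hx; last exact: D1.
move=> eps Heps; have [al [Hal H1]] := F2 x Hx eps Heps.
exists al; split=> // y Hy Hne Hd; rewrite (D0 x Hx).
by apply: H1; split=> //; split=> //; apply: not_eq_sym.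
Qed.

Lemma derivs_cb a b m B f D : derivs_on a b m f D ->
  (forall l x, (l <= m)%nat -> a <= x <= b -> Rabs (D l x) <= B) ->
  cb (itv a b) (itv a b) m B f.
Proof.
elim: m f D => [|m IH] f D [D0 [D1 D2]] DB; split.
- by move=> x Hx; rewrite -D0 //; apply: DB.
- move=> x Hx eps Heps; have [al [Hal H1]] := D2 x Hx eps Heps.
  by exists al; split=> // y [Hy Hd]; rewrite -!D0 //; apply: H1.
- by move=> x Hx; rewrite -D0 //; apply: DB.
- exists (D 1%nat); split; last first.
    apply: (IH _ (fun l => D l.+1)) => //; last by move=> l x Hl Hx; apply: DB.
    by split=> //; split=> // l Hl; apply: D1.
  move=> x Hx eps Heps; have [al [Hal H1]] := D1 0%nat isT x Hx eps Heps.
  exists al; split=> // y [[Hy Hne] Hd]; rewrite -!D0 //; apply: H1 => //; exact: not_eq_sym.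
Qed.

Lemma D_in_is_derive f f' x : D_in f f' no_cond x <-> is_derive f x (f' x).
Proof. by rewrite derivable_pt_lim_D_in is_derive_Reals. Qed.

(** A slope of modulus at most one keeps the bound unchanged at every order. For the map from the
    reference interval the slope is [tau / 2], so that mesh widths at most one are admissible. *)
Lemma cb_comp_affine (Bd Bd' : R -> Prop) m B f al be :
  Rabs be <= 1 -> (forall s, Bd' s -> Bd (al + be * s)) ->
  0 <= B -> cb no_cond Bd m B f -> cb no_cond Bd' m B (fun s => f (al + be * s)).
Proof.
move=> Hbe HBd pB; elim: m f => [|m IH] f F.
  case: F => [F1 F2]; split; first by move=> x Hx; apply: F1; apply: HBd.
  move=> x _ eps Heps; have [al' [Hal H1]] := F2 (al + be * x) I eps Heps.
  exists al'; split=> // y [_ Hd]; apply: H1; split=> //.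
  move: Hd; rewrite /= /Rdist (_ : al + be * y - _ = be * (y - x)); last ring.
  by rewrite Rabs_mult; have := Rabs_pos (y - x); have := Rabs_pos be; nra.
case: F => [F1 [f' [F2 F3]]]; split; first by move=> x Hx; apply: F1; apply: HBd.
exists (fun s => be * f' (al + be * s)); split.
  move=> x _; apply/D_in_is_derive.
  have /D_in_is_derive H := F2 (al + be * x) I.
  apply: is_derive_comp H _; auto_derive => //; ring.
apply: (@cb_le _ _ _ (Rabs be * B)); first by nra.
by apply: cb_scal; apply: IH.
Qed.

Lemma mvt_bound f f' x y K : x <= y ->
  (forall t, x <= t <= y -> is_derive f t (f' t)) ->
  (forall t, x <= t <= y -> Rabs (f' t) <= K) -> Rabs (f y - f x) <= K * (y - x).
Proof.
move=> le Hd HK; have [||c [Hc ->]] := @MVT_gen f x y f'.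
- by rewrite Rmin_left // Rmax_right // => t Ht; apply: Hd; lra.
- rewrite Rmin_left // Rmax_right // => t Ht; apply: derivable_continuous_pt.
  by apply: ex_derive_Reals_0; exists (f' t); apply: Hd.
rewrite Rmin_left // Rmax_right // in Hc.
rewrite Rabs_mult (Rabs_pos_eq (y - x)); last lra.
by apply: Rmult_le_compat_r; [lra|apply: HK].
Qed.

Lemma is_derive_cont (f : R -> R) (f' x : R) : is_derive f x f' -> continuous f x.
Proof. by move=> H; apply: ex_derive_continuous; exists f'. Qed.

(* The index [x] ranges over all steps of all meshes: constants that do not depend on [x] are
   independent of the mesh. *)
Section Fam.
Variable X : Type.
Implicit Types (lo hi w : X -> R) (g : X -> R -> R).

(** The weight [w] is the size of the family: [1] for boundedness, a power of [tau] for a small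
    quantity. All orders [m] are covered, since the functionals see derivatives up to orders such as
    [kI]; the constant may depend on [m] but not on the index [x]. *)
Definition fam lo hi w g : Prop :=
  forall m, exists B, 0 <= B /\ forall x, cb no_cond (itv (lo x) (hi x)) m (B * w x) (g x).

Lemma fam_ext lo hi w g g' : (forall x s, g x s = g' x s) -> fam lo hi w g -> fam lo hi w g'.
Proof.
move=> E; have -> // : g' = g.
by apply: functional_extensionality => x; apply: functional_extensionality.
Qed.

Lemma fam_bd lo hi w g : fam lo hi w g ->
  exists B, 0 <= B /\ forall x s, lo x <= s <= hi x -> Rabs (g x s) <= B * w x.
Proof. by move=> /(_ 0%nat) [B [HB H]]; exists B; split=> // x; case: (H x). Qed.

Lemma fam_derive lo hi w g : fam lo hi w g -> forall x s, is_derive (g x) s (Derive (g x) s).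
Proof.
move=> /(_ 1%nat) [B [_ H]] x s; case: (H x) => _ [f' [/(_ s I) /D_in_is_derive D _]].
by apply: Derive_correct; exists (f' s).
Qed.

Lemma fam_Derive lo hi w g : fam lo hi w g -> fam lo hi w (fun x => Derive (g x)).
Proof.
move=> F m; have [B [HB H]] := F m.+1; exists B; split=> // x.
case: (H x) => _ [f' [D C]].
have -> // : Derive (g x) = f'.
by apply: functional_extensionality => s; apply: is_derive_unique; apply/D_in_is_derive; apply: D.
Qed.

(** The way antiderivatives enter the calculus: only the values of [g] need a bound of their own,
    all derivatives inherit theirs from [g']. *)
Lemma fam_cons lo hi w g g' : (forall x, 0 <= w x) ->
  (exists B, forall x s, lo x <= s <= hi x -> Rabs (g x s) <= B * w x) ->
  (forall x s, is_derive (g x) s (g' x s)) -> fam lo hi w g' -> fam lo hi w g.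
Proof.
move=> w0 [B0 HB0] D F.
have H m : exists B, 0 <= B /\ forall x, cb no_cond (itv (lo x) (hi x)) m.+1 (B * w x) (g x).
  have [B [HB H]] := F m; exists (Rabs B0 + B); split; first by have := Rabs_pos B0; lra.
  move=> x; split.
    by move=> s Hs; have := HB0 x s Hs; have := w0 x; have := Rle_abs B0; nra.
  exists (g' x); split; first by move=> s _; apply/D_in_is_derive.
  apply: cb_le (H x); have := w0 x; have := Rabs_pos B0; nra.
by move=> m; have [B [HB HH]] := H m; exists B; split=> // x; apply: cb_S.
Qed.

Lemma fam_weaken lo hi w w' g K : 0 <= K -> (forall x, w x <= K * w' x) ->
  fam lo hi w g -> fam lo hi w' g.
Proof.
move=> K0 H F m; have [B [HB HH]] := F m; exists (B * K); split; first nra.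
by move=> x; apply: cb_le (HH x); have := H x; nra.
Qed.

Lemma fam_add lo hi w g h : fam lo hi w g -> fam lo hi w h ->
  fam lo hi w (fun x s => g x s + h x s).
Proof.
move=> G H m; have [B [HB G']] := G m; have [B' [HB' H']] := H m.
exists (B + B'); split; first lra.
by move=> x; rewrite Rmult_plus_distr_r; apply: cb_add.
Qed.

Lemma fam_mul lo hi w w' g h : (forall x, 0 <= w x) -> (forall x, 0 <= w' x) ->
  fam lo hi w g -> fam lo hi w' h -> fam lo hi (fun x => w x * w' x) (fun x s => g x s * h x s).
Proof.
move=> p p' G H m; have [B [HB G']] := G m; have [B' [HB' H']] := H m.
exists (2 ^ m * (B * B')); split; first by apply: Rmult_le_pos; [apply: pow_le; lra|apply: Rmult_le_pos].
move=> x; rewrite (_ : _ * _ = 2 ^ m * ((B * w x) * (B' * w' x))); last ring.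
by apply: cb_mul => //; apply: Rmult_le_pos.
Qed.

Lemma fam_const lo hi w (c : X -> R) : (exists B, forall x, Rabs (c x) <= B * w x) ->
  (forall x, 0 <= w x) -> fam lo hi w (fun x _ => c x).
Proof.
move=> [B HB] p m; exists (Rabs B); split; first exact: Rabs_pos.
move=> x; apply: cb_const; apply: Rle_trans (HB x) _.
by apply: Rmult_le_compat_r => //; apply: Rle_abs.
Qed.

Lemma fam_scal lo hi w g c : fam lo hi w g -> fam lo hi w (fun x s => c * g x s).
Proof.
move=> G m; have [B [HB G']] := G m; exists (Rabs c * B); split.
  by have := Rabs_pos c; nra.
by move=> x; rewrite Rmult_assoc; apply: cb_scal.
Qed.

Lemma fam_sub lo hi w g h : fam lo hi w g -> fam lo hi w h ->
  fam lo hi w (fun x s => g x s - h x s).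
Proof.
move=> G H; apply: (@fam_ext _ _ _ (fun x s => g x s + -1 * h x s)); first by move=> *; ring.
by apply: fam_add => //; apply: fam_scal.
Qed.

Lemma fam_sum lo hi w (I : Type) (s : seq I) (F : I -> X -> R -> R) : (forall x, 0 <= w x) ->
  (forall i, fam lo hi w (F i)) -> fam lo hi w (fun x t => \big[Rplus/0]_(i <- s) F i x t).
Proof.
move=> p H; elim: s => [|i s IH].
  apply: (@fam_ext _ _ _ (fun x _ => 0)); first by move=> *; rewrite big_nil.
  by apply: fam_const => //; exists 0 => x; rewrite Rabs_R0; lra.
apply: (@fam_ext _ _ _ (fun x t => F i x t + \big[Rplus/0]_(i <- s) F i x t)).
  by move=> *; rewrite big_cons.
exact: fam_add.
Qed.

Lemma fam_bounded_id lo hi w : (forall x, 0 <= w x) ->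
  (exists B, forall x s, lo x <= s <= hi x -> Rabs s <= B * w x) ->
  (exists B, forall x, 1 <= B * w x) -> fam lo hi w (fun _ s => s).
Proof.
move=> p H [B H1]; apply: (@fam_cons _ _ _ _ (fun _ _ => 1)) => //.
  by move=> x s; apply: is_derive_id.
by apply: fam_const => //; exists B => x; rewrite Rabs_R1.
Qed.

(** Since the intervals have length at most one, integration from the left end preserves the
    weight. *)
Lemma fam_RInt lo hi w g : (forall x, lo x <= hi x <= lo x + 1) -> (forall x, 0 <= w x) ->
  fam lo hi w g -> fam lo hi w (fun x t => RInt (g x) (lo x) t) /\
    forall x t, is_derive (fun t => RInt (g x) (lo x) t) t (g x t).
Proof.
move=> Hlo p F.
have C x s : continuous (g x) s by apply: is_derive_cont (fam_derive F x s).
have E x s t : ex_RInt (g x) s t by apply: ex_RInt_continuous => *.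
have D x t : is_derive (fun t => RInt (g x) (lo x) t) t (g x t).
  apply: (@is_derive_RInt _ (g x) _ (lo x)) => //.
  by apply: filter_forall => s; apply: RInt_correct.
split=> //; apply: (fam_cons p _ D F).
have [B [HB H]] := fam_bd F; exists B => x s Hs.
have := @abs_RInt_le_const (g x) (lo x) s (B * w x) ltac:(lra) (E x _ _).
have := Hlo x; have := p x => H1 H2 H3.
apply: Rle_trans (H3 _) _; first by move=> t Ht; apply: H; lra.
have : 0 <= B * w x by nra.
nra.
Qed.

End Fam.

Lemma is_derive_Rsum (I : Type) (s : seq I) (F F' : I -> R -> R) x :
  (forall i, is_derive (F i) x (F' i x)) ->
  is_derive (fun t => \big[Rplus/0]_(i <- s) F i t) x (\big[Rplus/0]_(i <- s) F' i x).
Proof.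
move=> H; elim: s => [|i s IH].
  rewrite big_nil; apply: (@is_derive_ext _ _ (fun _ => 0)); first by move=> t; rewrite big_nil.
  exact: is_derive_const.
rewrite big_cons; apply: (@is_derive_ext _ _ (fun t => F i t + \big[Rplus/0]_(i <- s) F i t)).
  by move=> t; rewrite big_cons.
exact: is_derive_plus.
Qed.

(** * Taylor expansion on the reference interval *)

Section Taylor.
Variables (X : Type) (a b : X -> R).
Hypothesis hab : forall x, a x < b x <= a x + 1.
Let tau x := b x - a x.

Definition hat (g : X -> R -> R) (x : X) (s : R) : R := g x (Tmap (a x) (b x) s).

Definition hfam (w : X -> R) (g : X -> R -> R) : Prop := fam (fun _ => -1) (fun _ => 1) w g.

Lemma fam_hat w g : (forall x, 0 <= w x) -> fam a b w g -> hfam w (hat g).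
Proof.
move=> p F m; have [B [HB H]] := F m; exists B; split=> // x.
have hx := hab x.
apply: (@cb_comp_affine (itv (a x) (b x)) _ m _ (g x) ((a x + b x) / 2) ((b x - a x) / 2)) => //.
- by rewrite Rabs_pos_eq; lra.
- by move=> s; rewrite /itv; nra.
- exact: Rmult_le_pos.
Qed.

Lemma is_derive_hat (g g' : X -> R -> R) x s :
  is_derive (g x) (Tmap (a x) (b x) s) (g' x (Tmap (a x) (b x) s)) ->
  is_derive (hat g x) s (tau x / 2 * hat g' x s).
Proof.
move=> H; apply: is_derive_comp H _; rewrite /Tmap; auto_derive => //; rewrite /tau; field.
Qed.

Lemma pow_tau_ge0 q x : 0 <= tau x ^ q.
Proof. by apply: pow_le; rewrite /tau; have := hab x; lra. Qed.

Lemma Tmap_m1 x : Tmap (a x) (b x) (-1) = a x.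
Proof. by rewrite /Tmap; field. Qed.

Lemma Tmap_1 x : Tmap (a x) (b x) 1 = b x.
Proof. by rewrite /Tmap; field. Qed.

(* The powers of [1 + s] rather than [t - a] keep the factors [tau ^ i] visible. *)
Lemma hat_taylor q (g : X -> R -> R) : fam a b (fun _ => 1) g ->
  exists (c : nat -> X -> R) (w : X -> R -> R),
    (exists B, 0 <= B /\ forall i x, Rabs (c i x) <= B) /\
    hfam (fun x => tau x ^ q) w /\
    (forall x s, hat g x s = \big[Rplus/0]_(i < q) (c i x * (tau x * (1 + s)) ^ i) + w x s) /\
    ((0 < q)%nat -> forall x, w x (-1) = 0).
Proof.
elim: q g => [|q IH] g F.
  exists (fun _ _ => 0), (hat g); split; first by exists 0; split=> [|i x]; rewrite ?Rabs_R0; lra.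
  split; first by apply: fam_hat => // x /=; lra.
  by split=> // x s; rewrite big_ord0; ring.
have [c [w [[B [B0 HB]] [Hw [E _]]]]] := IH _ (fam_Derive F).
have [Bg [Bg0 HBg]] := fam_bd F.
(* Termwise integration of the expansion of the derivative: the chain rule contributes [tau / 2],
   and the [tau] in it is absorbed by the next power of [tau * (1 + s)], leaving the factor
   [1 / (2 (j + 1))]. *)
pose c' i x := if i is j.+1 then c j x / (2 * INR j.+1) else g x (a x).
pose w' x s := hat g x s - \big[Rplus/0]_(i < q.+1) (c' i x * (tau x * (1 + s)) ^ i).
have w'0 x : w' x (-1) = 0.
  rewrite /w' /hat Tmap_m1 big_ord_recl /= big1 => [|i _]; first by ring.
  by rewrite (_ : 1 + -1 = 0); ring.
have D x s : is_derive (w' x) s (tau x / 2 * w x s).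
  have -> : tau x / 2 * w x s = tau x / 2 * hat (fun x => Derive (g x)) x s -
      \big[Rplus/0]_(i < q.+1) (c' i x * (INR i * tau x * (tau x * (1 + s)) ^ i.-1)).
    rewrite (_ : \big[_/_]_(i < q.+1) _ = tau x / 2 *
      \big[Rplus/0]_(i < q) (c i x * (tau x * (1 + s)) ^ i)); first by rewrite E; ring.
    rewrite big_ord_recl Rsum_scal [INR (nat_of_ord ord0)]/= !Rmult_0_l Rmult_0_r Rplus_0_l.
    apply: eq_bigr => i _; rewrite lift0 /c' -pred_Sn.
    have := S_INR i; have := pos_INR i => H1 H2.
    by move: (INR i.+1) H2 => y H2; field; lra.
  apply: is_derive_minus; first by apply: is_derive_hat; apply: fam_derive F _ _.
  apply: (@is_derive_Rsum _ _ (fun i t => c' (nat_of_ord i) x * (tau x * (1 + t)) ^ i)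
   (fun i t => c' (nat_of_ord i) x * (INR i * tau x * (tau x * (1 + t)) ^ i.-1))) => i.
  by auto_derive => //; rewrite /=; ring.
have pt : forall x, 0 <= tau x ^ q.+1 by apply: pow_tau_ge0.
(* The factor [tau] of the chain rule raises the weight from [tau ^ q] to [tau ^ q.+1]. *)
have Fw : hfam (fun x => tau x ^ q.+1) (fun x s => tau x / 2 * w x s).
  apply: (@fam_ext _ _ _ _ (fun x s => tau x * (1 / 2 * w x s))); first by move=> *; field.
  apply: (@fam_mul _ _ _ tau (fun x => tau x ^ q)).
  - by move=> x; rewrite /tau; have := hab x; lra.
  - exact: pow_tau_ge0.
  - apply: fam_const => [|x]; last by rewrite /tau; have := hab x; lra.
    by exists 1 => x; rewrite Rabs_pos_eq /tau; have := hab x; lra.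
  - exact: fam_scal.
exists c', w'; split.
  exists (B + Bg); split; first lra.
  move=> [|i] x /=.
    by have := HBg x (a x); have := hab x => H1 H2; have := H2 ltac:(lra); lra.
  rewrite -/(INR i.+1) /Rdiv Rabs_mult Rabs_inv (Rabs_pos_eq (2 * _)); last first.
    by have := pos_INR i.+1; lra.
  have H1 := HB i x; have H2 := Rabs_pos (c i x).
  have H3 : 1 <= INR i.+1 by rewrite S_INR; have := pos_INR i; lra.
  have : / (2 * INR i.+1) <= 1 by rewrite -Rinv_1; apply: Rinv_le_contravar; lra.
  have : 0 < / (2 * INR i.+1) by apply: Rinv_0_lt_compat; lra.
  nra.
split; last by split=> [x s|//]; rewrite /w'; ring.
apply: (fam_cons pt _ D Fw).
have [K [K0 HK]] := fam_bd Fw.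
exists (K * 2) => x s Hs.
have -> : w' x s = w' x s - w' x (-1) by rewrite w'0; ring.
apply: Rle_trans (_ : K * tau x ^ q.+1 * (s - -1) <= _); last first.
  have : 0 <= K * tau x ^ q.+1 by apply: Rmult_le_pos.
  nra.
apply: (@mvt_bound _ (fun s => tau x / 2 * w x s)); first lra.
  by move=> t _; apply: D.
by move=> t Ht; apply: HK; lra.
Qed.

End Taylor.

(** * Composition with smooth functions of several variables *)

(** Quantifying over all smaller radii makes the property stable under minima. *)
Lemma finite_delta (I : finType) (P : I -> R -> Prop) :
  (forall i, exists dl, 0 < dl /\ forall d', 0 < d' <= dl -> P i d') ->
  exists dl, 0 < dl /\ forall d', 0 < d' <= dl -> forall i, P i d'.
Proof.
move=> H.
suff [dl [H0 H1]] : exists dl, 0 < dl /\ forall d', 0 < d' <= dl ->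
    forall i, i \in enum I -> P i d'.
  by exists dl; split=> // d' Hd i; apply: H1 => //; rewrite mem_enum.
elim: (enum I) => [|i s [dl [H0 H1]]]; first by exists 1; split; [lra|].
have [dl' [H0' H1']] := H i; exists (Rmin dl dl'); split; first exact: Rmin_pos.
move=> d' Hd j; rewrite inE => /orP[/eqP ->|Hj].
  by apply: H1'; have := Rmin_r dl dl'; lra.
by apply: H1 => //; have := Rmin_l dl dl'; lra.
Qed.

Lemma mvt_between f x y : (forall t, ex_derive f t) ->
  exists c, Rabs (c - x) <= Rabs (y - x) /\ f y - f x = Derive f c * (y - x).
Proof.
move=> H; have [t _|t _|c [Hc E]] := @MVT_gen f x y (Derive f).
- exact: Derive_correct.
- by apply: derivable_continuous_pt; apply: ex_derive_Reals_0.
exists c; split=> //; move: Hc; rewrite /Rmin /Rmax; case: Rle_dec => le Hc; split_Rabs; lra.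
Qed.

Lemma Rsum_telescope n (F : nat -> R) : \big[Rplus/0]_(i < n) (F i.+1 - F i) = F n - F 0%nat.
Proof.
elim: n => [|n IH]; first by rewrite big_ord0; ring.
by rewrite big_ord_recr IH /=; ring.
Qed.

Section Smooth.
Variable d : nat.
Implicit Types (G : R -> vec d -> R) (y : vec d).

Lemma iter_pd_cat G l e : iter_pd (pd G e) l = iter_pd G (l ++ [:: e]).
Proof. by elim: l => //= e' l ->. Qed.

Lemma smooth_pd G e : smooth_scalar G -> smooth_scalar (pd G e).
Proof. by move=> H l; rewrite iter_pd_cat; apply: H. Qed.

Lemma smooth_jcont G : smooth_scalar G -> jcont G.
Proof. by move=> H; case: (H [::]). Qed.

Lemma smooth_ex_pd G e : smooth_scalar G -> ex_pd G e.
Proof. by move=> H; case: (H [::]). Qed.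

Lemma upd_upd y i s s' : upd (upd y i s) i s' = upd y i s'.
Proof. by apply: functional_extensionality => j; rewrite /upd; case: eqP. Qed.

Lemma is_derive_upd G y i t s : smooth_scalar G ->
  is_derive (fun s => G t (upd y i s)) s (pd G (Some i) t (upd y i s)).
Proof.
move=> H; have /= := @smooth_ex_pd G (Some i) H t (upd y i s).
have -> : upd y i s i = s by rewrite /upd eqxx.
have -> : (fun s0 => G t (upd (upd y i s) i s0)) = (fun s0 => G t (upd y i s0)).
  by apply: functional_extensionality => s0; rewrite upd_upd.
by move/Derive_correct.
Qed.

(** Jointly continuous partial derivatives give total differentiability: time is moved first and
    then one coordinate after another, with the mean value theorem on each leg. *)
Lemma smooth_frechet G t y eps : smooth_scalar G -> 0 < eps ->
  exists dl, 0 < dl /\ forall t' y', Rabs (t' - t) < dl -> (forall j, Rabs (y' j - y j) < dl) ->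
    Rabs (G t' y' - G t y - pd G None t y * (t' - t)
          - \big[Rplus/0]_(i < d) (pd G (Some i) t y * (y' i - y i)))
      <= eps * (Rabs (t' - t) + \big[Rplus/0]_(i < d) Rabs (y' i - y i)).
Proof.
move=> HG Heps.
have [dl [dl0 Hdl]] : exists dl, 0 < dl /\ forall d', 0 < d' <= dl ->
    forall e : option 'I_d, forall t' y', Rabs (t' - t) < d' -> (forall j, Rabs (y' j - y j) < d') ->
    Rabs (pd G e t' y' - pd G e t y) < eps.
  apply: finite_delta => e.
  have [dl [H0 H1]] := @smooth_jcont _ (@smooth_pd G e HG) t y eps Heps.
  exists dl; split=> // d' Hd' t' y' Ht Hy; apply: H1; first lra.
  by move=> j; have := Hy j; lra.
have {}Hdl := Hdl dl (conj dl0 (Rle_refl _)).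
exists dl; split=> // t' y' Ht Hy.
have [c [Hc Ec]] := @mvt_between (fun s => G s y) t t' (fun s => @smooth_ex_pd G None HG s y).
(* The intermediate points of this path, with the first [m] coordinates already moved. *)
pose Y (m : nat) : vec d := fun j => if (j < m)%nat then y' j else y j.
have YS (m : 'I_d) s : upd (Y m) m s = (fun j => if j == m then s else Y m j) by [].
have Y1 (m : 'I_d) : Y m.+1 = upd (Y m) m (y' m).
  apply: functional_extensionality => j; rewrite /Y /upd ltnS leq_eqVlt.
  have -> : (j == m) = (nat_of_ord j == m) by [].
  by case: eqP => //= E; congr y'; apply: val_inj.
have Y0 (m : 'I_d) : Y m = upd (Y m) m (y m).
  apply: functional_extensionality => j; rewrite /upd; case: eqP => // ->.
  by rewrite /Y ltnn.
have Yc (m : nat) j : Rabs (Y m j - y j) < dl.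
  by rewrite /Y; case: ifP => // _; rewrite Rminus_diag Rabs_R0.
have step (m : 'I_d) : Rabs (G t' (Y m.+1) - G t' (Y m) - pd G (Some m) t y * (y' m - y m))
   <= eps * Rabs (y' m - y m).
  rewrite {1}Y1 {2}Y0.
  have [|e [He Ee]] := @mvt_between (fun s => G t' (upd (Y m) m s)) (y m) (y' m).
    by move=> s; eexists; apply: is_derive_upd.
  rewrite Ee (is_derive_unique _ _ _ (is_derive_upd _ _ _ _ HG)).
  rewrite -Rmult_minus_distr_r Rabs_mult; apply: Rmult_le_compat_r; first exact: Rabs_pos.
  apply: Rlt_le; apply: Hdl => // j; rewrite /upd; case: eqP => [->|_]; last exact: Yc.
  by have := Hy m; lra.
have first_step : Rabs (G t' y - G t y - pd G None t y * (t' - t)) <= eps * Rabs (t' - t).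
  rewrite Ec -Rmult_minus_distr_r Rabs_mult; apply: Rmult_le_compat_r; first exact: Rabs_pos.
  apply: Rlt_le; apply: (Hdl None) => [|j]; first lra.
  by rewrite Rminus_diag Rabs_R0.
have tel := @Rsum_telescope d (fun m => G t' (Y m)).
have Yd : Y d = y' by apply: functional_extensionality => j; rewrite /Y ltn_ord.
have Y00 : Y 0%nat = y by apply: functional_extensionality => j.
rewrite Yd Y00 in tel.
have -> : G t' y' - G t y - pd G None t y * (t' - t)
          - \big[Rplus/0]_(i < d) (pd G (Some i) t y * (y' i - y i)) =
   (G t' y - G t y - pd G None t y * (t' - t)) +
   \big[Rplus/0]_(m < d) (G t' (Y m.+1) - G t' (Y m) - pd G (Some m) t y * (y' m - y m)).
  rewrite (_ : \big[_/_]_(m < d) (_ - _ - _) = \big[Rplus/0]_(m < d) (G t' (Y m.+1) - G t' (Y m)) -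
    \big[Rplus/0]_(i < d) (pd G (Some i) t y * (y' i - y i))); first by rewrite tel; ring.
  rewrite /Rminus -[X in _ = _ + X]Rmult_1_l -Ropp_mult_distr_r Ropp_mult_distr_l Rsum_scal.
  by rewrite -big_split; apply: eq_bigr => i _ /=; ring.
apply: Rle_trans (Rabs_triang _ _) _; rewrite Rmult_plus_distr_l.
apply: Rplus_le_compat => //.
by rewrite Rsum_scal; apply: Rsum_abs_le => m _; apply: step.
Qed.

Lemma smooth_chain G (th : R -> R) (y : R -> vec d) t dth (dy : vec d) : smooth_scalar G ->
  is_derive th t dth -> (forall j, is_derive (fun s => y s j) t (dy j)) ->
  is_derive (fun s => G (th s) (y s)) t
    (pd G None (th t) (y t) * dth + \big[Rplus/0]_(i < d) (pd G (Some i) (th t) (y t) * dy i)).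
Proof.
move=> HG /is_derive_Reals Hth Hy; apply/is_derive_Reals => eps Heps.
set p0 := pd G None (th t) (y t); pose p i := pd G (Some i) (th t) (y t).
(* [S] bounds the total increment of the arguments per unit of [|h|]; its [INR d + 1] is slack of
   one unit for each of the [d + 1] difference quotients. [P] weights the errors of these
   quotients. *)
pose S := Rabs dth + \big[Rplus/0]_(i < d) Rabs (dy i) + (INR d + 1).
pose P := Rabs p0 + \big[Rplus/0]_(i < d) Rabs (p i).
have Sy0 : 0 <= \big[Rplus/0]_(i < d) Rabs (dy i) by apply: Rsum_ge0 => *; apply: Rabs_pos.
have S1 : 1 <= S by rewrite /S; have := Rabs_pos dth; have := pos_INR d; lra.
have P0 : 0 <= P.
  have : 0 <= \big[Rplus/0]_(i < d) Rabs (p i) by apply: Rsum_ge0 => *; apply: Rabs_pos.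
  by rewrite /P; have := Rabs_pos p0; lra.
(* The budget: [eps / 2] for the remainder of the total derivative, [eps / 4] for the difference
   quotients. *)
pose e2 := eps / (2 * S); pose e1 := Rmin 1 (eps / (4 * (P + 1))).
have e2p : 0 < e2 by apply: Rdiv_lt_0_compat; lra.
have e1p : 0 < e1 by apply: Rmin_pos; [lra|apply: Rdiv_lt_0_compat; lra].
have e11 : e1 <= 1 by apply: Rmin_l.
have e1P : P * e1 <= eps / 4.
  have : e1 <= eps / (4 * (P + 1)) by apply: Rmin_r.
  have -> : eps / 4 = (P + 1) * (eps / (4 * (P + 1))) by field; lra.
  nra.
have [dF [dF0 HF]] := @smooth_frechet G (th t) (y t) e2 HG e2p.
have [d1 Hd1] := Hth e1 e1p.
have [d2 [d20 Hd2]] : exists dl, 0 < dl /\ forall d', 0 < d' <= dl -> forall i : 'I_d,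
    forall h, h <> 0 -> Rabs h < d' -> Rabs ((y (t + h) i - y t i) / h - dy i) < e1.
  apply: finite_delta => i; have /is_derive_Reals /(_ e1 e1p) [dl H] := Hy i.
  exists dl; split; first exact: cond_pos.
  by move=> d' Hd' h h0 Hh; apply: H => //; lra.
have {}Hd2 := Hd2 d2 (conj d20 (Rle_refl _)).
have dFS : 0 < dF / S by apply: Rdiv_lt_0_compat; lra.
have d0 : 0 < Rmin (dF / S) (Rmin d1 d2).
  by apply: Rmin_pos => //; apply: Rmin_pos => //; apply: cond_pos.
exists (mkposreal _ d0) => h h0 /= Hh.
have [h1 h2] : Rabs h < dF / S /\ Rabs h < Rmin d1 d2.
  by have := Rmin_l (dF / S) (Rmin d1 d2); have := Rmin_r (dF / S) (Rmin d1 d2); lra.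
have [h3 h4] : Rabs h < d1 /\ Rabs h < d2.
  by have := Rmin_l d1 d2; have := Rmin_r d1 d2; lra.
have hS : S * Rabs h < dF by rewrite Rmult_comm; apply/Rlt_div_r; lra.
have hp := Rabs_pos_lt h h0.
have lin (f0 f1 df : R) : Rabs ((f1 - f0) / h - df) < e1 ->
    Rabs (f1 - f0 - df * h) <= e1 * Rabs h /\ Rabs (f1 - f0) <= (Rabs df + 1) * Rabs h.
  move=> H; have E : f1 - f0 - df * h = ((f1 - f0) / h - df) * h by field.
  have H1 : Rabs (f1 - f0 - df * h) <= e1 * Rabs h by rewrite E Rabs_mult; nra.
  split=> //; have -> : f1 - f0 = (f1 - f0 - df * h) + df * h by ring.
  by apply: Rle_trans (Rabs_triang _ _) _; rewrite Rabs_mult; nra.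
have [Ath Bth] := lin _ _ _ (Hd1 h h0 h3).
have Ay i := (lin _ _ _ (Hd2 i h h0 h4)).1; have By i := (lin _ _ _ (Hd2 i h h0 h4)).2.
have dyS i : Rabs (dy i) + 1 <= S.
  have : Rabs (dy i) <= \big[Rplus/0]_(i < d) Rabs (dy i).
    by apply: (@Rsum_term_le _ (fun i : 'I_d => Rabs (dy i))) => j; apply: Rabs_pos.
  by rewrite /S; have := Rabs_pos dth; have := pos_INR d; lra.
have dthS : Rabs dth + 1 <= S by rewrite /S; have := pos_INR d; lra.
have {HF} := HF (th (t + h)) (y (t + h)) _ _.
set D0 := th (t + h) - th t in Ath Bth *.
move/(_ ltac:(nra)) => HF.
have {HF} := HF (fun i => ltac:(have := By i; have := dyS i; nra)).
set err := G _ _ - _ - _ - _ => Herr.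
have HS : Rabs D0 + \big[Rplus/0]_(i < d) Rabs (y (t + h) i - y t i) <= S * Rabs h.
  have : \big[Rplus/0]_(i < d) Rabs (y (t + h) i - y t i) <=
     \big[Rplus/0]_(i < d) (Rabs h * Rabs (dy i)  + Rabs h).
    by apply: Rsum_le => i _; have := By i; lra.
  rewrite big_split -Rsum_scal Rsum_const_ord /S /=; lra.
have HL : Rabs (p0 * (D0 - dth * h) + \big[Rplus/0]_(i < d) (p i * (y (t + h) i - y t i - dy i * h)))
    <= P * e1 * Rabs h.
  apply: Rle_trans (Rabs_triang _ _) _; rewrite /P !Rmult_plus_distr_r; apply: Rplus_le_compat.
    by rewrite Rabs_mult; have := Rabs_pos p0; nra.
  rewrite Rmult_assoc Rmult_comm Rsum_scal; apply: Rsum_abs_le => i _.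
  by rewrite Rabs_mult; have := Rabs_pos (p i); have := Ay i; nra.
have E : (G (th (t + h)) (y (t + h)) - G (th t) (y t)) / h -
   (p0 * dth + \big[Rplus/0]_(i < d) (p i * dy i)) =
   (err + (p0 * (D0 - dth * h) + \big[Rplus/0]_(i < d) (p i * (y (t + h) i - y t i - dy i * h)))) / h.
  have -> : \big[Rplus/0]_(i < d) (p i * (y (t + h) i - y t i - dy i * h)) =
     \big[Rplus/0]_(i < d) (p i * (y (t + h) i - y t i)) + - h * \big[Rplus/0]_(i < d) (p i * dy i).
    by rewrite Rsum_scal -big_split; apply: eq_bigr => i _ /=; ring.
  rewrite /err -/p0 -/D0 -[\big[_/_]_(i < d) (pd _ _ _ _ * _)]/(\big[Rplus/0]_(i < d) (p i * (y (t + h) i - y t i))).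
  by field.
rewrite E /Rdiv Rabs_mult Rabs_inv.
apply: (Rmult_lt_reg_r (Rabs h)) => //.
rewrite Rmult_assoc Rinv_l ?Rmult_1_r; last lra.
apply: Rle_lt_trans (Rabs_triang _ _) _.
have : e2 * (S * Rabs h) = eps / 2 * Rabs h by rewrite /e2; field; lra.
have : e2 * (Rabs D0 + \big[Rplus/0]_(i < d) Rabs (y (t + h) i - y t i)) <= e2 * (S * Rabs h).
  by apply: Rmult_le_compat_l; lra.
have : P * e1 * Rabs h <= eps / 4 * Rabs h by apply: Rmult_le_compat_r; lra.
have : 0 < eps * Rabs h by nra.
lra.
Qed.

(** Translation to the nested pairs on which compactness of boxes is stated; entry [0] will be
    time. *)
Fixpoint tuple_of (n : nat) (v : nat -> R) : Compactness.Tn n R :=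
  if n is n'.+1 then (v 0%nat, tuple_of n' (fun i => v i.+1)) else tt.

Fixpoint coord_of (n : nat) : Compactness.Tn n R -> nat -> R :=
  match n with
  | 0%nat => fun _ _ => 0
  | n'.+1 => fun x i => if i is i'.+1 then coord_of x.2 i' else x.1
  end.

Lemma bounded_tuple n (a b v : nat -> R) : (forall i, (i < n)%nat -> a i <= v i <= b i) ->
  bounded_n n (tuple_of n a) (tuple_of n b) (tuple_of n v).
Proof.
elim: n a b v => //= n IH a b v H; split; first exact: H.
by apply: IH => i Hi; apply: H.
Qed.

Lemma close_coord n dl (v : nat -> R) t : close_n n dl (tuple_of n v) t ->
  forall i, (i < n)%nat -> Rabs (v i - coord_of t i) < dl.
Proof.
elim: n v t => //= n IH v [t1 t2] [H1 H2] [|i] Hi //=.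
exact: (IH (fun i => v i.+1)).
Qed.

(** The compact box is covered by finitely many neighbourhoods on each of which [G] varies by less
    than one. *)
Lemma jcont_bounded G t0 t1 K : jcont G ->
  exists B, 0 <= B /\ forall t y, t0 <= t <= t1 -> (forall j, Rabs (y j) <= K) -> Rabs (G t y) <= B.
Proof.
move=> HG.
pose yof (v : nat -> R) : vec d := fun j => v (nat_of_ord j).+1.
have Hd (x : Compactness.Tn d.+1 R) : {dl : posreal | forall t' y',
    Rabs (t' - coord_of x 0) < dl -> (forall j, Rabs (y' j - yof (coord_of x) j) < dl) ->
    Rabs (G t' y' - G (coord_of x 0) (yof (coord_of x))) < 1}.
  apply: constructive_indefinite_description.
  have [dl [H0 H1]] := HG (coord_of x 0) (yof (coord_of x)) 1 ltac:(lra).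
  by exists (mkposreal dl H0).
pose lo i := if i is 0%nat then t0 else - K.
pose hi i := if i is 0%nat then t1 else K.
(* Compactness yields the finite cover only under a double negation. *)
have [l Hl] := NNPP _ (@compactness_list d.+1 (tuple_of d.+1 lo) (tuple_of d.+1 hi) (fun x => sval (Hd x))).
have [B [B0 HB]] : exists B, 0 <= B /\ forall x, List.In x l ->
   Rabs (G (coord_of x 0) (yof (coord_of x))) <= B.
  elim: {Hl} l => [|x l [B [B0 HB]]]; first by exists 0; split; [lra|].
  exists (B + Rabs (G (coord_of x 0) (yof (coord_of x)))).
  have := Rabs_pos (G (coord_of x 0) (yof (coord_of x))) => H; split; first lra.
  by move=> z [<-|/HB]; lra.
exists (B + 1); split; first lra.
move=> t y Ht Hy.
(* The value [0] for indices out of range is a mere default. *)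
pose v i := if i is i'.+1 then (if insub i' is Some j then y j else 0) else t.
have vy : yof v = y.
  by apply: functional_extensionality => j; rewrite /yof /v valK.
have [|x [Hx [_ Hc]]] := Hl (tuple_of d.+1 v).
  apply: bounded_tuple => -[|i] Hi //=.
  case: insubP => [j _ _|]; last by rewrite -ltnS Hi.
  by have := Hy j; split_Rabs; lra.
have {}Hc := close_coord Hc.
have := proj2_sig (Hd x) t y (Hc 0%nat isT) _.
rewrite -{1}vy => /(_ (fun j => Hc (nat_of_ord j).+1 (ltn_ord j))).
have := HB x Hx; split_Rabs; lra.
Qed.

End Smooth.

Section SmoothFam.
Variables (X : Type) (d : nat) (lo hi : X -> R) (U : X -> R -> vec d) (th : X -> R -> R).
Variables (t0 t1 K : R).
Hypothesis th_range : forall x s, lo x <= s <= hi x -> t0 <= th x s <= t1.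
Hypothesis U_range : forall x s, lo x <= s <= hi x -> forall j, Rabs (U x s j) <= K.
Hypothesis th_fam : fam lo hi (fun _ => 1) th.
Hypothesis U_fam : forall j, fam lo hi (fun _ => 1) (fun x s => U x s j).

(** Induction on the order of differentiation, for all smooth functions at once: the derivative of a
    composition involves compositions with the partial derivatives, which are again smooth.
    Compactness bounds each of them on the common range. *)
Lemma fam_smooth (G : R -> vec d -> R) : smooth_scalar G ->
  fam lo hi (fun _ => 1) (fun x s => G (th x s) (U x s)).
Proof.
have p1 : forall _ : X, 0 <= 1 by move=> _; lra.
(* Closure under products and sums at a fixed order [m], because the induction hypothesis supplies
   only that order for the composed factor. *)
have mulf m g h : (exists B, 0 <= B /\ forall x, cb no_cond (itv (lo x) (hi x)) m B (g x)) ->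
    fam lo hi (fun _ => 1) h ->
    exists B, 0 <= B /\ forall x, cb no_cond (itv (lo x) (hi x)) m B (fun s => g x s * h x s).
  move=> [B [B0 HB]] /(_ m) [C [C0 HC]]; exists (2 ^ m * (B * C)); split.
    by apply: Rmult_le_pos; [apply: pow_le; lra|apply: Rmult_le_pos].
  by move=> x; apply: cb_mul => //; have := HC x; rewrite Rmult_1_r.
have addf m g h : (exists B, 0 <= B /\ forall x, cb no_cond (itv (lo x) (hi x)) m B (g x)) ->
    (exists B, 0 <= B /\ forall x, cb no_cond (itv (lo x) (hi x)) m B (h x)) ->
    exists B, 0 <= B /\ forall x, cb no_cond (itv (lo x) (hi x)) m B (fun s => g x s + h x s).
  move=> [B [B0 HB]] [C [C0 HC]]; exists (B + C); split; first lra.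
  by move=> x; apply: cb_add.
pose dH (H : R -> vec d -> R) x s := pd H None (th x s) (U x s) * Derive (th x) s +
    \big[Rplus/0]_(i < d) (pd H (Some i) (th x s) (U x s) * Derive (fun s => U x s i) s).
have D H x s : smooth_scalar H -> D_in (fun s => H (th x s) (U x s)) (dH H x) no_cond s.
  move=> HH; apply/D_in_is_derive; apply: (@smooth_chain d H (th x) (U x)) => //; first exact: fam_derive th_fam _ _.
  by move=> j; apply: (fam_derive (U_fam j)).
suff cbf m : forall H, smooth_scalar H -> exists B, 0 <= B /\ forall x,
    cb no_cond (itv (lo x) (hi x)) m B (fun s => H (th x s) (U x s)).
  by move=> HG m; have [B [B0 HB]] := cbf m G HG; exists B; split=> // x; rewrite Rmult_1_r.
elim: m => [|m IH] H HH; have [B [B0 HB]] := @jcont_bounded d H t0 t1 K (smooth_jcont HH).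
  exists B; split=> // x; split; first by move=> s Hs; apply: HB; [apply: th_range|apply: (U_range Hs)].
  by move=> s _; apply: D_in_cont (D H x s HH).
have [C [C0 HC]] : exists C, 0 <= C /\ forall x, cb no_cond (itv (lo x) (hi x)) m C (dH H x).
  apply: (addf m).
    apply: (@mulf m (fun x s => pd H None (th x s) (U x s)) (fun x => Derive (th x))).
      by apply: IH; apply: smooth_pd.
    exact: fam_Derive.
  elim: (index_enum _) => [|i r IHr].
    exists 0; split; first lra.
    move=> x; rewrite (_ : (fun s => _) = (fun _ => 0)); last first.
      by apply: functional_extensionality => s; rewrite big_nil.
    by apply: cb_const; rewrite Rabs_R0; lra.
  have := @addf m (fun x s => pd H (Some i) (th x s) (U x s) * Derive (fun s => U x s i) s)
    (fun x s => \big[Rplus/0]_(i <- r) (pd H (Some i) (th x s) (U x s) * Derive (fun s => U x s i) s)) _ IHr.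
  case=> [|C [C0 HC]].
    apply: (@mulf m (fun x s => pd H (Some i) (th x s) (U x s)) (fun x => Derive (fun s => U x s i))).
      by apply: IH; apply: smooth_pd.
    exact: (fam_Derive (U_fam i)).
  exists C; split=> // x; have := HC x; congr cb; apply: functional_extensionality => s.
  by rewrite big_cons.
exists (B + C); split; first lra.
move=> x; split.
  move=> s Hs; apply: Rle_trans (_ : B <= _); last lra.
  by apply: HB; [apply: th_range|apply: (U_range Hs)].
exists (dH H x); split; first by move=> s _; apply: D.
by apply: cb_le (HC x); lra.
Qed.

End SmoothFam.

(** * Polynomials vanishing at the end points *)

(** The value at [0] gives the constant coefficient. The remaining polynomial [q] satisfies
    [x * q x = 0], so it vanishes away from [0], and at [0] by differentiating this identity. *)
Lemma poly_zero_coefs n (c : nat -> R) :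
  (forall x, \big[Rplus/0]_(m < n) (c m * x ^ m) = 0) -> forall m, (m < n)%nat -> c m = 0.
Proof.
elim: n c => [|n IH] c H m; first by rewrite ltn0.
have E x : \big[Rplus/0]_(m < n.+1) (c m * x ^ m) =
    c 0%nat + x * \big[Rplus/0]_(m < n) (c m.+1 * x ^ m).
  rewrite big_ord_recl Rsum_scal; congr (_ + _); first by rewrite /=; ring.
  by apply: eq_bigr => i _; rewrite lift0 /=; ring.
have c0 : c 0%nat = 0 by have := H 0; rewrite E; lra.
case: m => // m; rewrite ltnS; apply: (IH (fun m => c m.+1)) => x.
pose q x := \big[Rplus/0]_(m < n) (c m.+1 * x ^ m).
have qz y : y * q y = 0 by have := H y; rewrite E c0 /q; lra.
have [x0|x0] := Req_dec x 0; last by have := qz x; rewrite /q; move: (\big[_/_]_(_ < _) _) => z; nra.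
have [|q' [_ Hq]] := @pn_derive n q; first by apply: (pn_leq (leqnSn n)); exists (fun m => c m.+1).
have D1 : is_derive (fun y => y * q y) 0 (q 0).
  by auto_derive; [exists (q' 0)|ring].
have D2 : is_derive (fun y => y * q y) 0 0.
  by apply: (@is_derive_ext _ _ (fun _ => 0)); [move=> t; rewrite qz|apply: is_derive_const].
by rewrite -/(q x) x0 -(is_derive_unique _ _ _ D1) (is_derive_unique _ _ _ D2).
Qed.

Lemma pn_Derive_n n g i : pn n g -> pn n (Derive_n g i).
Proof.
move=> H; elim: i => // i /(pn_leq (leqnSn n)) /pn_derive [p' [Hp D]].
by apply: (pn_ext _ Hp) => x /=; rewrite (is_derive_unique _ _ _ (D x)).
Qed.

Lemma pn_ex_derive n g : pn n g -> forall x, ex_derive g x.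
Proof. by move=> /(pn_leq (leqnSn n)) /pn_derive [p' [_ D]] x; exists (p' x). Qed.

Lemma Derive_n_mul_linear n g c i x : pn n g ->
  Derive_n (fun x => (x - c) * g x) i x = (x - c) * Derive_n g i x + INR i * Derive_n g i.-1 x.
Proof.
move=> H; elim: i x => [|i IH] x; first by rewrite /=; ring.
have H1 := pn_ex_derive (pn_Derive_n i H); have H2 := pn_ex_derive (pn_Derive_n i.-1 H).
rewrite [LHS]/= (_ : Derive_n _ i = (fun x => (x - c) * Derive_n g i x + INR i * Derive_n g i.-1 x));
  last exact: functional_extensionality.
apply: is_derive_unique; auto_derive; first by [].
rewrite (is_derive_unique _ _ _ (Derive_correct _ _ (H1 x))).
rewrite (is_derive_unique _ _ _ (Derive_correct _ _ (H2 x))).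
by case: i {IH H1 H2} => [|i]; rewrite ?S_INR /=; ring.
Qed.

(** The last clause lets the two end points be split off in succession: at [c' <> c] the factor
    [x - c] is nonzero, so by the Leibniz rule and induction on the order the cofactor inherits the
    vanishing derivatives. *)
Lemma pn_factor_mult c e n V : pn (n + e) V -> (forall i, (i < e)%nat -> Derive_n V i c = 0) ->
  exists psi, pn n psi /\ (forall x, V x = (x - c) ^ e * psi x) /\
    forall c' e', c' <> c -> (forall i, (i < e')%nat -> Derive_n V i c' = 0) ->
      forall i, (i < e')%nat -> Derive_n psi i c' = 0.
Proof.
elim: e V => [|e IH] V; first by rewrite addn0 => H _; exists V; split=> //; split=> // x /=; ring.
rewrite addnS => HV H0.
have [q [Hq E]] := pn_factor c HV.
have EV : V = (fun x => (x - c) * q x).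
  by apply: functional_extensionality => x; rewrite E (H0 0%nat isT : V c = 0); ring.
have DV i x : Derive_n V i x = (x - c) * Derive_n q i x + INR i * Derive_n q i.-1 x.
  by rewrite EV; apply: Derive_n_mul_linear Hq.
have [i Hi|psi [Hpsi [Epsi Hroot]]] := IH q Hq.
  have := H0 i.+1 Hi; rewrite DV /= -/(INR i.+1) Rminus_diag Rmult_0_l Rplus_0_l.
  by move/Rmult_integral => [|//]; rewrite -/(INR i.+1) => H; have := not_0_INR i.+1 ltac:(lia).
exists psi; split=> //; split; first by move=> x; rewrite EV Epsi /=; ring.
move=> c' e' ne HV'; apply: Hroot => // i.
elim: i => [|i IHi] Hi.
  have := HV' 0%nat Hi; rewrite DV /= Rmult_0_l Rplus_0_r.
  by move/Rmult_integral => [|//]; lra.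
have := HV' i.+1 Hi; rewrite DV (IHi (ltnW Hi) : Derive_n q i.+1.-1 c' = 0) Rmult_0_r Rplus_0_r.
by move/Rmult_integral => [|//]; lra.
Qed.

(** Merges finitely many constants into one. [X] is often taken to be a subset type, which carries
    the side conditions under which the estimate holds. *)
Lemma finite_bound (I : finType) (X : Type) (P : I -> X -> R) (w : X -> R) :
  (forall i, exists K, 0 <= K /\ forall x, Rabs (P i x) <= K * w x) -> (forall x, 0 <= w x) ->
  exists K, 0 <= K /\ forall i x, Rabs (P i x) <= K * w x.
Proof.
move=> H w0.
suff [K [H0 H1]] : exists K, 0 <= K /\ forall i, i \in enum I -> forall x, Rabs (P i x) <= K * w x.
  by exists K; split=> // i; apply: H1; rewrite mem_enum.
elim: (enum I) => [|i s [K [H0 H1]]]; first by exists 0; split; [lra|].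
have [K' [H0' H1']] := H i; exists (K + K'); split; first lra.
move=> j; rewrite inE => /orP[/eqP ->|Hj] x; have := w0 x.
  by have := H1' x; nra.
by have := H1 j Hj x; nra.
Qed.

Lemma fam_Derive_n (X : Type) (lo hi w : X -> R) g n : fam lo hi w g ->
  fam lo hi w (fun x => Derive_n (g x) n).
Proof. by move=> H; elim: n => // n IH; apply: (fam_Derive IH). Qed.

(** * The reference functional and operator *)

Definition cbI m B f := cb (itv (-1) 1) (itv (-1) 1) m B f.

(* Smooth on the line; the bounds on [-1, 1] are then automatic. *)
Definition sm (f : R -> R) := hfam (fun _ : unit => 1) (fun _ => f).

Lemma hfam_sm X (w : X -> R) g x : (forall x, 0 <= w x) -> hfam w g -> sm (g x).
Proof.
move=> w0 H m; have [B [B0 HB]] := H m; exists (B * w x); split; first exact: Rmult_le_pos.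
by move=> _; rewrite Rmult_1_r.
Qed.

Lemma sm_cbI f m : sm f -> exists B, 0 <= B /\ cbI m B f.
Proof.
move=> /(_ m) [B [B0 /(_ tt)]]; rewrite Rmult_1_r => HB; exists B; split=> //.
exact: cb_restrict HB.
Qed.

Lemma cbI_Cm m B f : cbI m B f -> Cm_on (-1) 1 m f.
Proof. by move/cb_derivs => [D [H _]]; exists D. Qed.

Lemma one_ge0 (X : Type) : forall _ : X, 0 <= 1. Proof. by move=> _; lra. Qed.

Lemma hfam_ge_mul X (w w' : X -> R) g h : (forall x, 0 <= w x) -> (forall x, 0 <= w' x) ->
  hfam w g -> hfam w' h -> hfam (fun x => w x * w' x) (fun x s => g x s * h x s).
Proof. exact: fam_mul. Qed.

Lemma hfam_mul1 X (w : X -> R) g h : (forall x, 0 <= w x) -> hfam w g -> hfam (fun _ => 1) h ->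
  hfam w (fun x s => g x s * h x s).
Proof.
move=> w0 G H; apply: (@fam_weaken _ _ _ (fun x => w x * 1) _ _ 1); [lra|by move=> x; lra|].
by apply: fam_mul => // x; lra.
Qed.

Lemma sm_mul f g : sm f -> sm g -> sm (fun s => f s * g s).
Proof. by apply: hfam_mul1; apply: one_ge0. Qed.

Lemma sm_lin al be f g : sm f -> sm g -> sm (fun s => al * f s + be * g s).
Proof. by move=> F G; apply: fam_add; apply: fam_scal. Qed.

Lemma hfam_pow X l : hfam (fun _ : X => 1) (fun _ s => (1 + s) ^ l).
Proof.
elim: l => [|l IH] /=; first by apply: fam_const; [exists 1 => _; rewrite Rabs_R1; lra|apply: one_ge0].
apply: hfam_mul1 => //; first exact: one_ge0.
apply: fam_add; first by apply: fam_const; [exists 1 => _; rewrite Rabs_R1; lra|apply: one_ge0].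
apply: fam_bounded_id; first exact: one_ge0.
  by exists 1 => _ s Hs; split_Rabs; lra.
by exists 1 => _; lra.
Qed.

Lemma sm_pow l : sm (fun s => (1 + s) ^ l).
Proof. exact: (@hfam_pow unit). Qed.

Lemma sm_sum n (c : nat -> R) : sm (fun s => \big[Rplus/0]_(m < n) (c m * (1 + s) ^ m)).
Proof.
apply: (@fam_sum _ _ _ _ _ _ (fun m _ s => c (nat_of_ord m) * (1 + s) ^ m)); first exact: one_ge0.
by move=> i; apply: fam_scal; apply: sm_pow.
Qed.

Lemma sm_ex_derive_n f n x : sm f -> ex_derive_n f n x.
Proof.
case: n => // n H; have := fam_derive (fam_Derive_n n H) tt x; by exists (Derive (Derive_n f n) x).
Qed.

Lemma lin_sum (L : (R -> R) -> R) n (c : nat -> R) :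
  (forall al be f g, sm f -> sm g -> L (fun s => al * f s + be * g s) = al * L f + be * L g) ->
  L (fun s => \big[Rplus/0]_(m < n) (c m * (1 + s) ^ m)) =
  \big[Rplus/0]_(m < n) (c m * L (fun s => (1 + s) ^ m)).
Proof.
move=> HL; elim: n => [|n IH].
  (* Linearity with both coefficients zero gives the value at the zero function. *)
  have := HL 0 0 (fun s => (1 + s) ^ 0) (fun s => (1 + s) ^ 0) (sm_pow 0) (sm_pow 0).
  rewrite big_ord0 (_ : (fun s => _ * _ + _) = (fun s => \big[Rplus/0]_(m < 0) (c m * (1 + s) ^ m))).
    by move=> ->; ring.
  by apply: functional_extensionality => s; rewrite big_ord0; ring.
rewrite big_ord_recr /= -IH.
have := HL 1 (c n) _ _ (sm_sum n c) (sm_pow n); rewrite Rmult_1_l => <-; congr L.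
by apply: functional_extensionality => s; rewrite big_ord_recr /=; ring.
Qed.

Lemma derivs_on_leq a b m l f D : (l <= m)%nat -> derivs_on a b m f D -> derivs_on a b l f D.
Proof.
move=> le [D0 [D1 D2]]; split=> //; split; first by move=> i Hi; apply: D1; apply: leq_trans le.
move: le; rewrite leq_eqVlt => /orP[/eqP -> //|lt] x Hx.
have C : limit1_in (D l) (itv a b) (D l x) x.
  apply: (@D_in_cont _ _ (D l.+1)) => eps Heps.
  have [al [Hal H1]] := D1 l lt x Hx eps Heps; exists al; split=> // y [[Hy Hne] Hd].
  by apply: H1 => //; apply: not_eq_sym.
move=> eps Heps; have [al [Hal H1]] := C eps Heps.
by exists al; split=> // y Hy Hd; apply: H1.
Qed.

Section Reference.
Variables (d : nat) (Ihat : (R -> R) -> R) (Iop : (R -> R) -> (R -> R)) (kI kIop : nat).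
Hypothesis d_gt0 : (0 < d)%nat.
Hypothesis I_ok : Ihat_ok Ihat kI.
Hypothesis O_ok : Iop_ok Iop kIop.
Hypothesis A2 : Assumption_A2 d Ihat kI.
Hypothesis A3 : Assumption_A3 d Iop kI kIop.

(** (A2) and (A3) concern vector-valued functions. They are applied to scalar ones by repeating the
    scalar in every component, which requires [d] to be positive. *)
Lemma vnorm_diag (c B : R) : Rabs c <= B -> vnorm (fun _ : 'I_d => c) <= INR d * B.
Proof.
move=> H; apply: Rle_trans (vnorm_le_sum _) _; rewrite /vsum -Rsum_const_ord.
exact: Rsum_le.
Qed.

Lemma abs_le_vnorm_diag (c : R) : Rabs c <= vnorm (fun _ : 'I_d => c).
Proof. exact: (coord_le_vnorm (fun _ : 'I_d => c) (Ordinal d_gt0)). Qed.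

Lemma sum_upto_const m c : sum_upto m (fun _ => c) = INR m.+1 * c.
Proof. exact: Rsum_const_ord. Qed.

Lemma Ihat_bound : exists C, 0 <= C /\ forall f B, 0 <= B -> cbI kI B f -> Rabs (Ihat f) <= C * B.
Proof.
have [C0 H] := A2; exists (Rabs C0 * (INR kI.+1 * INR d)).
have p1 := pos_INR kI.+1; have p2 := pos_INR d; have p3 := Rabs_pos C0.
split; first by apply: Rmult_le_pos => //; apply: Rmult_le_pos.
move=> f B B0 /cb_derivs [D [HD HB]].
apply: Rle_trans (abs_le_vnorm_diag _) _.
apply: Rle_trans (H (fun s _ => f s) (fun l s _ => D l s) _ (fun _ => INR d * B) _) _ => //.
  by move=> l x Hl Hx; apply: vnorm_diag; apply: HB.
rewrite sum_upto_const.
have : 0 <= INR kI.+1 * (INR d * B) by apply: Rmult_le_pos => //; apply: Rmult_le_pos.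
have := Rle_abs C0; nra.
Qed.

(** (A3) bounds a given sequence of derivatives of the output; that there is one is the second half
    of [Iop_ok]. *)
Lemma Iop_bound : exists C, 0 <= C /\ forall f B, 0 <= B -> cbI (maxn kIop kI) B f ->
  cbI kI (C * B) (Iop f).
Proof.
have [C1 H] := A3; exists (Rabs C1 * (INR (maxn kIop kI).+1 * INR d)).
have p1 := pos_INR (maxn kIop kI).+1; have p2 := pos_INR d; have p3 := Rabs_pos C1.
split; first by apply: Rmult_le_pos => //; apply: Rmult_le_pos.
move=> f B B0 Hf; have [D [HD HB]] := cb_derivs Hf.
have [E HE] := O_ok.2 kI f (cbI_Cm Hf).
apply: (derivs_cb HE) => l x Hl Hx.
have le : (maxn kIop l <= maxn kIop kI)%nat by lia.
apply: Rle_trans (abs_le_vnorm_diag _) _.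
apply: Rle_trans (H l Hl (fun s _ => f s) (fun l s _ => D l s) (fun l s _ => E l s) _ _
   (fun _ => INR d * B) _ x Hx) _.
- by move=> j; apply: derivs_on_leq HD.
- by move=> j; apply: derivs_on_leq HE.
- by move=> m y Hm Hy; apply: vnorm_diag; apply: HB => //; apply: leq_trans le.
rewrite sum_upto_const.
have H1 : INR (maxn kIop l).+1 <= INR (maxn kIop kI).+1 by apply: le_INR; lia.
have H2 := pos_INR (maxn kIop l).+1.
have H3 : 0 <= INR d * B by apply: Rmult_le_pos.
have H4 : INR (maxn kIop l).+1 * (INR d * B) <= INR (maxn kIop kI).+1 * (INR d * B) by nra.
have H5 : 0 <= INR (maxn kIop l).+1 * (INR d * B) by apply: Rmult_le_pos.
have := Rle_abs C1; nra.
Qed.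

Lemma cbI_zero m f : (forall s, -1 <= s <= 1 -> f s = 0) -> cbI m 0 f.
Proof.
move=> H; apply: (@derivs_cb _ _ _ _ _ (fun _ _ => 0)); last by move=> *; rewrite Rabs_R0; lra.
split; first by move=> x Hx; rewrite H.
split=> [l _|] x _ eps Heps; exists 1; split; try lra.
  by move=> y _ _ _; rewrite (_ : _ - _ = 0) ?Rabs_R0 // /Rdiv; ring.
by move=> y _ _; rewrite Rminus_diag Rabs_R0.
Qed.

(* [Ihat] is only assumed linear: that it ignores values outside [-1, 1] comes from (A2). *)
Lemma Ihat_ext B B' f g : cbI kI B f -> cbI kI B' g ->
  (forall s, -1 <= s <= 1 -> f s = g s) -> Ihat f = Ihat g.
Proof.
move=> Hf Hg E; have := @I_ok 1 (-1) f g (cbI_Cm Hf) (cbI_Cm Hg).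
have [C [C0 HC]] := Ihat_bound.
have := HC (fun s => 1 * f s + -1 * g s) 0 (Rle_refl _) (@cbI_zero kI _ _).
rewrite Rmult_0_r => H.
have {}H := H (fun s Hs => ltac:(rewrite (E s Hs); ring)).
by move=> E2; move: H; rewrite E2; split_Rabs; lra.
Qed.

Lemma Ihat_lin al be f g : sm f -> sm g ->
  Ihat (fun s => al * f s + be * g s) = al * Ihat f + be * Ihat g.
Proof.
move=> /(@sm_cbI _ kI) [B [_ F]] /(@sm_cbI _ kI) [B' [_ G]].
by apply: I_ok; apply: cbI_Cm; [apply: F|apply: G].
Qed.

(** The right-hand side of the variational condition as a functional of the interpolated function,
    for a fixed test function. *)
Definition Jop (phi : R -> R) (f : R -> R) : R := Ihat (fun s => Iop f s * phi s).

Lemma Jop_cbI phi f : sm phi -> sm f -> exists B, cbI kI B (fun s => Iop f s * phi s).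
Proof.
move=> /(@sm_cbI _ kI) [B [B0 P]] /(@sm_cbI _ (maxn kIop kI)) [B' [B'0 F]].
have [C [C0 HC]] := Iop_bound.
eexists; apply: cb_mul; last exact: P.
- exact: (Rmult_le_pos _ _ C0 B'0).
- exact: B0.
- exact: HC.
Qed.

(** The operator is linear only on [-1, 1], so the integrands agree there only and [Ihat_ext] is
    required. *)
Lemma Jop_lin phi al be f g : sm phi -> sm f -> sm g ->
  Jop phi (fun s => al * f s + be * g s) = al * Jop phi f + be * Jop phi g.
Proof.
move=> P F G; rewrite /Jop.
have [B1 H1] := Jop_cbI P F; have [B2 H2] := Jop_cbI P G.
have [B3 H3] := Jop_cbI P (sm_lin al be F G).
rewrite -(I_ok _ _ (cbI_Cm H1) (cbI_Cm H2)).
apply: (Ihat_ext H3 (cb_add (cb_scal al H1) (cb_scal be H2))) => s Hs.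
have [Bf [_ Cf]] := @sm_cbI _ kIop F; have [Bg [_ Cg]] := @sm_cbI _ kIop G.
by rewrite (O_ok.1 _ _ _ _ (cbI_Cm Cf) (cbI_Cm Cg)) //; ring.
Qed.

Section Families.
Variable X : Type.
Implicit Types (w : X -> R) (g : X -> R -> R).

Lemma hfam_cbI w g m : hfam w g -> exists B, 0 <= B /\ forall x, cbI m (B * w x) (g x).
Proof.
move=> /(_ m) [B [B0 HB]]; exists B; split=> // x; exact: cb_restrict (HB x).
Qed.

Lemma Ihat_fam w g : (forall x, 0 <= w x) -> hfam w g ->
  exists C, 0 <= C /\ forall x, Rabs (Ihat (g x)) <= C * w x.
Proof.
move=> w0 /(@hfam_cbI _ _ kI) [B [B0 HB]]; have [C [C0 HC]] := Ihat_bound.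
exists (C * B); split; first exact: Rmult_le_pos.
by move=> x; rewrite Rmult_assoc; apply: HC => //; apply: Rmult_le_pos.
Qed.

Lemma Jop_fam w phi g : (forall x, 0 <= w x) -> sm phi -> hfam w g ->
  exists C, 0 <= C /\ forall x, Rabs (Jop phi (g x)) <= C * w x.
Proof.
move=> w0 /(@sm_cbI _ kI) [Bp [Bp0 P]] /(@hfam_cbI _ _ (maxn kIop kI)) [B [B0 HB]].
have [C [C0 HC]] := Ihat_bound; have [C' [C'0 HC']] := Iop_bound.
exists (C * (2 ^ kI * (C' * B * Bp))).
have p2 : 0 <= 2 ^ kI by apply: pow_le; lra.
have p3 : 0 <= C' * B by apply: Rmult_le_pos.
split; first by repeat apply: Rmult_le_pos => //.
move=> x; have pw := w0 x.
have p4 : 0 <= B * w x by apply: Rmult_le_pos.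
rewrite (_ : _ * w x = C * (2 ^ kI * (C' * (B * w x) * Bp))); last ring.
apply: HC; first by repeat apply: Rmult_le_pos => //.
by apply: cb_mul => //; [apply: Rmult_le_pos|apply: HC'].
Qed.

End Families.

(** The order conditions hold on every interval; on [-1, 1] itself they become statements about the
    reference functional. *)
Lemma Iloc_ref g : Iloc Ihat (-1) 1 g = Ihat g.
Proof.
rewrite /Iloc (_ : (1 - -1) / 2 = 1); last field.
rewrite Rmult_1_l; congr Ihat; apply: functional_extensionality => s.
by congr g; rewrite /Tmap; field.
Qed.

Lemma Ioploc_ref g : Ioploc Iop (-1) 1 g = Iop g.
Proof.
apply: functional_extensionality => t; rewrite /Ioploc.
rewrite (_ : (fun s => _) = g); first by congr Iop; rewrite /Tinv; field.
by apply: functional_extensionality => s; congr g; rewrite /Tmap; field.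
Qed.

(* [n] plays the role of [r_{I,l} + 1] (resp. [r_ex + 1]), so that it stays in [nat]. *)
Definition interp_ord l n := interp_deg Ihat Iop l (Z.of_nat n - 1).
Definition quad_ord n := exact_deg Ihat (Z.of_nat n - 1).

Lemma interp_ord_Jop l n p : interp_ord l n -> pn n p ->
  Jop (fun s => (1 + s) ^ l) p = Ihat (fun s => p s * (1 + s) ^ l).
Proof.
move=> H Hp; have := H (-1) 1 ltac:(lra) p (fun s => (1 + s) ^ l).
rewrite !Iloc_ref Ioploc_ref /Jop => <- //; first by apply/(is_poly_leE (n := n)) => //; lia.
apply/is_poly_le_nat; apply: (pn_ext _ (pn_affine_pow l 1 1)) => x; congr (_ ^ _); ring.
Qed.

(** * Consistency of interpolation and quadrature *)

Section Consistency.
Variables (X : Type) (a b : X -> R).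
Hypothesis hab : forall x, a x < b x <= a x + 1.
Let tau x := b x - a x.

Lemma pn_taylor_poly n (c : nat -> R) ta :
  pn n (fun s => \big[Rplus/0]_(i < n) (c i * (ta * (1 + s)) ^ i)).
Proof.
apply: (@pn_sum n n (fun i s => c i * (ta * (1 + s)) ^ i)) => m Hm.
apply: pn_scal; apply: (pn_leq Hm); apply: (pn_ext _ (pn_affine_pow m ta ta)) => x.
by congr (_ ^ _); ring.
Qed.

Lemma sm_taylor_poly n (c : nat -> R) ta :
  sm (fun s => \big[Rplus/0]_(i < n) (c i * (ta * (1 + s)) ^ i)).
Proof.
apply: (fam_ext _ (sm_sum n (fun i => c i * ta ^ i))) => _ s.
by apply: eq_bigr => i _; rewrite Rpow_mult_distr; ring.
Qed.

(** The Taylor polynomial with [n] terms is treated exactly, and both functionals are bounded on the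
    remainder, which has weight [tau ^ n]. The quadrature error below is split in the same way. *)
Lemma interp_consistency l n g : interp_ord l n -> fam a b (fun _ => 1) g ->
  exists C, 0 <= C /\ forall x,
    Rabs (Jop (fun s => (1 + s) ^ l) (hat a b g x) - Ihat (fun s => hat a b g x s * (1 + s) ^ l))
      <= C * tau x ^ n.
Proof.
move=> Hl G; have [c [w [_ [Hw [E _]]]]] := hat_taylor hab n G.
have w0 := pow_tau_ge0 hab n.
have [C1 [C10 H1]] := Jop_fam w0 (sm_pow l) Hw.
have [C2 [C20 H2]] := Ihat_fam w0 (hfam_mul1 w0 Hw (hfam_pow X l)).
exists (C1 + C2); split; first lra.
move=> x.
pose P s := \big[Rplus/0]_(i < n) (c i x * (tau x * (1 + s)) ^ i).
have sP : sm P := sm_taylor_poly n (fun i => c i x) (tau x).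
have sw : sm (w x) by apply: (hfam_sm x w0 Hw).
have -> : hat a b g x = (fun s => 1 * P s + 1 * w x s).
  by apply: functional_extensionality => s; rewrite E !Rmult_1_l.
rewrite Jop_lin //; last exact: sm_pow.
rewrite (_ : (fun s => (1 * P s + 1 * w x s) * (1 + s) ^ l) =
  (fun s => 1 * (P s * (1 + s) ^ l) + 1 * (w x s * (1 + s) ^ l))); last first.
  by apply: functional_extensionality => s; ring.
rewrite Ihat_lin; [|by apply: sm_mul => //; apply: sm_pow..].
rewrite (interp_ord_Jop Hl (pn_taylor_poly n (fun i => c i x) (tau x) : pn n P)).
have := H1 x; have := H2 x; rewrite -/(tau x) => {}H1 {}H2.
rewrite Rmult_plus_distr_r; move: H1 H2; split_Rabs; lra.
Qed.

Lemma quad_consistency n g : quad_ord n -> fam a b (fun _ => 1) g ->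
  exists C, 0 <= C /\ forall x,
    Rabs (RInt (hat a b g x) (-1) 1 - Ihat (hat a b g x)) <= C * tau x ^ n.
Proof.
move=> Hl G; have [c [w [_ [Hw [E _]]]]] := hat_taylor hab n G.
have w0 := pow_tau_ge0 hab n.
have [C2 [C20 H2]] := Ihat_fam w0 Hw.
have [C1 [C10 H1]] := fam_bd Hw.
exists (2 * C1 + C2); split; first lra.
move=> x.
pose P s := \big[Rplus/0]_(i < n) (c i x * (tau x * (1 + s)) ^ i).
have sP : sm P := sm_taylor_poly n (fun i => c i x) (tau x).
have sw : sm (w x) by apply: (hfam_sm x w0 Hw).
have ex f : sm f -> ex_RInt f (-1) 1.
  move=> Hf; apply: (@ex_RInt_continuous) => z _; apply: is_derive_cont (fam_derive Hf tt z).
have -> : hat a b g x = (fun s => 1 * P s + 1 * w x s).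
  by apply: functional_extensionality => s; rewrite E !Rmult_1_l.
rewrite Ihat_lin //.
have -> : RInt (fun s => 1 * P s + 1 * w x s) (-1) 1 = RInt P (-1) 1 + RInt (w x) (-1) 1.
  have := RInt_plus P (w x) (-1) 1 (ex _ sP) (ex _ sw); rewrite /plus [X in _ = X]/= => <-.
  by apply: RInt_ext => s _; rewrite /= !Rmult_1_l.
have -> : RInt P (-1) 1 = Ihat P.
  rewrite -Iloc_ref; apply: Hl; first lra.
  by apply/(is_poly_leE (n := n)); [lia|apply: (pn_taylor_poly n (fun i => c i x) (tau x))].
have H3 := @abs_RInt_le_const (w x) (-1) 1 (C1 * tau x ^ n) ltac:(lra) (ex _ sw) (H1 x).
have := H2 x; rewrite -/(tau x) => {}H2.
rewrite Rmult_plus_distr_r; move: H3 H2; split_Rabs; lra.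
Qed.

End Consistency.

Lemma sm_Derive_n_lin al be f g i x : sm f -> sm g ->
  Derive_n (fun s => al * f s + be * g s) i x = al * Derive_n f i x + be * Derive_n g i x.
Proof.
move=> F G.
have Fa : sm (fun s => al * f s) by apply: fam_scal.
have Gb : sm (fun s => be * g s) by apply: fam_scal.
rewrite (Derive_n_plus (fun s => al * f s) (fun s => be * g s)) ?Derive_n_scal_l //.
  by apply: filter_forall => y j _; apply: sm_ex_derive_n.
by apply: filter_forall => y j _; apply: sm_ex_derive_n.
Qed.

(** * Estimate of the residual *)

Section Residual.
Variables (r k : nat).
Hypothesis k_le_r : (k <= r)%nat.
Hypothesis A1 : Assumption_A1 Ihat r k.

(** The number of moments, that is the dimension of the polynomials of degree at most
    [r - max(1, k)]. With the end point conditions it adds up to [r], the dimension of the space of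
    [U']. *)
Let nm := (r.+1 - maxn 1 k)%nat.
Let expo (l : nat) := (l + (k == 0%nat))%nat.

Definition cond_index := ('I_(k./2) + 'I_((k.-1)./2) + 'I_nm)%type.

(* The conditions by which the method determines [U'] from [f(., U)]; for [k = 0] the test
   functions are those vanishing at the left end point, so that the jump drops out. *)
Definition cond (i : cond_index) (f : R -> R) : R :=
  match i with
  | inl (inl i) => Derive_n f i 1
  | inl (inr i) => Derive_n f i (-1)
  | inr l => Ihat (fun s => f s * (1 + s) ^ (expo l))
  end.

Lemma cond_lin i al be f g : sm f -> sm g ->
  cond i (fun s => al * f s + be * g s) = al * cond i f + be * cond i g.
Proof.
move=> F G; case: i => [[i|i]|l]; rewrite /cond; try exact: sm_Derive_n_lin.
rewrite -Ihat_lin; [|by apply: sm_mul => //; apply: sm_pow..].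
by congr Ihat; apply: functional_extensionality => s; ring.
Qed.

(** The end point conditions split off powers of [1 - s] and [1 + s]; the vanishing moments then say
    that the cofactor satisfies the hypothesis of (A1). *)
Lemma cond_unisolvent V : pn r V -> sm V -> (forall i, cond i V = 0) -> forall x, V x = 0.
Proof.
move=> HV sV H0.
have E : (r = nm + (k.-1)./2 + k./2)%nat by rewrite /nm; lia.
have HV' : pn (nm + (k.-1)./2 + k./2) V by rewrite -E.
have [i Hi|p1 [Hp1 [E1 R1]]] := pn_factor_mult (c := 1) HV'.
  exact: (H0 (inl (inl (Ordinal Hi)))).
have [i Hi|p2 [Hp2 [E2 _]]] := pn_factor_mult (c := -1) Hp1.
  apply: (R1 (-1) (k.-1)./2) => //; first lra.
  by move=> j Hj; apply: (H0 (inl (inr (Ordinal Hj)))).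
(* The sign converts powers of [s - 1] into powers of [1 - s]. *)
pose psi s := (-1) ^ (k./2) * p2 s.
have EV s : V s = (1 - s) ^ (k./2) * (1 + s) ^ ((k.-1)./2) * psi s.
  rewrite E1 E2 /psi (_ : s - 1 = -1 * (1 - s)); last ring.
  by rewrite Rpow_mult_distr (_ : s - -1 = 1 + s); ring.
suff psi0 : forall s, psi s = 0 by move=> x; rewrite EV psi0; ring.
have deg : (Z.to_nat (Z.of_nat r - Z.of_nat (maxn 1 k) + 1) = nm)%Z by rewrite /nm; lia.
apply: A1; first by apply/(is_poly_leE _ deg); apply: pn_scal.
move=> phi /(is_poly_leE _ deg) /pn_shifted [c Hc].
(* For [k = 0] the weight of (A1) has an extra factor [1 + s], which is exactly the shift in
   [expo]. *)
have -> : (fun s => (1 - s) ^ k./2 * (1 + s) ^ (if k == 0%nat then 1%nat else (k.-1)./2) * psi s * phi s)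
   = (fun s => V s * (1 + s) ^ (k == 0%nat) * \big[Rplus/0]_(m < nm) (c m * (1 + s) ^ m)).
  apply: functional_extensionality => s; rewrite EV Hc; case: eqP => [->|_] /=; ring.
have := @lin_sum (fun f => Ihat (fun s => V s * (1 + s) ^ (k == 0%nat) * f s)) nm c.
move=> -> => [|al be f g F G]; last first.
  rewrite -Ihat_lin; try by (apply: sm_mul => //; apply: sm_mul => //; apply: sm_pow).
  by congr Ihat; apply: functional_extensionality => s; ring.
rewrite big1 // => m _.
have := H0 (inr m); rewrite /cond /expo => H.
rewrite (_ : (fun s => _) = (fun s => V s * (1 + s) ^ (m + (k == 0%nat)))); first by rewrite H; ring.
by apply: functional_extensionality => s; rewrite pow_add; ring.
Qed.

(** In finite dimension unisolvence is quantitative: the matrix of the conditions in the basis of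
    powers of [1 + s] is bounded below, with a constant of the reference interval only. *)
Lemma cond_bound : exists C, 0 <= C /\ forall (v : nat -> R) delta,
  (forall i, Rabs (cond i (fun s => \big[Rplus/0]_(m < r) (v m * (1 + s) ^ m))) <= delta) ->
  forall m, (m < r)%nat -> Rabs (v m) <= C * delta.
Proof.
have condE (v : nat -> R) i : cond i (fun s => \big[Rplus/0]_(m < r) (v m * (1 + s) ^ m)) =
   \big[Rplus/0]_(m < r) (cond i (fun s => (1 + s) ^ m) * v m).
  rewrite (lin_sum r v (fun al be f g => @cond_lin i al be f g)).
  by apply: eq_bigr => m _; ring.
have [v Hv|C [C0 HC]] := @injective_bounded_below cond_index r (fun i m => cond i (fun s => (1 + s) ^ m)).
  apply: poly_zero_coefs => x.
  have H := @cond_unisolvent (fun s => \big[Rplus/0]_(m < r) (v m * (1 + s) ^ m)) _ (sm_sum r v) _ (x - 1).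
  rewrite -[RHS]H => [| |i]; last by rewrite condE.
    by apply: eq_bigr => m _; rewrite (_ : 1 + (x - 1) = x); ring.
  apply: (@pn_sum r r (fun m s => v m * (1 + s) ^ m)) => m Hm; apply: pn_scal.
  by apply: (pn_leq Hm); apply: (pn_ext _ (pn_affine_pow m 1 1)) => y; congr (_ ^ _); ring.
exists C; split=> // v delta H; apply: HC => i; rewrite -condE; exact: H.
Qed.

Section ResidualFam.
Variables (X : Type) (a b : X -> R).
Hypothesis hab : forall x, a x < b x <= a x + 1.
Let tau x := b x - a x.
Variables F dU : X -> R -> R.
Hypothesis F_fam : fam a b (fun _ => 1) F.
Hypothesis dU_fam : fam a b (fun _ => 1) dU.
Hypothesis dU_poly : forall x, pn r (dU x).
Let rho x t := F x t - dU x t.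
Hypothesis right_cond : forall x i, (i < k./2)%nat -> Derive_n (rho x) i (b x) = 0.
Hypothesis left_cond : forall x i, (i < (k.-1)./2)%nat -> Derive_n (rho x) i (a x) = 0.
Variable jump : X -> R.
Hypothesis variational : forall x l, (l <= r - k)%nat ->
  tau x / 2 * Ihat (fun s => hat a b dU x s * (1 + s) ^ l)
    + (if k == 0%nat then jump x * 0 ^ l else 0)
  = tau x / 2 * Jop (fun s => (1 + s) ^ l) (hat a b F x).

Lemma moments x l : (l <= r - k)%nat -> (k == 0%nat -> (0 < l)%nat) ->
  Ihat (fun s => hat a b dU x s * (1 + s) ^ l) = Jop (fun s => (1 + s) ^ l) (hat a b F x).
Proof.
move=> Hl Hk; have := variational x Hl.
have -> : (if k == 0%nat then jump x * 0 ^ l else 0) = 0.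
  by move: Hk; case: eqP => // _ /(_ isT); case: (l) => //= l' _; ring.
have := hab x; rewrite /tau => ab.
by rewrite Rplus_0_r => /(Rmult_eq_reg_l (tau x / 2)); apply; rewrite /tau; lra.
Qed.

Lemma rho_fam : fam a b (fun _ => 1) rho.
Proof. exact: fam_sub. Qed.

Lemma Derive_n_hat g i x s : fam a b (fun _ => 1) g ->
  Derive_n (hat a b g x) i s = (tau x / 2) ^ i * Derive_n (g x) i (Tmap (a x) (b x) s).
Proof.
move=> G; elim: i s => [|i IH] s; first by rewrite /= Rmult_1_l.
rewrite [LHS]/= (_ : Derive_n _ i = (fun s => (tau x / 2) ^ i *
  hat a b (fun x => Derive_n (g x) i) x s)); last exact: functional_extensionality.
rewrite Derive_scal.
rewrite (_ : Derive _ s = tau x / 2 * hat a b (fun x => Derive (Derive_n (g x) i)) x s); last first.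
  apply: is_derive_unique; apply: (@is_derive_hat _ a b (fun x => Derive_n (g x) i)).
  exact: (fam_derive (fam_Derive_n i G) x).
by rewrite /= /hat /tau /=; ring.
Qed.

Lemma hat_rho_end i x : cond (inl i) (hat a b rho x) = 0.
Proof.
case: i => i; rewrite /cond (Derive_n_hat _ _ _ rho_fam).
  by rewrite Tmap_1 right_cond ?ltn_ord //; ring.
by rewrite Tmap_m1 left_cond ?ltn_ord //; ring.
Qed.

(** Write the pullback of [F] as [P + w] with Taylor polynomial [P], and set [V = dU - P]. As
    [q <= r], [V] is determined by the conditions [cond]. At the end points the residual vanishes,
    so [V] has the data of [w]; in the moments exactness on [P] leaves the functional of [w]. All
    data are thus of order [tau ^ q], hence so are [V] and the residual [w - V]. *)
Lemma residual_estimate q : (q <= r)%nat -> interp_ord (r - k) q ->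
  hfam (fun x => tau x ^ q) (hat a b rho).
Proof.
move=> Hq Hi; have [c [w [_ [Hw [E _]]]]] := hat_taylor hab q F_fam.
have w0 : forall x, 0 <= tau x ^ q := pow_tau_ge0 hab q.
pose P x s := \big[Rplus/0]_(i < q) (c i x * (tau x * (1 + s)) ^ i).
pose V x s := hat a b dU x s - P x s.
have sP x : sm (P x) := sm_taylor_poly q (fun i => c i x) (tau x).
have pP x : pn q (P x) := pn_taylor_poly q (fun i => c i x) (tau x).
have sw x : sm (w x) by apply: (hfam_sm x w0 Hw).
have sdU x : sm (hat a b dU x) by apply: (hfam_sm x (@one_ge0 X)); apply: fam_hat => // y; lra.
have sF x : sm (hat a b F x) by apply: (hfam_sm x (@one_ge0 X)); apply: fam_hat => // y; lra.
have VE x : V x = (fun s => 1 * hat a b dU x s + -1 * P x s).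
  by apply: functional_extensionality => s; rewrite /V; ring.
have VE' x : V x = (fun s => 1 * w x s + -1 * hat a b rho x s).
  apply: functional_extensionality => s; rewrite /V.
  have -> : hat a b rho x s = hat a b F x s - hat a b dU x s by [].
  by rewrite E -/(P x s); ring.
have srho x : sm (hat a b rho x).
  by apply: (hfam_sm x (@one_ge0 X)); apply: fam_hat => //; [move=> y; lra|apply: rho_fam].
have pV x : pn r (V x).
  rewrite VE; apply: pn_add; apply: pn_scal; last exact: pn_leq (pP x).
  exact: (pn_comp_affine _ _ (dU_poly x)).
pose v x := proj1_sig (constructive_indefinite_description _ (pn_shifted (pV x))).
have vE x s : V x s = \big[Rplus/0]_(m < r) (v x m * (1 + s) ^ m).
  exact: (proj2_sig (constructive_indefinite_description _ (pn_shifted (pV x)))).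
have [K [K0 HK]] : exists K, 0 <= K /\ forall i x, Rabs (cond i (V x)) <= K * tau x ^ q.
  apply: (@finite_bound cond_index X (fun i x => cond i (V x))) => // -[i|l].
    have [K [K0 HK]] : exists K, 0 <= K /\ forall x, Rabs (cond (inl i) (w x)) <= K * tau x ^ q.
      case: i => i; have [K [K0 HK]] := fam_bd (fam_Derive_n i Hw); exists K; split=> // x;
        by apply: HK; lra.
    exists K; split=> // x; rewrite VE' cond_lin // hat_rho_end.
    by rewrite Rmult_0_r Rplus_0_r Rmult_1_l.
  have [C [C0 HC]] := Jop_fam w0 (sm_pow (expo l)) Hw.
  exists C; split=> // x; rewrite VE cond_lin // /cond.
  have Hl := ltn_ord l; rewrite /nm in Hl.
  have le : (expo l <= r - k)%nat by move: (nat_of_ord l) Hl; rewrite /expo; clear -k_le_r; case: k k_le_r => [|k'] /= ? n; lia.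
  rewrite moments //; last by rewrite /expo => /eqP ->; rewrite addn1.
  (* Exactness against test functions of degree [r - k] includes those of lower degree. *)
  have Hi' : interp_ord (expo l) q.
    move=> a' b' ab phi psi Hphi Hpsi; apply: Hi => //.
    by apply/is_poly_le_nat; apply: (pn_leq _ (proj1 (is_poly_le_nat _ _) Hpsi)).
  rewrite -(interp_ord_Jop Hi' (pP x)) -Jop_lin //; last exact: sm_pow.
  rewrite (_ : (fun s => 1 * hat a b F x s + -1 * P x s) = w x); first exact: HC.
  by apply: functional_extensionality => s; rewrite E -/(P x s); ring.
have [C [C0 HC]] := cond_bound.
have Hv x m : (m < r)%nat -> Rabs (v x m) <= C * K * tau x ^ q.
  move=> Hm; rewrite Rmult_assoc; apply: HC Hm => i.
  rewrite (_ : (fun s => _) = V x); first exact: HK.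
  by apply: functional_extensionality => s; rewrite vE.
have FV : hfam (fun x => tau x ^ q) V.
  apply: (@fam_ext _ _ _ _ (fun x s => \big[Rplus/0]_(m < r) (v x m * (1 + s) ^ m))).
    by move=> x s; rewrite vE.
  apply: (@fam_sum _ _ _ _ _ _ (fun m x s => v x (nat_of_ord m) * (1 + s) ^ m)) => // m.
  apply: (@hfam_mul1 X (fun x => tau x ^ q) (fun x _ => v x (nat_of_ord m))) => //; last exact: hfam_pow.
  by apply: fam_const => //; exists (C * K) => x; apply: Hv.
apply: (@fam_ext _ _ _ _ (fun x s => w x s - V x s)); last exact: fam_sub.
by move=> x s; rewrite VE'; ring.
Qed.

Lemma pow_tau_le m n x : (n <= m)%nat -> tau x ^ m <= tau x ^ n.
Proof.
move=> le; have := hab x => ab; rewrite -(subnKC le) pow_add.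
have H1 : 0 <= tau x ^ n by apply: pow_tau_ge0.
have H2 : tau x ^ (m - n) <= 1 ^ (m - n) by apply: pow_incr; rewrite /tau; lra.
rewrite pow1 in H2; nra.
Qed.

Lemma interp_ord_leq l m n : (m <= n)%nat -> interp_ord l n -> interp_ord l m.
Proof.
move=> le H a' b' ab phi psi Hphi Hpsi; apply: H => //.
have E n' : Z.to_nat (Z.of_nat n' - 1 + 1) = n' by lia.
by apply/(is_poly_leE _ (E n)); apply: (pn_leq le); apply/(is_poly_leE _ (E m)).
Qed.

Lemma RInt_hat g x : fam a b (fun _ => 1) g ->
  RInt (g x) (a x) (b x) = tau x / 2 * RInt (hat a b g x) (-1) 1.
Proof.
move=> G.
have C s : continuous (g x) s by apply: is_derive_cont (fam_derive G x s).
have := @RInt_comp_lin _ (g x) (tau x / 2) ((a x + b x) / 2) (-1) 1.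
have -> : tau x / 2 * -1 + (a x + b x) / 2 = a x by rewrite /tau; field.
have -> : tau x / 2 * 1 + (a x + b x) / 2 = b x by rewrite /tau; field.
move=> <-; last by apply: ex_RInt_continuous => *.
rewrite -[RHS](@RInt_scal R_CompleteNormedModule (hat a b g x)).
  apply: RInt_ext => s _; congr (scal _ _); congr g; rewrite /Tmap /tau; ring.
apply: ex_RInt_continuous => s _; apply: is_derive_cont.
exact: (fam_derive (fam_hat hab (@one_ge0 X) G) x s).
Qed.

Lemma Ihat_rho x l : Ihat (fun s => hat a b rho x s * (1 + s) ^ l) =
  Ihat (fun s => hat a b F x s * (1 + s) ^ l) - Ihat (fun s => hat a b dU x s * (1 + s) ^ l).
Proof.
have sh g : fam a b (fun _ => 1) g -> sm (fun s => hat a b g x s * (1 + s) ^ l).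
  move=> G; apply: sm_mul; last exact: sm_pow.
  exact: (hfam_sm x (@one_ge0 X) (fam_hat hab (@one_ge0 X) G)).
rewrite -[X in _ = X - _]Rmult_1_l /Rminus -[X in _ = _ + - X]Rmult_1_l Ropp_mult_distr_l.
rewrite -Ihat_lin; [|exact: sh..].
by congr Ihat; apply: functional_extensionality => s; rewrite /hat /rho; ring.
Qed.

(** * The defect of one step *)

Section Defect.
Variables (z : X -> R -> R) (p : nat).
Hypothesis z_fam : fam a b (fun _ => 1) z.
(** This encodes [p <= r_var + 1]. When [l >= p] the truncated difference asks for exactness on the
    zero polynomial only. *)
Hypothesis p_interp : forall l, (l <= r - k)%nat -> interp_ord l (p - l).

Let defect x := RInt (fun t => rho x t * z x t) (a x) (b x)
  - (if k == 0%nat then jump x * z x (a x) else 0).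

(** The residual is of order [tau ^ p], and integration over the step gives one more power. *)
Lemma defect_small_residual : (p <= r)%nat -> interp_ord (r - k) p ->
  exists C, 0 <= C /\ forall x, Rabs (defect x) <= C * tau x ^ p.+1.
Proof.
move=> Hp Hi; have Hr := residual_estimate Hp Hi.
have w0 : forall x, 0 <= tau x ^ p := pow_tau_ge0 hab p.
have [C1 [C10 H1]] := fam_bd Hr.
have [Cz [Cz0 Hz]] := fam_bd z_fam.
have [C2 [C20 H2]] := Ihat_fam w0 (hfam_mul1 w0 Hr (hfam_pow X 0)).
have Hi0 : interp_ord 0 p by have := p_interp (leq0n _); rewrite subn0.
have [C3 [C30 H3]] := interp_consistency hab Hi0 F_fam.
exists (C1 * Cz + (C2 + C3) * Cz); split; first by nra.
move=> x; have ab := hab x; have t0 : 0 < tau x by rewrite /tau; lra.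
rewrite /defect Rmult_plus_distr_r; apply: Rle_trans (Rabs_triang _ _) _.
have za t : a x <= t <= b x -> Rabs (z x t) <= Cz by move=> Ht; have := Hz x t Ht; lra.
apply: Rplus_le_compat.
  rewrite (_ : C1 * Cz * _ = (b x - a x) * (C1 * tau x ^ p * Cz)); last by rewrite /tau /=; ring.
  apply: abs_RInt_le_const; first lra.
    apply: ex_RInt_continuous => t _; apply: (@continuous_mult).
      exact: is_derive_cont (fam_derive rho_fam x t).
    exact: is_derive_cont (fam_derive z_fam x t).
  move=> t Ht; apply: Rabs_mult_le; last exact: za.
  have -> : rho x t = hat a b rho x (Tinv (a x) (b x) t).
    by rewrite /hat; congr rho; rewrite /Tmap /Tinv; field; lra.
  apply: H1; rewrite /Tinv; split.
    by apply/Rle_div_r; lra.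
  by apply/Rle_div_l; lra.
rewrite Rabs_Ropp.
case: eqP => k0; last first.
  rewrite Rabs_R0; apply: Rmult_le_pos; first by nra.
  by apply: pow_le; lra.
rewrite (_ : _ * tau x ^ p.+1 = ((C2 + C3) * tau x ^ p.+1) * Cz); last ring.
apply: Rabs_mult_le; last by apply: za; lra.
(* The constant test function expresses the jump as [tau / 2] times an interpolation error plus the
   quadrature of the residual. *)
have := variational x (leq0n _); rewrite k0 eqxx /= => V.
have := Ihat_rho x 0 => /= E; have := H2 x; have := H3 x; rewrite /= -/(tau x) => {}H3 {}H2.
have -> : jump x = tau x / 2 * ((Jop (fun s => 1) (hat a b F x) - Ihat (fun s => hat a b F x s * 1)) +
   Ihat (fun s => hat a b rho x s * 1)) by rewrite E; lra.
rewrite Rabs_mult Rabs_pos_eq; last lra.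
have := Rabs_triang (Jop (fun s => 1) (hat a b F x) - Ihat (fun s => hat a b F x s * 1))
   (Ihat (fun s => hat a b rho x s * 1)) => H4.
have := w0 x => pw.
set Q := Rabs (_ + _) in H4 *.
have Q1 : Q <= (C2 + C3) * tau x ^ p by lra.
have : tau x / 2 * Q <= tau x / 2 * ((C2 + C3) * tau x ^ p) by apply: Rmult_le_compat_l; lra.
have : 0 <= (C2 + C3) * tau x ^ p by apply: Rmult_le_pos; lra.
nra.
Qed.

Lemma defect_quadrature : (p + k <= r + r + 1)%nat -> quad_ord p ->
  exists C, 0 <= C /\ forall x, Rabs (defect x) <= C * tau x ^ p.+1.
Proof.
move=> Hp Hquad.
(* The order of the residual that [p_interp] guarantees at [l = r - k]. It suffices because
   [q + (r - k) + 1 >= p], where [Hp] settles the case [q = r]. *)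
pose q := minn r (p - (r - k)).
have Hr : hfam (fun x => tau x ^ q) (hat a b rho).
  apply: residual_estimate; first exact: geq_minl.
  by apply: interp_ord_leq (p_interp (leqnn _)); apply: geq_minr.
have w0 n : forall x, 0 <= tau x ^ n := pow_tau_ge0 hab n.
have rz_fam : fam a b (fun _ => 1) (fun x t => rho x t * z x t).
  apply: (@fam_weaken _ _ _ (fun x => 1 * 1) _ _ 1); [lra|by move=> x; lra|].
  by apply: fam_mul; [exact: one_ge0|exact: one_ge0|exact: rho_fam|].
have [C1 [C10 H1]] := quad_consistency hab Hquad rz_fam.
have [c [w [[B [B0 HB]] [Hw [E w_m1]]]]] := hat_taylor hab (r - k).+1 z_fam.
(* The interpolation error against degree [l] is only of order [p - l]; the Taylor coefficient of
   [z] at that degree carries the missing [tau ^ l]. This is the [+ i] in the definition of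
   [r_var]. *)
pose Dl l x := Ihat (fun s => hat a b F x s * (1 + s) ^ l) - Jop (fun s => (1 + s) ^ l) (hat a b F x).
have [C2 [C20 H2]] : exists K, 0 <= K /\ forall (l : 'I_(r - k).+1) x,
    Rabs (tau x ^ l * Dl l x) <= K * tau x ^ p.
  apply: (@finite_bound _ X (fun (l : 'I_(r - k).+1) x => tau x ^ l * Dl l x)) => // l.
  have [C [C0 HC]] := interp_consistency hab (p_interp (ltn_ord l : (l <= r - k)%nat)) F_fam.
  exists C; split=> // x; rewrite Rabs_mult (Rabs_pos_eq (tau x ^ l)) //.
  have := HC x; rewrite Rabs_minus_sym -/(Dl l x) -/(tau x) => {}HC.
  apply: Rle_trans (_ : tau x ^ l * (C * tau x ^ (p - l)) <= _).
    by apply: Rmult_le_compat_l.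
  rewrite (_ : _ * (C * _) = C * (tau x ^ (l + (p - l)))); last by rewrite pow_add; ring.
  by apply: Rmult_le_compat_l => //; apply: pow_tau_le; lia.
have [C3 [C30 H3]] := Ihat_fam (fun x => Rmult_le_pos _ _ (w0 q x) (w0 _ x))
   (hfam_ge_mul (w0 q) (w0 (r - k).+1) Hr Hw).
exists (C1 + INR (r - k).+1 * (B * C2) + C3); split.
  have := pos_INR (r - k).+1; have : 0 <= B * C2 by apply: Rmult_le_pos.
  nra.
move=> x; have ab := hab x; have t0 : 0 < tau x by rewrite /tau; lra.
have srho : sm (hat a b rho x) by apply: (hfam_sm x (w0 q) Hr).
have sw : sm (w x) by apply: (hfam_sm x (w0 (r - k).+1) Hw).
pose cl l := c l x * tau x ^ l.
pose P s := \big[Rplus/0]_(l < (r - k).+1) (cl l * (1 + s) ^ l).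
have hatz s : hat a b z x s = P s + w x s.
  rewrite E -/(tau x); congr (_ + _); apply: eq_bigr => l _.
  by rewrite Rpow_mult_distr /cl; ring.
(* The remainder vanishes at the left end, so the Taylor polynomial takes the full value of [z]
   there and the jump terms cancel exactly. *)
have zaE : z x (a x) = \big[Rplus/0]_(l < (r - k).+1) (cl l * 0 ^ l).
  have := hatz (-1); rewrite /hat Tmap_m1 w_m1 // Rplus_0_r => ->.
  by apply: eq_bigr => l _; congr (_ * _ ^ _); ring.
have IE : Ihat (hat a b (fun x t => rho x t * z x t) x) =
   \big[Rplus/0]_(l < (r - k).+1) (cl l * Ihat (fun s => hat a b rho x s * (1 + s) ^ l)) +
   Ihat (fun s => hat a b rho x s * w x s).
  have Lin al be f g : sm f -> sm g -> Ihat (fun s => hat a b rho x s * (al * f s + be * g s)) =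
      al * Ihat (fun s => hat a b rho x s * f s) + be * Ihat (fun s => hat a b rho x s * g s).
    move=> Hf Hg; rewrite -Ihat_lin; [|exact: sm_mul..].
    by congr Ihat; apply: functional_extensionality => s; ring.
  rewrite -(lin_sum (L := fun f => Ihat (fun s => hat a b rho x s * f s)) (r - k).+1 cl Lin).
  rewrite -/P -[X in _ = X + _]Rmult_1_l -[X in _ = _ + X]Rmult_1_l -(Lin 1 1 P (w x) (sm_sum _ _) sw).
  congr Ihat; apply: functional_extensionality => s.
  by rewrite !Rmult_1_l -hatz.
have IR l : (l <= r - k)%nat -> tau x / 2 * Ihat (fun s => hat a b rho x s * (1 + s) ^ l) =
    tau x / 2 * Dl l x + (if k == 0%nat then jump x * 0 ^ l else 0).
  by move=> Hl; have := variational x Hl; rewrite Ihat_rho /Dl; lra.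
have DE : defect x =
    tau x / 2 * (RInt (hat a b (fun x t => rho x t * z x t) x) (-1) 1
                 - Ihat (hat a b (fun x t => rho x t * z x t) x))
    + \big[Rplus/0]_(l < (r - k).+1) (cl l * (tau x / 2 * Dl l x))
    + tau x / 2 * Ihat (fun s => hat a b rho x s * w x s).
  rewrite /defect (RInt_hat x rz_fam) IE.
  have : tau x / 2 * \big[Rplus/0]_(l < (r - k).+1) (cl l * Ihat (fun s => hat a b rho x s * (1 + s) ^ l)) =
     \big[Rplus/0]_(l < (r - k).+1) (cl l * (tau x / 2 * Dl l x)) +
     (if k == 0%nat then jump x * z x (a x) else 0).
    rewrite (_ : (if _ then _ else _) =
       \big[Rplus/0]_(l < (r - k).+1) (cl l * (if k == 0%nat then jump x * 0 ^ l else 0))).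
      rewrite Rsum_scal -big_split; apply: eq_bigr => l _ /=.
      have := IR l (ltn_ord l : (l <= r - k)%nat) => E'.
      by rewrite -Rmult_plus_distr_l -E'; ring.
    case: eqP => _; last by rewrite big1 // => l _; ring.
    by rewrite zaE Rsum_scal; apply: eq_bigr => l _; ring.
  move=> E'; lra.
rewrite DE.
have B1 := H1 x; rewrite -/(tau x) in B1.
have B2 : Rabs (\big[Rplus/0]_(l < (r - k).+1) (cl l * (tau x / 2 * Dl l x))) <=
    INR (r - k).+1 * (tau x / 2 * (B * C2) * tau x ^ p).
  rewrite -Rsum_const_ord; apply: Rsum_abs_le => l _.
  rewrite (_ : cl l * _ = tau x / 2 * (c l x * (tau x ^ l * Dl l x))); last by rewrite /cl; ring.
  rewrite Rabs_mult (Rabs_pos_eq (tau x / 2)); last lra.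
  rewrite (_ : tau x / 2 * (B * C2) * _ = tau x / 2 * (B * (C2 * tau x ^ p))); last ring.
  by apply: Rmult_le_compat_l; [lra|apply: Rabs_mult_le].
have B3 : Rabs (Ihat (fun s => hat a b rho x s * w x s)) <= C3 * tau x ^ p.
  apply: Rle_trans (H3 x) _; rewrite -pow_add.
  by apply: Rmult_le_compat_l => //; apply: pow_tau_le; rewrite /q; lia.
have pw := w0 p x.
apply: Rle_trans (Rabs_triang _ _) _; apply: Rle_trans (Rplus_le_compat_r _ _ _ (Rabs_triang _ _)) _.
have half y : Rabs (tau x / 2 * y) = tau x / 2 * Rabs y.
  by rewrite Rabs_mult (Rabs_pos_eq (tau x / 2)) //; lra.
rewrite !half.
set S1 := Rabs (RInt _ _ _ - _) in B1 *; set S3 := Rabs (Ihat _) in B3 *; set S2 := Rabs _ in B2 *.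
have G1 : tau x / 2 * S1 <= tau x / 2 * (C1 * tau x ^ p) by apply: Rmult_le_compat_l; lra.
have G3 : tau x / 2 * S3 <= tau x / 2 * (C3 * tau x ^ p) by apply: Rmult_le_compat_l; lra.
have P1 : 0 <= tau x * (C1 * tau x ^ p) by repeat apply: Rmult_le_pos => //; lra.
have P3 : 0 <= tau x * (C3 * tau x ^ p) by repeat apply: Rmult_le_pos => //; lra.
have P2 : 0 <= tau x * (INR (r - k).+1 * (B * C2) * tau x ^ p).
  by repeat apply: Rmult_le_pos => //; try lra; apply: pos_INR.
rewrite [tau x ^ p.+1]/=; lra.
Qed.

Lemma defect_bound : (p + k <= r + r + 1)%nat ->
  quad_ord p \/ ((p <= r)%nat /\ interp_ord (r - k) p) ->
  exists C, 0 <= C /\ forall x, Rabs (defect x) <= C * tau x ^ p.+1.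
Proof. by move=> Hp [|[]]; [apply: defect_quadrature|apply: defect_small_residual]. Qed.

End Defect.
End ResidualFam.
End Residual.
End Reference.

(** * Linearisation and dual problem *)

(** The exact solution is differentiated only in the interior. The intermediate point supplied by
    the mean value theorem might be an end point, so the derivative is given the value [0] there. *)
Lemma mvt_bound_open f f' x y K : x <= y -> 0 <= K ->
  (forall t, x < t < y -> is_derive f t (f' t)) ->
  (forall t, x <= t <= y -> continuity_pt f t) ->
  (forall t, x < t < y -> Rabs (f' t) <= K) -> Rabs (f y - f x) <= K * (y - x).
Proof.
move=> le K0 Hd Hc HK.
pose df t := if excluded_middle_informative (x < t < y) then f' t else 0.
have [||c [_ ->]] := @MVT_gen f x y df.
- rewrite Rmin_left // Rmax_right // => t Ht; rewrite /df.
  by case: (excluded_middle_informative (x < t < y)) => H; [apply: Hd|case: H].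
- by rewrite Rmin_left // Rmax_right.
rewrite Rabs_mult (Rabs_pos_eq (y - x)); last lra.
apply: Rmult_le_compat_r; first lra.
rewrite /df; case: (excluded_middle_informative (x < c < y)) => H; [exact: HK|by rewrite Rabs_R0].
Qed.

Section Linearise.
Variables (d : nat) (G : R -> vec d -> R) (t0 t1 K : R).
Hypothesis G_smooth : smooth_scalar G.

Definition vmove (y v : vec d) (s : R) : vec d := fun j => y j + s * v j.

Lemma vmove_bd y v s : (forall j, Rabs (y j) <= K) -> (forall j, Rabs (v j) <= K) -> 0 <= s <= 1 ->
  forall j, Rabs (vmove y v s j) <= 2 * K.
Proof.
move=> Hy Hv Hs j; rewrite /vmove; have := Hy j; have := Hv j.
have := Rabs_triang (y j) (s * v j); rewrite Rabs_mult (Rabs_pos_eq s); last lra.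
have := Rabs_pos (v j); nra.
Qed.

Lemma is_derive_vmove H t y v s : smooth_scalar H ->
  is_derive (fun s => H t (vmove y v s)) s
    (\big[Rplus/0]_(i < d) (pd H (Some i) t (vmove y v s) * v i)).
Proof.
move=> HH; have := @smooth_chain d H (fun _ => t) (vmove y v) s 0 v HH (is_derive_const _ _) _.
rewrite Rmult_0_r Rplus_0_l; apply=> j; rewrite /vmove; auto_derive => //; ring.
Qed.

(** Mean value theorem along the segment, which stays in the box of radius [2 * K] where the partial
    derivatives are bounded. *)
Lemma smooth_lipschitz : exists C, 0 <= C /\ forall t y v E, t0 <= t <= t1 ->
  (forall j, Rabs (y j) <= K) -> (forall j, Rabs (v j) <= K) -> (forall j, Rabs (v j) <= E) ->
  forall s, 0 <= s <= 1 -> Rabs (G t (vmove y v s) - G t (vmove y v 0)) <= C * E.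
Proof.
have [B [B0 HB]] : exists B, 0 <= B /\ forall (i : 'I_d) (x : {x : R * vec d | t0 <= x.1 <= t1 /\ forall j, Rabs (x.2 j) <= 2 * K}),
    Rabs (pd G (Some i) (sval x).1 (sval x).2) <= B * 1.
  apply: (@finite_bound _ _ (fun (i : 'I_d) (x : {x : R * vec d | t0 <= x.1 <= t1 /\ forall j, Rabs (x.2 j) <= 2 * K}) =>
    pd G (Some i) (sval x).1 (sval x).2) (fun _ => 1)) => [i|_]; last lra.
  have [B [B0 HB]] := jcont_bounded t0 t1 (2 * K) (smooth_jcont (smooth_pd (Some i) G_smooth)).
  by exists B; split=> // -[[t y] [Ht Hy]] /=; rewrite Rmult_1_r; apply: HB.
exists (INR d * B); split; first by apply: Rmult_le_pos => //; apply: pos_INR.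
move=> t y v E Ht Hy Hv HE s Hs.
apply: Rle_trans (_ : INR d * (B * E) * (s - 0) <= _); last first.
  case: (posnP d) => [->|d0]; first by rewrite /=; lra.
  have E0 : 0 <= E by have := HE (Ordinal d0); have := Rabs_pos (v (Ordinal d0)); lra.
  have : 0 <= INR d * (B * E) by apply: Rmult_le_pos; [apply: pos_INR|apply: Rmult_le_pos].
  nra.
apply: (@mvt_bound (fun s => G t (vmove y v s)) (fun s => \big[Rplus/0]_(i < d) (pd G (Some i) t (vmove y v s) * v i))).
- lra.
- by move=> s' _; apply: is_derive_vmove.
move=> s' Hs'; rewrite -Rsum_const_ord; apply: Rsum_abs_le => i _; apply: Rabs_mult_le => //.
have Hs'' : 0 <= s' <= 1 by lra.
by have := HB i (exist _ (t, vmove y v s') (conj Ht (vmove_bd Hy Hv Hs''))) => /=; rewrite Rmult_1_r.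
Qed.

End Linearise.

Lemma smooth_linearise (d : nat) (G : R -> vec d -> R) (t0 t1 K : R) : smooth_scalar G ->
  exists C, 0 <= C /\ forall t y v E, t0 <= t <= t1 -> (forall j, Rabs (y j) <= K) ->
    (forall j, Rabs (v j) <= K) -> (forall j, Rabs (v j) <= E) ->
    Rabs (G t (fun j => y j + v j) - G t y - \big[Rplus/0]_(i < d) (pd G (Some i) t y * v i))
      <= C * E ^ 2.
Proof.
move=> HG.
have Hi (i : 'I_d) := smooth_lipschitz t0 t1 K (smooth_pd (Some i) HG).
pose Y := {x : R * vec d * vec d * R * R | t0 <= x.1.1.1.1 <= t1 /\
  (forall j, Rabs (x.1.1.1.2 j) <= K) /\ (forall j, Rabs (x.1.1.2 j) <= K) /\
  (forall j, Rabs (x.1.1.2 j) <= x.1.2) /\ 0 <= x.1.2 /\ 0 <= x.2 <= 1}.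
have [B [B0 HB]] : exists B, 0 <= B /\ forall (i : 'I_d) (x : Y),
    let: (t, y, v, E, s) := sval x in
    Rabs (pd G (Some i) t (vmove y v s) - pd G (Some i) t (vmove y v 0)) <= B * E.
  have [|[[[[[t y] v] E] s] /= H]|B [B0 HB]] := @finite_bound 'I_d Y
    (fun i x => let: (t, y, v, E, s) := sval x in
       pd G (Some i) t (vmove y v s) - pd G (Some i) t (vmove y v 0)) (fun x => (sval x).1.2).
  - move=> i; have [C [C0 HC]] := Hi i; exists C; split=> //.
    by move=> [[[[[t y] v] E] s] /= [H1 [H2 [H3 [H4 [H5 H6]]]]]]; apply: HC.
  - by tauto.
  exists B; split=> // i x; have := HB i x.
  by case: x => [[[[[t y] v] E] s] /= H].
exists (INR d * B); split; first by apply: Rmult_le_pos => //; apply: pos_INR.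
move=> t y v E Ht Hy Hv HE.
case: (posnP d) => [d0|d0].
  have e1 : (fun j => y j + v j) = y by apply: functional_extensionality => -[j Hj]; exfalso; lia.
  have e2 : \big[Rplus/0]_(i < d) (pd G (Some i) t y * v i) = 0.
    by apply: big1 => -[j Hj]; exfalso; lia.
  by rewrite e1 e2 d0 /= (_ : _ - _ - 0 = 0) ?Rabs_R0; [lra|ring].
have E0 : 0 <= E by have := HE (Ordinal d0); have := Rabs_pos (v (Ordinal d0)); lra.
pose L := \big[Rplus/0]_(i < d) (pd G (Some i) t y * v i).
(* Along the segment the derivative of [h] pairs increments of the partial derivatives with [v], and
   both factors are of order [E]. *)
pose h s := G t (vmove y v s) - L * s.
have y0 : vmove y v 0 = y by apply: functional_extensionality => j; rewrite /vmove; ring.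
have y1 : vmove y v 1 = (fun j => y j + v j) by apply: functional_extensionality => j; rewrite /vmove; ring.
have -> : G t (fun j => y j + v j) - G t y - L = h 1 - h 0 by rewrite /h y0 y1; ring.
rewrite (_ : INR d * B * E ^ 2 = INR d * (B * E * E) * (1 - 0)); last ring.
apply: (@mvt_bound _ (fun s => \big[Rplus/0]_(i < d) ((pd G (Some i) t (vmove y v s)
   - pd G (Some i) t (vmove y v 0)) * v i))); first lra.
  move=> s _; have D := is_derive_vmove t y v s HG.
  have -> : \big[Rplus/0]_(i < d) ((pd G (Some i) t (vmove y v s) - pd G (Some i) t (vmove y v 0)) * v i)
     = \big[Rplus/0]_(i < d) (pd G (Some i) t (vmove y v s) * v i) - L.
    rewrite y0 /L /Rminus -[X in _ = _ + X]Rmult_1_l -Ropp_mult_distr_r Ropp_mult_distr_l Rsum_scal.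
    by rewrite -big_split; apply: eq_bigr => i _ /=; ring.
  apply: is_derive_minus; first exact: D.
  by auto_derive => //; ring.
move=> s Hs; rewrite -Rsum_const_ord; apply: Rsum_abs_le => i _; apply: Rabs_mult_le => //.
exact: (HB i (exist _ (t, y, v, E, s) (conj Ht (conj Hy (conj Hv (conj HE (conj E0 Hs))))))).
Qed.

(* Picard iterates of the dual problem: each one gains a factor [tau] in the residual. *)
Section Dual.
Variables (X : Type) (d : nat) (a b : X -> R) (A : 'I_d -> 'I_d -> X -> R -> R) (j0 : 'I_d).
Hypothesis hab : forall x, a x < b x <= a x + 1.
Hypothesis A_fam : forall i l, fam a b (fun _ => 1) (A i l).
Let tau x := b x - a x.
Let del (l : 'I_d) : R := if l == j0 then 1 else 0.

(** The sum runs over the first index of [A], so the transpose acts. *)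
Fixpoint picard (n : nat) (l : 'I_d) (x : X) (t : R) : R :=
  if n is n'.+1 then
    del l - RInt (fun s => \big[Rplus/0]_(i < d) (A i l x s * picard n' i x s)) (a x) t
  else del l.

Arguments picard : simpl never.

Let rhs n l x s := \big[Rplus/0]_(i < d) (A i l x s * picard n i x s).

Lemma fam_mul1 (g h : X -> R -> R) : fam a b (fun _ => 1) g -> fam a b (fun _ => 1) h ->
  fam a b (fun _ => 1) (fun x s => g x s * h x s).
Proof.
move=> G H; apply: (@fam_weaken _ _ _ (fun x => 1 * 1) _ _ 1); [lra|by move=> x; lra|].
by apply: fam_mul => // x; lra.
Qed.

Lemma del_le1 l : Rabs (del l) <= 1.
Proof. by rewrite /del; case: ifP => _; rewrite ?Rabs_R1 ?Rabs_R0; lra. Qed.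

Lemma picard_fam n l : fam a b (fun _ => 1) (picard n l).
Proof.
have p1 := @one_ge0 X; have hab' x : a x <= b x <= a x + 1 by have := hab x; lra.
elim: n l => [|n IH] l.
  by apply: fam_const => //; exists 1 => x; have := del_le1 l; lra.
apply: fam_sub; first by apply: fam_const => //; exists 1 => x; have := del_le1 l; lra.
apply: (proj1 (@fam_RInt _ a b (fun _ => 1) (rhs n l) hab' p1 _)).
apply: (@fam_sum _ _ _ _ _ _ (fun i x s => A i l x s * picard n i x s)) => // i.
exact: fam_mul1.
Qed.

Lemma rhs_fam n l : fam a b (fun _ => 1) (rhs n l).
Proof.
apply: (@fam_sum _ _ _ _ _ _ (fun i x s => A i l x s * picard n i x s)); first exact: one_ge0.
by move=> i; apply: fam_mul1 => //; apply: picard_fam.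
Qed.

Lemma picard_init n l x : picard n l x (a x) = del l.
Proof. by case: n => // n; rewrite /picard -/picard RInt_point /zero /=; ring. Qed.

Lemma picard_derive n l x t : is_derive (picard n.+1 l x) t (- rhs n l x t).
Proof.
have hab' y : a y <= b y <= a y + 1 by have := hab y; lra.
have [_ D] := fam_RInt hab' (@one_ge0 X) (rhs_fam n l).
have -> : - rhs n l x t = minus 0 (rhs n l x t) by rewrite /minus /plus /opp /=; ring.
apply: is_derive_minus; first exact: is_derive_const.
exact: D.
Qed.

Lemma picard_near_init n l : exists C, 0 <= C /\ forall x t, a x <= t <= b x ->
  Rabs (picard n l x t - del l) <= C * tau x.
Proof.
case: n => [|n].
  exists 0; split; first lra.
  by move=> x t _ /=; rewrite Rminus_diag Rabs_R0; lra.
have [C [C0 HC]] := fam_bd (rhs_fam n l); exists C; split=> // x t Ht.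
rewrite -(picard_init n.+1 l x).
apply: Rle_trans (_ : C * (t - a x) <= _); last first.
  by apply: Rmult_le_compat_l => //; rewrite /tau; lra.
apply: (@mvt_bound _ (fun t => - rhs n l x t)); first lra.
  by move=> s _; apply: picard_derive.
by move=> s Hs; rewrite Rabs_Ropp; have := HC x s; rewrite Rmult_1_r; apply; lra.
Qed.

Lemma A_bd : exists C, 0 <= C /\ forall i l x t, a x <= t <= b x -> Rabs (A i l x t) <= C.
Proof.
pose Y := {p : X * R | a p.1 <= p.2 <= b p.1}.
have [[i l] /=|_|C [C0 HC]] := @finite_bound ('I_d * 'I_d)%type Y
  (fun il p => A il.1 il.2 (sval p).1 (sval p).2) (fun _ => 1); try lra.
  have [C [C0 HC]] := fam_bd (A_fam i l); exists C; split=> //.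
  by move=> [[x t] /= Ht]; apply: HC.
exists C; split=> // i l x t Ht.
by have := HC (i, l) (exist _ (x, t) Ht) => /=; rewrite Rmult_1_r.
Qed.

Lemma picard_step n : exists C, 0 <= C /\ forall l x t, a x <= t <= b x ->
  Rabs (picard n.+1 l x t - picard n l x t) <= C * tau x ^ n.
Proof.
have [CA [CA0 HA]] := A_bd.
elim: n => [|n [C [C0 HC]]].
  pose Y := {p : X * R | a p.1 <= p.2 <= b p.1}.
  have [l|_|C [C0 HC]] := @finite_bound 'I_d Y
     (fun l p => picard 1 l (sval p).1 (sval p).2 - picard 0 l (sval p).1 (sval p).2)
     (fun _ => 1); try lra.
    have [C [C0 HC]] := picard_near_init 1 l; exists C; split=> //.
    move=> [[x t] /= Ht]; apply: Rle_trans (HC x t Ht) _.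
    by apply: Rmult_le_compat_l => //; rewrite /tau; have := hab x; lra.
  exists C; split=> // l x t Ht.
  by have := HC l (exist _ (x, t) Ht).
exists (INR d * (CA * C)); split.
  by apply: Rmult_le_pos; [apply: pos_INR|apply: Rmult_le_pos].
move=> l x t Ht; have ab := hab x.
have t0 : 0 <= tau x by rewrite /tau; lra.
have pt : 0 <= tau x ^ n by apply: pow_le.
pose h t := picard n.+2 l x t - picard n.+1 l x t.
have h0 : h (a x) = 0 by rewrite /h !picard_init; ring.
have -> : picard n.+2 l x t - picard n.+1 l x t = h t - h (a x) by rewrite h0 /h; ring.
apply: Rle_trans (_ : INR d * (CA * (C * tau x ^ n)) * (t - a x) <= _); last first.
  rewrite (_ : _ * tau x ^ n.+1 = INR d * (CA * (C * tau x ^ n)) * tau x); last by rewrite /=; ring.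
  apply: Rmult_le_compat_l; last by rewrite /tau; lra.
  by apply: Rmult_le_pos; [apply: pos_INR|repeat apply: Rmult_le_pos => //].
apply: (@mvt_bound _ (fun t => - rhs n.+1 l x t - - rhs n l x t)); first lra.
  by move=> s _; apply: is_derive_minus; apply: picard_derive.
move=> s Hs.
have -> : - rhs n.+1 l x s - - rhs n l x s =
    \big[Rplus/0]_(i < d) (A i l x s * - (picard n.+1 i x s - picard n i x s)).
  have -> : - rhs n.+1 l x s - - rhs n l x s = -1 * rhs n.+1 l x s + rhs n l x s by ring.
  by rewrite /rhs Rsum_scal -big_split; apply: eq_bigr => i _; rewrite [LHS]/=; ring.
rewrite -Rsum_const_ord; apply: Rsum_abs_le => i _; apply: Rabs_mult_le; first by apply: HA; lra.
by rewrite Rabs_Ropp; apply: HC; lra.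
Qed.

Lemma dual_solution p : exists z : 'I_d -> X -> R -> R,
  (forall l, fam a b (fun _ => 1) (z l)) /\
  (forall l x, z l x (a x) = del l) /\
  (exists C, 0 <= C /\ forall l x t, a x <= t <= b x -> Rabs (z l x t - del l) <= C * tau x) /\
  (exists C, 0 <= C /\ forall l x t, a x <= t <= b x ->
     Rabs (Derive (z l x) t + \big[Rplus/0]_(i < d) (A i l x t * z i x t)) <= C * tau x ^ p).
Proof.
(* The residual of an iterate is the transpose of [A] applied to its difference from the preceding
   one, here of order [tau ^ p]. *)
exists (picard p.+1); split; first by move=> l; apply: picard_fam.
split; first by move=> l x; apply: picard_init.
split.
  pose Y := {q : X * R | a q.1 <= q.2 <= b q.1}.
  have [l|[[x t] Ht] /=|C [C0 HC]] := @finite_bound 'I_d Y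
     (fun l q => picard p.+1 l (sval q).1 (sval q).2 - del l) (fun q => tau (sval q).1).
  - have [C [C0 HC]] := picard_near_init p.+1 l; exists C; split=> //.
    by move=> [[x t] /= Ht]; apply: HC.
  - by rewrite /tau; have := hab x; lra.
  by exists C; split=> // l x t Ht; apply: (HC l (exist _ (x, t) Ht)).
have [CA [CA0 HA]] := A_bd; have [C [C0 HC]] := picard_step p.
exists (INR d * (CA * C)); split.
  by apply: Rmult_le_pos; [apply: pos_INR|apply: Rmult_le_pos].
move=> l x t Ht; rewrite (is_derive_unique _ _ _ (picard_derive p l x t)).
have -> : - rhs p l x t + \big[Rplus/0]_(i < d) (A i l x t * picard p.+1 i x t) =
    \big[Rplus/0]_(i < d) (A i l x t * (picard p.+1 i x t - picard p i x t)).
  have -> : - rhs p l x t = -1 * rhs p l x t by ring.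
  by rewrite /rhs Rsum_scal -big_split; apply: eq_bigr => i _; rewrite [LHS]/=; ring.
rewrite (_ : _ * tau x ^ p = INR d * (CA * (C * tau x ^ p))); last ring.
rewrite -Rsum_const_ord; apply: Rsum_abs_le => i _; apply: Rabs_mult_le; first exact: HA.
exact: HC.
Qed.

End Dual.

(** * One step of the method *)

Section Step.
Variables (d : nat) (f : R -> vec d -> vec d) (t0 T : R) (r k : nat).
Variables (Ihat : (R -> R) -> R) (Iop : (R -> R) -> (R -> R)) (BU : nat -> R).

(** One step of any mesh together with the facts used about it. Only [f], the time interval, the
    method and [BU] are parameters, so constants uniform over this type depend on nothing else.
    [st_prev] is the left limit at the start of the step. *)
Record step : Type := Step {
  st_a : R; st_b : R; st_U : R -> vec d; st_prev : vec d;
  st_ab : st_a < st_b <= st_a + 1;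
  st_lo : t0 <= st_a;
  st_hi : st_b <= t0 + T;
  st_poly : forall j, pn r.+1 (fun t => st_U t j);
  st_init : (1 <= k)%nat -> forall j, st_U st_a j = st_prev j;
  st_right : forall i, (i < k./2)%nat -> forall j,
    Derive_n (fun t => st_U t j) i.+1 st_b = Derive_n (fun t => f t (st_U t) j) i st_b;
  st_left : forall i, (i < (k.-1)./2)%nat -> forall j,
    Derive_n (fun t => st_U t j) i.+1 st_a = Derive_n (fun t => f t (st_U t) j) i st_a;
  st_var : forall phi : R -> vec d,
    (forall j, is_poly_le (Z.of_nat (r - k)) (fun t => phi t j)) ->
    Iloc Ihat st_a st_b (fun t => vsum (fun j => Derive (fun s => st_U s j) t * phi t j))
    + (if k == 0%nat then vsum (fun j => (st_U st_a j - st_prev j) * phi st_a j) else 0)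
    = Iloc Ihat st_a st_b (fun t => vsum (fun j =>
        Ioploc Iop st_a st_b (fun s => f s (st_U s) j) t * phi t j));
  st_bd : forall l t, st_a <= t <= st_b ->
    vnorm (fun j => Derive_n (fun s => st_U s j) l t) <= BU l
}.

Hypothesis f_smooth : smooth_f f.
Implicit Type x : step.

Lemma step_U_fam j : fam st_a st_b (fun _ => 1) (fun x t => st_U x t j).
Proof.
move=> m.
suff H : forall n, exists B, 0 <= B /\ forall x,
    cb no_cond (itv (st_a x) (st_b x)) m B (Derive_n (fun t => st_U x t j) n).
  by have [B [B0 HB]] := H 0%nat; exists B; split=> // x; rewrite Rmult_1_r; apply: HB.
have bd x n t : st_a x <= t <= st_b x -> Rabs (Derive_n (fun t => st_U x t j) n t) <= Rabs (BU n).
  move=> Ht; apply: Rle_trans (coord_le_vnorm (fun j => Derive_n (fun s => st_U x s j) n t) j) _.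
  by apply: Rle_trans (st_bd n Ht) (Rle_abs _).
have D x n t : D_in (Derive_n (fun t => st_U x t j) n) (Derive_n (fun t => st_U x t j) n.+1) no_cond t.
  apply/D_in_is_derive; apply: Derive_correct.
  exact: (pn_ex_derive (pn_Derive_n n (st_poly x j))).
elim: m => [|m IH] n.
  exists (Rabs (BU n)); split; first exact: Rabs_pos.
  by move=> x; split=> [t Ht|t _]; [apply: bd|apply: D_in_cont (D x n t)].
have [B [B0 HB]] := IH n.+1; have p := Rabs_pos (BU n).
exists (Rabs (BU n) + B); split; first lra.
move=> x; split; first by move=> t Ht; have := bd x n t Ht; lra.
exists (Derive_n (fun t => st_U x t j) n.+1); split; first by move=> t _; apply: D.
by apply: cb_le (HB x); lra.
Qed.

Lemma step_U_bd x t : st_a x <= t <= st_b x -> forall j, Rabs (st_U x t j) <= BU 0%nat.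
Proof. by move=> Ht j; apply: Rle_trans (coord_le_vnorm (st_U x t) j) (st_bd 0 Ht). Qed.

Lemma step_smooth_fam G : smooth_scalar G -> fam st_a st_b (fun _ => 1) (fun x t => G t (st_U x t)).
Proof.
apply: (@fam_smooth step d st_a st_b st_U (fun _ t => t) t0 (t0 + T) (BU 0%nat)).
- by move=> x s Hs; have := st_lo x; have := st_hi x; lra.
- exact: step_U_bd.
- apply: fam_bounded_id; [exact: one_ge0| |by exists 1 => x; lra].
  exists (Rabs t0 + Rabs (t0 + T)) => x s Hs; have := st_lo x; have := st_hi x.
  by split_Rabs; lra.
- exact: step_U_fam.
Qed.

Let F (i : 'I_d) x t := f t (st_U x t) i.
Let dU (i : 'I_d) x := Derive (fun t => st_U x t i).
Let A (i l : 'I_d) x t := pd (fun t y => f t y i) (Some l) t (st_U x t).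
Let tau x := st_b x - st_a x.

Lemma step_F_fam i : fam st_a st_b (fun _ => 1) (F i).
Proof. exact: step_smooth_fam (f_smooth i). Qed.

Lemma step_dU_fam i : fam st_a st_b (fun _ => 1) (dU i).
Proof. exact: (fam_Derive (step_U_fam i)). Qed.

Lemma step_A_fam i l : fam st_a st_b (fun _ => 1) (A i l).
Proof. exact: step_smooth_fam (smooth_pd (Some l) (f_smooth i)). Qed.

Lemma step_dU_poly i x : pn r (dU i x).
Proof.
have [p' [Hp D]] := pn_derive (st_poly x i).
by apply: (pn_ext _ Hp) => t; rewrite /dU (is_derive_unique _ _ _ (D t)).
Qed.

Lemma Derive_n_rho i x n t :
  Derive_n (fun t => F i x t - dU i x t) n t =
  Derive_n (F i x) n t - Derive_n (fun t => st_U x t i) n.+1 t.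
Proof.
have ex g : fam st_a st_b (fun _ => 1) g -> forall m s, ex_derive_n (g x) m s.
  by move=> G [|m] s //=; eexists; apply: (fam_derive (fam_Derive_n m G) x s).
rewrite Derive_n_minus.
- by rewrite /dU -[Derive _]/(Derive_n (fun t => st_U x t i) 1) Derive_n_comp Nat.add_1_r.
- by apply: filter_forall => s m _; apply: ex; apply: step_F_fam.
- by apply: filter_forall => s m _; apply: ex; apply: step_dU_fam.
Qed.

Lemma Tinv_Tmap (a b s : R) : a < b -> Tinv a b (Tmap a b s) = s.
Proof. by move=> ab; rewrite /Tinv /Tmap; field; lra. Qed.

Lemma step_variational i x l : (l <= r - k)%nat ->
  tau x / 2 * Ihat (fun s => hat st_a st_b (dU i) x s * (1 + s) ^ l)
    + (if k == 0%nat then (st_U x (st_a x) i - st_prev x i) * 0 ^ l else 0)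
  = tau x / 2 * Jop Ihat Iop (fun s => (1 + s) ^ l) (hat st_a st_b (F i) x).
Proof.
move=> Hl; have ab := proj1 (st_ab x).
(* The pullback of [(1 + s) ^ l], tested in component [i] alone. At the left end it equals [0 ^ l],
   which is one for [l = 0]. *)
pose ps t := (1 + Tinv (st_a x) (st_b x) t) ^ l.
have col (c : 'I_d -> R) t : vsum (fun j => c j * (if j == i then ps t else 0)) = c i * ps t.
  rewrite /vsum -(Rsum_delta (fun j => c j * ps t) i); apply: eq_bigr => j _.
  by case: ifP => // _; ring.
have psT s : ps (Tmap (st_a x) (st_b x) s) = (1 + s) ^ l by rewrite /ps Tinv_Tmap.
have := @st_var x (fun t j => if j == i then ps t else 0).
have Hphi j : is_poly_le (Z.of_nat (r - k)) (fun t => if j == i then ps t else 0).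
  apply/is_poly_le_nat; case: eqP => _; last exact: pn0.
  apply: (@pn_leq l.+1); first by [].
  pose be := 2 / (st_b x - st_a x).
  apply: (pn_ext _ (pn_affine_pow l (1 - (st_a x + st_b x) / (st_b x - st_a x)) be)) => t.
  by rewrite /ps /be /Tinv; congr (_ ^ _); field; lra.
move=> /(_ Hphi); rewrite /Iloc.
have -> : (fun s => vsum (fun j => Derive (fun s => st_U x s j) (Tmap (st_a x) (st_b x) s) *
     (if j == i then ps (Tmap (st_a x) (st_b x) s) else 0))) =
   (fun s => hat st_a st_b (dU i) x s * (1 + s) ^ l).
  apply: functional_extensionality => s.
  by rewrite (col (fun j => Derive (fun s => st_U x s j) (Tmap (st_a x) (st_b x) s))) psT.
rewrite (col (fun j => st_U x (st_a x) j - st_prev x j)).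
have -> : ps (st_a x) = 0 ^ l.
  by rewrite /ps /Tinv; congr (_ ^ _); field; lra.
have -> : (fun s => vsum (fun j => Ioploc Iop (st_a x) (st_b x) (fun s => f s (st_U x s) j)
      (Tmap (st_a x) (st_b x) s) * (if j == i then ps (Tmap (st_a x) (st_b x) s) else 0))) =
   (fun s => Iop (hat st_a st_b (F i) x) s * (1 + s) ^ l).
  apply: functional_extensionality => s.
  rewrite (col (fun j => Ioploc Iop (st_a x) (st_b x) (fun s => f s (st_U x s) j)
      (Tmap (st_a x) (st_b x) s))) psT /Ioploc Tinv_Tmap //.
by [].
Qed.

Section Error.
Variables (kI kIop p : nat) (u : R -> vec d) (Berr : R).
Hypothesis d_gt0 : (0 < d)%nat.
Hypothesis k_le_r : (k <= r)%nat.
Hypothesis I_ok : Ihat_ok Ihat kI.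
Hypothesis O_ok : Iop_ok Iop kIop.
Hypothesis A1 : Assumption_A1 Ihat r k.
Hypothesis A2 : Assumption_A2 d Ihat kI.
Hypothesis A3 : Assumption_A3 d Iop kI kIop.
Hypothesis p_le : (p + k <= r + r + 1)%nat.
Hypothesis p_interp : forall l, (l <= r - k)%nat -> interp_ord Ihat Iop l (p - l).
Hypothesis p_alt : quad_ord Ihat p \/ ((p <= r)%nat /\ interp_ord Ihat Iop (r - k) p).
Hypothesis u_sol : forall j, has_deriv_on t0 (t0 + T) (fun t => u t j) (fun t => f t (u t) j).

Lemma step_defect i z : fam st_a st_b (fun _ => 1) z -> exists C, 0 <= C /\ forall x,
  Rabs (RInt (fun t => (F i x t - dU i x t) * z x t) (st_a x) (st_b x)
        - (if k == 0%nat then (st_U x (st_a x) i - st_prev x i) * z x (st_a x) else 0))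
    <= C * tau x ^ p.+1.
Proof.
move=> z_fam.
apply: (@defect_bound d Ihat Iop kI kIop d_gt0 I_ok O_ok A2 A3 r k k_le_r A1 step st_a st_b st_ab
  (F i) (dU i) (step_F_fam i) (step_dU_fam i) (step_dU_poly i) _ _
  (fun x => st_U x (st_a x) i - st_prev x i) (step_variational i) z p z_fam p_interp p_le p_alt).
- by move=> x n Hn; rewrite Derive_n_rho (st_right x Hn); apply: Rminus_diag.
- by move=> x n Hn; rewrite Derive_n_rho (st_left x Hn); apply: Rminus_diag.
Qed.

(* [u] frozen outside of [[t0, t0 + T]], to be continuous on the whole line. *)
Let uc (t : R) (j : 'I_d) : R := u (Rmax t0 (Rmin t (t0 + T))) j.

Lemma ucE t : t0 <= t <= t0 + T -> uc t = u t.
Proof.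
by move=> Ht; apply: functional_extensionality => j; rewrite /uc Rmin_left ?Rmax_right; lra.
Qed.

Lemma uc_cont j t : 0 < T -> continuity_pt (fun t => uc t j) t.
Proof.
move=> T0.
pose c s := Rmax t0 (Rmin s (t0 + T)).
have cE s : (s <= t0 /\ c s = t0) \/ (t0 <= s <= t0 + T /\ c s = s) \/ (t0 + T <= s /\ c s = t0 + T).
  have [H1|H1] := Rle_or_lt s t0.
    by left; split=> //; rewrite /c Rmin_left ?Rmax_left; lra.
  have [H2|H2] := Rle_or_lt s (t0 + T).
    by right; left; split; [lra|rewrite /c Rmin_left ?Rmax_right; lra].
  by right; right; split; [lra|rewrite /c Rmin_right ?Rmax_right; lra].
have cr s : t0 <= c s <= t0 + T by have := cE s; lra.
have cl s s' : Rabs (c s - c s') <= Rabs (s - s').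
  by have := cE s; have := cE s'; split_Rabs; lra.
have L : limit1_in (fun t => u t j) (itv t0 (t0 + T)) (u (c t) j) (c t).
  apply: (@D_in_cont _ _ (fun t => f t (u t) j)) => eps Heps.
  have [al [Hal H1]] := u_sol j (cr t) Heps; exists al; split=> // y [[Hy Hne] Hd].
  by apply: H1 => //; apply: not_eq_sym.
move=> eps Heps; have [al [Hal H1]] := L eps Heps; exists al; split=> // y [_ Hd].
apply: H1; split; first exact: cr.
by apply: Rle_lt_trans (cl y t) _.
Qed.

Lemma uc_derive j t : t0 < t < t0 + T -> is_derive (fun t => uc t j) t (f t (u t) j).
Proof.
move=> Ht; apply/is_derive_Reals => eps Heps.
have Ht' : t0 <= t <= t0 + T by lra.
have [al [Hal H1]] := u_sol j Ht' Heps.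
have m0 : 0 < Rmin al (Rmin (t - t0) (t0 + T - t)) by repeat apply: Rmin_pos; lra.
exists (mkposreal _ m0) => h h0 /= Hh.
have m1 := Rmin_l al (Rmin (t - t0) (t0 + T - t)); have m2 := Rmin_r al (Rmin (t - t0) (t0 + T - t)).
have m3 := Rmin_l (t - t0) (t0 + T - t); have m4 := Rmin_r (t - t0) (t0 + T - t).
have Hth : t0 <= t + h <= t0 + T by move: Hh; split_Rabs; lra.
rewrite !ucE //.
have := H1 (t + h) Hth; rewrite (_ : t + h - t = h); last ring.
by apply; [move: h0; lra|lra].
Qed.

(** The two bounds on the error differ in their quantifiers. [Berr] is fixed before [C]: it confines
    [u] to a compact set and multiplies the residual of the dual solution. [E] comes after [C] and
    enters quadratically. *)
Lemma step_error : 0 < T -> exists C, 0 <= C /\ forall x E, 0 <= E ->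
  (forall t j, st_a x < t <= st_b x -> Rabs (u t j - st_U x t j) <= Berr) ->
  (forall t j, st_a x < t <= st_b x -> Rabs (u t j - st_U x t j) <= E) ->
  forall j, Rabs (u (st_b x) j - st_U x (st_b x) j) <=
    Rabs (u (st_a x) j - st_prev x j)
    + C * tau x * \big[Rplus/0]_(i < d) Rabs (u (st_b x) i - st_U x (st_b x) i)
    + C * tau x * (E ^ 2 + tau x ^ p).
Proof.
move=> T0.
pose N := INR d.
have N0 : 0 <= N by apply: pos_INR.
have one_coord (j : 'I_d) : exists C, 0 <= C /\ forall x E, 0 <= E ->
    (forall t j, st_a x < t <= st_b x -> Rabs (u t j - st_U x t j) <= Berr) ->
    (forall t j, st_a x < t <= st_b x -> Rabs (u t j - st_U x t j) <= E) ->
    Rabs (u (st_b x) j - st_U x (st_b x) j) <=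
      Rabs (u (st_a x) j - st_prev x j)
      + C * tau x * \big[Rplus/0]_(i < d) Rabs (u (st_b x) i - st_U x (st_b x) i)
      + C * tau x * (E ^ 2 + tau x ^ p).
  have [z [z_fam [z_init [[Cz [Cz0 Hz]] [Cr [Cr0 Hr]]]]]] := dual_solution j st_ab step_A_fam p.
  have [CQ [CQ0 HQ]] : exists C, 0 <= C /\ forall (i : 'I_d) x E t, 0 <= E ->
      (forall l, Rabs (u t l - st_U x t l) <= Berr) -> (forall l, Rabs (u t l - st_U x t l) <= E) ->
      st_a x <= t <= st_b x ->
      Rabs (f t (u t) i - F i x t - \big[Rplus/0]_(l < d) (A i l x t * (u t l - st_U x t l))) <= C * E ^ 2.
    pose Y := {q : step * R * R | 0 <= q.1.2 /\ st_a q.1.1 <= q.2 <= st_b q.1.1 /\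
       (forall l, Rabs (u q.2 l - st_U q.1.1 q.2 l) <= Berr) /\ (forall l, Rabs (u q.2 l - st_U q.1.1 q.2 l) <= q.1.2)}.
    have [i|[[[x E] t] /= _]|C [C0 HC]] := @finite_bound 'I_d Y (fun i q => let: (x, E, t) := sval q in
       f t (u t) i - F i x t - \big[Rplus/0]_(l < d) (A i l x t * (u t l - st_U x t l)))
       (fun q => (sval q).1.2 ^ 2); last 2 first.
    - exact: pow2_ge_0.
    - exists C; split=> // i x E t E0 H1 H2 Ht.
      exact: (HC i (exist _ (x, E, t) (conj E0 (conj Ht (conj H1 H2))))).
    have [C [C0 HC]] := smooth_linearise t0 (t0 + T) (Rabs Berr + Rabs (BU 0%nat)) (f_smooth i).
    exists C; split=> // -[[[x E] t] /= [E0 [Ht [H1 H2]]]].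
    have := HC t (st_U x t) (fun l => u t l - st_U x t l) E.
    rewrite (_ : (fun l => st_U x t l + (u t l - st_U x t l)) = u t); last first.
      by apply: functional_extensionality => l; ring.
    apply=> //.
    - by have := st_lo x; have := st_hi x; lra.
    - move=> l; have := step_U_bd Ht l; have := Rabs_pos Berr; have := Rle_abs (BU 0%nat); lra.
    - by move=> l; have := H1 l; have := Rabs_pos (BU 0%nat); have := Rle_abs Berr; lra.
  have [CD [CD0 HD]] : exists C, 0 <= C /\ forall i x,
      Rabs (RInt (fun t => (F i x t - dU i x t) * z i x t) (st_a x) (st_b x)
        - (if k == 0%nat then (st_U x (st_a x) i - st_prev x i) * z i x (st_a x) else 0))
      <= C * tau x ^ p.+1.
    apply: (@finite_bound 'I_d step (fun i x => RInt (fun t => (F i x t - dU i x t) * z i x t) (st_a x) (st_b x)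
        - (if k == 0%nat then (st_U x (st_a x) i - st_prev x i) * z i x (st_a x) else 0))) => [i|x].
      exact: step_defect.
    exact: (pow_tau_ge0 st_ab).
  pose Bz := 1 + Cz.
  have zbd i x t : st_a x <= t <= st_b x -> Rabs (z i x t) <= Bz.
    move=> Ht; have := Hz i x t Ht; have := del_le1 j i => H1 H2.
    have ab := st_ab x.
    have : Cz * tau x <= Cz by rewrite /tau; nra.
    move: H1 H2; rewrite -/(tau x) /Bz; split_Rabs; lra.
  have Bz0 : 0 <= Bz by rewrite /Bz; lra.
  pose K := N * (CQ * Bz) + N * (Rabs Berr * Cr).
  have K0 : 0 <= K.
    have := Rabs_pos Berr => B0.
    by apply: Rplus_le_le_0_compat; repeat apply: Rmult_le_pos => //.
  exists (Cz + K + N * CD).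
  have ND0 : 0 <= N * CD by apply: Rmult_le_pos.
  split; first by lra.
  move=> x E E0 He1 He2.
  have ab := st_ab x; have lo := st_lo x; have hi := st_hi x.
  have ta : 0 < tau x by rewrite /tau; lra.
  have pt : 0 <= tau x ^ p by apply: pow_le; lra.
  set a := st_a x in ab lo hi He1 He2 *; set b := st_b x in ab lo hi He1 He2 *.
  pose e t i := uc t i - st_U x t i.
  pose I t := \big[Rplus/0]_(i < d) RInt (fun t => (F i x t - dU i x t) * z i x t) a t.
  (* Subtracting the integral removes the residual from the derivative of [e . z]; it reappears in
     [Q], where the defect bound applies. *)
  pose H t := \big[Rplus/0]_(i < d) (e t i * z i x t) - I t.
  have rz_fam i : fam st_a st_b (fun _ => 1) (fun x t => (F i x t - dU i x t) * z i x t).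
    by apply: fam_mul1 => //; apply: fam_sub; [apply: step_F_fam|apply: step_dU_fam].
  have DI t : is_derive I t (\big[Rplus/0]_(i < d) ((F i x t - dU i x t) * z i x t)).
    apply: (@is_derive_Rsum _ _ (fun i t => RInt (fun t => (F i x t - dU i x t) * z i x t) a t)
      (fun i t => (F i x t - dU i x t) * z i x t)) => i.
    have hab' y : st_a y <= st_b y <= st_a y + 1 by have := st_ab y; lra.
    by have [_ D] := fam_RInt hab' (@one_ge0 step) (rz_fam i); apply: D.
  have DU t i : is_derive (fun t => st_U x t i) t (dU i x t) by apply: (fam_derive (step_U_fam i)).
  have Dz t i : is_derive (z i x) t (Derive (z i x) t) by apply: (fam_derive (z_fam i)).
  pose dH t := \big[Rplus/0]_(i < d) ((f t (u t) i - dU i x t) * z i x t + e t i * Derive (z i x) t)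
     - \big[Rplus/0]_(i < d) ((F i x t - dU i x t) * z i x t).
  have DH t : a < t < b -> is_derive H t (dH t).
    move=> Ht; apply: is_derive_minus => //.
    apply: (@is_derive_Rsum _ _ (fun i t => e t i * z i x t)
      (fun i t => (f t (u t) i - dU i x t) * z i x t + e t i * Derive (z i x) t)) => i.
    have De : is_derive (fun t => e t i) t (f t (u t) i - dU i x t).
      by apply: is_derive_minus => //; apply: uc_derive; lra.
    have := is_derive_mult (fun t => e t i) (z i x) t _ _ De (Dz t i).
    by rewrite /plus /mult /=; apply; apply: Rmult_comm.
  have cont_of_derive g l t : is_derive g t l -> continuity_pt g t.
    by move=> D; apply: derivable_continuous_pt; apply: ex_derive_Reals_0; exists l.
  have CH t : continuity_pt H t.
    apply: continuity_pt_minus; last exact: cont_of_derive (DI t).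
    suff : forall s : seq 'I_d, continuity_pt (fun t => \big[Rplus/0]_(i <- s) (e t i * z i x t)) t by apply.
    elim=> [|i s IH].
      apply: (continuity_pt_ext (fun _ => 0)); first by move=> y; rewrite big_nil.
      exact: continuity_pt_const.
    apply: (continuity_pt_ext (fun t => e t i * z i x t + \big[Rplus/0]_(i <- s) (e t i * z i x t))).
      by move=> y; rewrite big_cons.
    apply: continuity_pt_plus => //; apply: continuity_pt_mult; last exact: cont_of_derive (Dz t i).
    apply: continuity_pt_minus; first exact: uc_cont.
    exact: cont_of_derive (DU t i).
  (* [A e] is added and subtracted, and exchanging the sums moves [A] onto [z]. What remains are the
     linearisation remainder and the residual of the dual equation. *)
  have dHE t : a < t < b -> dH t =
      \big[Rplus/0]_(i < d) ((f t (u t) i - F i x t - \big[Rplus/0]_(l < d) (A i l x t * e t l)) * z i x t)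
    + \big[Rplus/0]_(l < d) (e t l * (Derive (z l x) t + \big[Rplus/0]_(i < d) (A i l x t * z i x t))).
    move=> Ht; rewrite /dH.
    have ex : \big[Rplus/0]_(i < d) (\big[Rplus/0]_(l < d) (A i l x t * e t l) * z i x t) =
        \big[Rplus/0]_(l < d) (e t l * \big[Rplus/0]_(i < d) (A i l x t * z i x t)).
      rewrite (eq_bigr (fun i => \big[Rplus/0]_(l < d) (A i l x t * e t l * z i x t))); last first.
        by move=> i _; rewrite Rmult_comm Rsum_scal; apply: eq_bigr => l _; ring.
      rewrite exchange_big; apply: eq_bigr => l _; rewrite Rsum_scal.
      by apply: eq_bigr => i _ /=; ring.
    pose S1 := \big[Rplus/0]_(i < d) ((f t (u t) i - F i x t - \big[Rplus/0]_(l < d) (A i l x t * e t l)) * z i x t).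
    pose S2 := \big[Rplus/0]_(i < d) ((F i x t - dU i x t) * z i x t).
    pose S3 := \big[Rplus/0]_(i < d) (e t i * Derive (z i x) t).
    pose S4 := \big[Rplus/0]_(i < d) (\big[Rplus/0]_(l < d) (A i l x t * e t l) * z i x t).
    have -> : \big[Rplus/0]_(i < d) ((f t (u t) i - dU i x t) * z i x t + e t i * Derive (z i x) t) =
        S1 + S2 + S3 + S4.
      by rewrite -!big_split; apply: eq_bigr => i _ /=; ring.
    have -> : \big[Rplus/0]_(l < d) (e t l * (Derive (z l x) t + \big[Rplus/0]_(i < d) (A i l x t * z i x t))) =
        S3 + S4.
      by rewrite /S4 ex -big_split; apply: eq_bigr => i _ /=; ring.
    by rewrite -/S1 -/S2; ring.
  have eE t : t0 <= t <= t0 + T -> forall i, e t i = u t i - st_U x t i by move=> Ht i; rewrite /e ucE.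
  have HdH t : a < t < b -> Rabs (dH t) <= K * (E ^ 2 + tau x ^ p).
    move=> Ht; rewrite dHE //; apply: Rle_trans (Rabs_triang _ _) _.
    have Ht' : t0 <= t <= t0 + T by lra.
    have Ht2 : a < t <= b by lra.
    have Ht3 : a <= t <= b by lra.
    apply: Rle_trans (_ : N * (CQ * E ^ 2 * Bz) + N * (Rabs Berr * (Cr * tau x ^ p)) <= _); last first.
      have := pow2_ge_0 E; rewrite /K => E2.
      have : 0 <= N * (CQ * Bz) by repeat apply: Rmult_le_pos => //.
      have : 0 <= N * (Rabs Berr * Cr) by repeat apply: Rmult_le_pos => //; apply: Rabs_pos.
      nra.
    rewrite /N -!Rsum_const_ord; apply: Rplus_le_compat.
      apply: Rsum_abs_le => i _; apply: Rabs_mult_le; last exact: zbd.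
      rewrite (eq_bigr (fun l => A i l x t * (u t l - st_U x t l))); last by move=> l _; rewrite eE.
      by apply: HQ => // l; [apply: He1|apply: He2].
    apply: Rsum_abs_le => l _; apply: Rabs_mult_le; last exact: Hr.
    by rewrite eE //; apply: Rle_trans (He1 t l Ht2) (Rle_abs _).
  have MV : Rabs (H b - H a) <= K * (E ^ 2 + tau x ^ p) * (b - a).
    apply: (mvt_bound_open (f' := dH)) => //; try lra.
    by apply: Rmult_le_pos => //; have := pow2_ge_0 E; lra.
  have za i : z i x a = if i == j then 1 else 0 by rewrite z_init.
  have Ia : I a = 0 by apply: big1 => i _; rewrite RInt_point.
  have ea i : e a i = u a i - st_U x a i by apply: eE; lra.
  have eb i : e b i = u b i - st_U x b i by apply: eE; lra.
  pose Q := \big[Rplus/0]_(i < d) (RInt (fun t => (F i x t - dU i x t) * z i x t) a b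
        - (if k == 0%nat then (st_U x a i - st_prev x i) * z i x a else 0)).
  have HQ' : Rabs Q <= N * (CD * tau x ^ p.+1).
    by rewrite /N -Rsum_const_ord; apply: Rsum_abs_le => i _; apply: HD.
  (* For [k = 0] the jump turns the limit from the right at [a] into the one from the left; for
     [k >= 1] they agree by continuity. *)
  have Ha : H a + (I b - Q) = u a j - st_prev x j.
    have -> : I b - Q = \big[Rplus/0]_(i < d) (if k == 0%nat then (st_U x a i - st_prev x i) * z i x a else 0).
      rewrite /I /Q (_ : \big[_/_]_(i < d) RInt _ _ _ = Q +
         \big[Rplus/0]_(i < d) (if k == 0%nat then (st_U x a i - st_prev x i) * z i x a else 0)).
        by rewrite /Q; ring.
      by rewrite /Q -big_split; apply: eq_bigr => i _ /=; rewrite /Rminus Rplus_assoc Rplus_opp_l Rplus_0_r.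
    rewrite /H Ia Rminus_0_r -big_split /= -(Rsum_delta (fun i => u a i - st_prev x i) j).
    apply: eq_bigr => i _; rewrite ea za; case: (posnP k) => [k0|k0].
      by case: (i == j); ring.
    rewrite -(st_init x k0 i) -/a.
    by case: (i == j); ring.
  have Hb : H b = e b j + \big[Rplus/0]_(i < d) (e b i * (z i x b - (if i == j then 1 else 0))) - I b.
    rewrite /H; congr (_ - _).
    rewrite -(Rsum_delta (fun i => e b i) j) -big_split; apply: eq_bigr => i _ /=.
    by case: ifP => _; ring.
  have HS : Rabs (\big[Rplus/0]_(i < d) (e b i * (z i x b - (if i == j then 1 else 0)))) <=
      Cz * tau x * \big[Rplus/0]_(i < d) Rabs (u b i - st_U x b i).
    rewrite Rsum_scal; apply: Rsum_abs_le => i _; rewrite Rmult_comm; apply: Rabs_mult_le.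
      by apply: Hz; rewrite -/a -/b; lra.
    by rewrite eb; lra.
  have S0 : 0 <= \big[Rplus/0]_(i < d) Rabs (u b i - st_U x b i).
    by apply: Rsum_ge0 => i _; apply: Rabs_pos.
  rewrite -eb.
  set S := \big[Rplus/0]_(i < d) Rabs _ in S0 HS *; set Z := \big[Rplus/0]_(i < d) _ in Hb HS.
  have Ee : e b j = (u a j - st_prev x j) + (H b - H a) + Q + - Z by lra.
  rewrite Ee; have E2 := pow2_ge_0 E.
  have P1 : 0 <= (K + N * CD) * tau x * S by repeat apply: Rmult_le_pos => //; lra.
  have P2 : 0 <= (Cz + K) * tau x * tau x ^ p by repeat apply: Rmult_le_pos => //; lra.
  have P3 : 0 <= (Cz + N * CD) * tau x * E ^ 2 by repeat apply: Rmult_le_pos => //; lra.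
  have P4 : 0 <= Cz * tau x * tau x ^ p by repeat apply: Rmult_le_pos => //; lra.
  rewrite /= in HQ'; rewrite -/(tau x) in MV.
  have T1 := Rabs_triang (u a j - st_prev x j + (H b - H a) + Q) (- Z).
  have T2 := Rabs_triang (u a j - st_prev x j + (H b - H a)) Q.
  have T3 := Rabs_triang (u a j - st_prev x j) (H b - H a).
  rewrite Rabs_Ropp in T1.
  apply: Rle_trans T1 _; lra.
(* One constant for all components [j]: the maximum with [0] makes the increment nonnegative, so
   that [finite_bound] applies to its absolute value. *)
pose Y := {q : step * R | 0 <= q.2 /\
    (forall t j, st_a q.1 < t <= st_b q.1 -> Rabs (u t j - st_U q.1 t j) <= Berr) /\
    (forall t j, st_a q.1 < t <= st_b q.1 -> Rabs (u t j - st_U q.1 t j) <= q.2)}.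
pose Sb x := \big[Rplus/0]_(i < d) Rabs (u (st_b x) i - st_U x (st_b x) i).
pose W (q : Y) := let: (x, E) := sval q in tau x * Sb x + tau x * (E ^ 2 + tau x ^ p).
have taup x : 0 <= tau x by rewrite /tau; have := st_ab x; lra.
have W0 q : 0 <= W q.
  case: q => [[x E] H]; rewrite /W /=.
  apply: Rplus_le_le_0_compat; apply: Rmult_le_pos => //.
    by apply: Rsum_ge0 => i _; apply: Rabs_pos.
  by apply: Rplus_le_le_0_compat; [apply: pow2_ge_0|apply: pow_le].
have [j|//|C [C0 HC]] := @finite_bound 'I_d Y (fun j q => let: (x, E) := sval q in
    Rmax 0 (Rabs (u (st_b x) j - st_U x (st_b x) j) - Rabs (u (st_a x) j - st_prev x j))) W.
  have [C [C0 HC]] := one_coord j; exists C; split=> // q; have := W0 q.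
  case: q => [[x E] /= [E0 [H1 H2]]]; rewrite /W /= => W0'.
  have := HC x E E0 H1 H2; rewrite -/(Sb x) => HC'; rewrite Rabs_pos_eq; last exact: Rmax_l.
  apply: Rmax_lub; first exact: Rmult_le_pos.
  by lra.
exists C; split=> // x E E0 H1 H2 j; rewrite -/(Sb x).
have := HC j (exist _ (x, E) (conj E0 (conj H1 H2))); rewrite /W /= Rabs_pos_eq; last exact: Rmax_l.
have := Rmax_r 0 (Rabs (u (st_b x) j - st_U x (st_b x) j) - Rabs (u (st_a x) j - st_prev x j)).
lra.
Qed.

End Error.
End Step.

(** * The convergence order *)

Definition leE (z : Z) (o : ext) : Prop := if o is Some a then (z <= a)%Z else True.

Lemma leE_emin z x y : leE z (emin x y) <-> leE z x /\ leE z y.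
Proof. by case: x y => [a|] [b|] /=; lia. Qed.

Lemma leE_emax z x y : leE z (emax x y) <-> leE z x \/ leE z y.
Proof. by case: x y => [a|] [b|] /=; lia. Qed.

Lemma leE_eaddZ z x c : leE z (eaddZ x c) <-> leE (z - c) x.
Proof. by case: x => [a|] /=; lia. Qed.

Lemma leE_foldr z (s : seq ext) : leE z (foldr emin None s) <-> forall o, List.In o s -> leE z o.
Proof.
elim: s => [|o s IH] /=; first by split=> // _ o [].
rewrite leE_emin IH; split=> [[H1 H2] o' [<- //|]|H]; first exact: H2.
by split=> [|o' Ho']; apply: H; [left|right].
Qed.

Lemma leE_r_var z rI r k i : (i <= r - k)%nat -> leE z (r_var rI r k) -> leE (z - Z.of_nat i) (rI i).
Proof.
move=> Hi /leE_foldr H; apply/leE_eaddZ; apply: H.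
have : i \in iota 0 (r - k).+1 by rewrite mem_iota.
elim: (iota _ _) => //= j s IH; rewrite inE => /orP[/eqP ->|/IH]; by [left|right].
Qed.

(** The minimum is finite because its first entry is. The maximum in the exponent becomes the
    alternative between the two treatments of the defect. *)
Lemma conv_exponentP rex rI r k :
  exists z, conv_exponent rex rI r k = Z.to_nat z /\
    (z <= 2 * Z.of_nat r - Z.of_nat k + 1)%Z /\
    (forall i, (i <= r - k)%nat -> leE (z - 1 - Z.of_nat i) (rI i)) /\
    (leE (z - 1) rex \/ ((z <= Z.of_nat r)%Z /\ leE (z - 1) (rI (r - k)%nat))).
Proof.
rewrite /conv_exponent; set A := (_ + 1)%Z; set y := emin _ (emax _ _).
have [z Hz] : exists z, emin (Some A) y = Some z by case: y => [b|] /=; eexists.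
exists z; rewrite Hz; split=> //.
have : leE z (emin (Some A) y) by rewrite Hz /=; lia.
rewrite !leE_emin leE_emax !leE_eaddZ => -[H1 [H2 H3]]; split; first exact: H1.
split; first by move=> i Hi; apply: leE_r_var Hi H2.
case: H3 => [|H]; [by left|right].
by move: H; rewrite leE_emin leE_eaddZ => -[].
Qed.

(** The maximum with [-1] covers exponents truncated to [0], for which only the zero polynomial is
    concerned. *)
Lemma is_largest_nat (P : Z -> Prop) o z (n : nat) : is_largest P o ->
  (forall s s', (s <= s')%Z -> P s' -> P s) -> leE z o -> (Z.of_nat n - 1 <= Z.max z (-1))%Z ->
  P (Z.of_nat n - 1)%Z.
Proof.
case: o => [a|] /= H mono Hz Hn; last by apply: H; lia.
by case: H => a1 [Ha _]; apply: mono Ha; lia.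
Qed.

Lemma is_poly_le_leq s s' p : (s <= s')%Z -> is_poly_le s p -> is_poly_le s' p.
Proof. by move=> le; apply: pn_leq; lia. Qed.

Lemma exact_deg_leq Ihat s s' : (s <= s')%Z -> exact_deg Ihat s' -> exact_deg Ihat s.
Proof. by move=> le H a b ab phi Hphi; apply: H => //; apply: is_poly_le_leq Hphi. Qed.

Lemma interp_deg_leq Ihat Iop i s s' : (s <= s')%Z -> interp_deg Ihat Iop i s' -> interp_deg Ihat Iop i s.
Proof. by move=> le H a b ab phi psi Hphi; apply: H => //; apply: is_poly_le_leq Hphi. Qed.

Lemma conv_exponent_orders Ihat Iop rex rI r k : (k <= r)%nat ->
  is_largest (exact_deg Ihat) rex ->
  (forall i, (i <= r - k)%nat -> is_largest (interp_deg Ihat Iop i) (rI i)) ->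
  let p := conv_exponent rex rI r k in
  (p + k <= r + r + 1)%nat /\
  (forall l, (l <= r - k)%nat -> interp_ord Ihat Iop l (p - l)) /\
  (quad_ord Ihat p \/ ((p <= r)%nat /\ interp_ord Ihat Iop (r - k) p)).
Proof.
move=> kr Hex HI p; have [z [pE [H1 [H2 H3]]]] := conv_exponentP rex rI r k.
rewrite -/p in pE; split; first by lia.
split.
  move=> l Hl; apply: (is_largest_nat (HI l Hl) _ (H2 l Hl)); last by lia.
  by move=> s s'; apply: interp_deg_leq.
case: H3 => [H3|[H3 H4]]; [left|right].
  apply: (is_largest_nat Hex _ H3); last by lia.
  by move=> s s'; apply: exact_deg_leq.
split; first by lia.
apply: (is_largest_nat (HI _ (leqnn _)) _ H4); last by lia.
by move=> s s'; apply: interp_deg_leq.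
Qed.

(** * Summation over the mesh *)

(** For [x = K * (t n.+1 - t n) <= 1 / 2] the implicit term is solved by
    [1 / (1 - x) <= 1 + 2 x <= exp (2 x)]. The form [delta * (exp _ - 1)] lets the inhomogeneous
    terms close the induction. *)
Lemma discrete_gronwall (N : nat) (t S : nat -> R) (K delta : R) :
  0 <= K -> 0 <= delta -> (forall n, 0 <= S n) -> S 0%nat = 0 ->
  (forall n, (n < N)%nat -> 0 <= t n.+1 - t n /\ K * (t n.+1 - t n) <= 1 / 2) ->
  (forall n, (n < N)%nat -> S n.+1 <= S n + K * (t n.+1 - t n) * S n.+1 + K * (t n.+1 - t n) * delta) ->
  forall n, (n <= N)%nat -> S n <= delta * (exp (2 * K * (t n - t 0%nat)) - 1).
Proof.
move=> K0 d0 S0 S00 Ht HS; elim=> [|n IH] Hn.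
  by rewrite S00 Rminus_diag Rmult_0_r exp_0; lra.
have {}IH := IH (ltnW Hn); have [h1 h2] := Ht n Hn; have := HS n Hn.
set x := K * (t n.+1 - t n) in h2 *.
have x0 : 0 <= x by apply: Rmult_le_pos.
have -> : 2 * K * (t n.+1 - t 0%nat) = 2 * x + 2 * K * (t n - t 0%nat) by rewrite /x; ring.
rewrite exp_plus; have := exp_ineq1_le (2 * x); have := exp_pos (2 * K * (t n - t 0%nat)).
move: IH; set y := exp (2 * K * _); set ex := exp (2 * x) => IH y0 Hex Hstep.
have sn := S0 n; have sn1 := S0 n.+1.
have H1 : S n.+1 <= (1 + 2 * x) * (S n + x * delta).
  have : S n.+1 * (1 - x) <= S n + x * delta by lra.
  have : 0 <= S n.+1 * (x * (1 - 2 * x)) by apply: Rmult_le_pos => //; nra.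
  nra.
have H2 : (1 + 2 * x) * (x * delta) <= 2 * x * delta.
  have : 0 <= x * delta by nra.
  nra.
have H3 : (1 + 2 * x) * S n <= (1 + 2 * x) * (delta * (y - 1)) by apply: Rmult_le_compat_l; lra.
have H4 : (1 + 2 * x) * (delta * y) <= ex * (delta * y) by apply: Rmult_le_compat_r => //; nra.
lra.
Qed.

Lemma mesh_tau_ge N tm n : (n < N)%nat -> tm n.+1 - tm n <= mesh_tau N tm.
Proof.
move=> Hn; rewrite /mesh_tau.
have : n \in iota 0 N by rewrite mem_iota.
elim: (iota 0 N) => //= j s IH; rewrite inE => /orP[/eqP ->|/IH H]; first exact: Rmax_l.
by apply: Rle_trans H (Rmax_r _ _).
Qed.

Lemma mesh_range t0 T N tm n : is_mesh t0 T N tm -> (n <= N)%nat -> t0 <= tm n <= t0 + T.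
Proof.
move=> [N0 [m0 [mN H]]] Hn; split.
  elim: n Hn => [|n IH] Hn; first by lra.
  by have := IH (ltnW Hn); have := H n Hn; lra.
rewrite -mN -(subnKC Hn); have : (n + (N - n) <= N)%nat by lia.
elim: (N - n)%nat => [|m IH] Hm; first by rewrite addn0; lra.
rewrite addnS in Hm *; have := IH (ltnW Hm); have := H _ Hm; lra.
Qed.

Theorem mainTheorem16
  (d : nat) (f : R -> vec d -> vec d) (u0 : vec d) (t0 T : R) (u : R -> vec d)
  (r k : nat) (Ihat : (R -> R) -> R) (Iop : (R -> R) -> (R -> R)) (kI kIop : nat)
  (rex : ext) (rI : nat -> ext) :
  0 < T -> smooth_f f -> is_ode_solution f u0 t0 T u ->
  (k <= r)%nat ->
  Ihat_ok Ihat kI -> Iop_ok Iop kIop ->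
  Assumption_A1 Ihat r k -> Assumption_A2 d Ihat kI -> Assumption_A3 d Iop kI kIop ->
  is_largest (exact_deg Ihat) rex ->
  (forall i, (i <= r - k)%nat -> is_largest (interp_deg Ihat Iop i) (rI i)) ->
  forall (Berr : R) (BU : nat -> R),
  exists C tau1, 0 < tau1 /\
    forall (N : nat) (tm : nat -> R) (Up : nat -> R -> vec d),
      is_mesh t0 T N tm ->
      mesh_tau N tm <= tau1 ->
      solves_M f u0 r k Ihat Iop N tm Up ->
      (* global error bounded independently of the mesh *)
      (forall n t, (1 <= n <= N)%nat -> tm n.-1 < t <= tm n ->
         vnorm (fun j => u t j - Up n t j) <= Berr) ->
      (* U and all its derivatives bounded on each mesh interval *)
      (forall n l t, (1 <= n <= N)%nat -> tm n.-1 <= t <= tm n ->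
         vnorm (fun j => Derive_n (fun s => Up n s j) l t) <= BU l) ->
      forall E : R,
        (* E >= sup_{t in I} |(u - U)(t)| *)
        (forall n t, (1 <= n <= N)%nat -> tm n.-1 < t <= tm n ->
           vnorm (fun j => u t j - Up n t j) <= E) ->
        vnorm (fun j => u (tm N) j - Up N (tm N) j)
          <= C * (E ^ 2 + mesh_tau N tm ^ conv_exponent rex rI r k).
Proof.
move=> T0 Hf [u_init u_sol] kr HI HO A1 A2 A3 Hex HrI Berr BU.
(* In dimension zero the assumptions on the functionals carry no information, but the norm
   vanishes. *)
have [d0|d_gt0] := posnP d.
  exists 0, 1; split; first lra.
  move=> N tm Up _ _ _ _ _ E _; rewrite Rmult_0_l.
  apply: Rle_trans (vnorm_le_sum _) _; rewrite /vsum big1; first lra.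
  by move=> -[i Hi]; exfalso; rewrite d0 in Hi.
have [p_le [p_interp p_alt]] := conv_exponent_orders kr Hex HrI.
set p := conv_exponent rex rI r k in p_le p_interp p_alt *.
have [C [C0 HC]] := @step_error d f t0 T r k Ihat Iop BU Hf kI kIop p u Berr
  d_gt0 kr HI HO A1 A2 A3 p_le p_interp p_alt u_sol T0.
pose K := INR d * C.
have K0 : 0 <= K by apply: Rmult_le_pos => //; apply: pos_INR.
(* The threshold ensures [K * tau <= 1 / 2] for the Gronwall step; the added one covers [K = 0]. *)
exists (exp (2 * K * T)), (1 / (2 * (K + 1))); split; first by apply: Rdiv_lt_0_compat; lra.
move=> N tm Up Hmesh Htau HM HBerr HBU E HE.
have [N0 [m0 [mN Hstep]]] := Hmesh.
have E0 : 0 <= E.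
  apply: Rle_trans (vnorm_ge0 _) (HE N (tm N) _ _); first by rewrite N0 leqnn.
  by have := Hstep N.-1; rewrite prednK // leqnn => /(_ isT); lra.
pose tau := mesh_tau N tm; rewrite -/tau in Htau *.
have tau0 : 0 <= tau by have := mesh_tau_ge tm N0; have := Hstep 0%nat N0; rewrite /tau; lra.
pose delta := E ^ 2 + tau ^ p.
have delta0 : 0 <= delta by apply: Rplus_le_le_0_compat; [apply: pow2_ge_0|apply: pow_le].
(* The error in the sum norm, which turns the componentwise recursion into a scalar one with
   [K = d * C]. It uses left limits, so that it starts from zero. *)
pose S n := \big[Rplus/0]_(j < d) Rabs (u (tm n) j - Uminus u0 tm Up n j).
have S0 n : 0 <= S n by apply: Rsum_ge0 => j _; apply: Rabs_pos.
have S00 : S 0%nat = 0.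
  by rewrite /S big1 // => j _; rewrite /Uminus /= m0 u_init Rminus_diag Rabs_R0.
have Hstep_ok n : (n < N)%nat -> 0 <= tm n.+1 - tm n /\ K * (tm n.+1 - tm n) <= 1 / 2.
  move=> Hn; have := Hstep n Hn; have := mesh_tau_ge tm Hn; rewrite -/tau => h1 h2.
  split; first lra.
  apply: Rle_trans (_ : K * (1 / (2 * (K + 1))) <= _); first by apply: Rmult_le_compat_l; lra.
  have -> : K * (1 / (2 * (K + 1))) = (K / (K + 1)) / 2 by field; lra.
  by have : K / (K + 1) <= 1 by [apply/Rle_div_l; lra]; lra.
have Hrec n : (n < N)%nat ->
    S n.+1 <= S n + K * (tm n.+1 - tm n) * S n.+1 + K * (tm n.+1 - tm n) * delta.
  move=> Hn; have Hn1 : (1 <= n.+1 <= N)%nat by [].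
  have [Hpoly [Hinit [Hright [Hleft Hvar]]]] := HM n.+1 Hn1.
  have [ab1 ab2] := Hstep n Hn.
  have ab : tm n.+1.-1 < tm n.+1 <= tm n.+1.-1 + 1 by rewrite /=; lra.
  have lo : t0 <= tm n.+1.-1 by have := mesh_range Hmesh (ltnW Hn); rewrite /=; lra.
  have hi : tm n.+1 <= t0 + T by have := mesh_range Hmesh Hn; lra.
  have poly j : pn r.+1 (fun t => Up n.+1 t j) by apply/is_poly_le_nat.
  pose x := @Step d f t0 T r k Ihat Iop BU (tm n.+1.-1) (tm n.+1) (Up n.+1) (Uminus u0 tm Up n.+1.-1)
    ab lo hi poly Hinit Hright Hleft Hvar (fun l t => HBU n.+1 l t Hn1).
  have H1 t j : tm n < t <= tm n.+1 -> Rabs (u t j - Up n.+1 t j) <= Berr.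
    by move=> Ht; apply: Rle_trans (coord_le_vnorm (fun j => u t j - Up n.+1 t j) j) (HBerr _ _ Hn1 Ht).
  have H2 t j : tm n < t <= tm n.+1 -> Rabs (u t j - Up n.+1 t j) <= E.
    by move=> Ht; apply: Rle_trans (coord_le_vnorm (fun j => u t j - Up n.+1 t j) j) (HE _ _ Hn1 Ht).
  have tp : (tm n.+1 - tm n) ^ p <= tau ^ p.
    by apply: pow_incr; split; [lra|apply: mesh_tau_ge].
  have HC' j : Rabs (u (tm n.+1) j - Uminus u0 tm Up n.+1 j) <=
     Rabs (u (tm n) j - Uminus u0 tm Up n j) + (C * (tm n.+1 - tm n) * S n.+1 + C * (tm n.+1 - tm n) * delta).
    have := HC x E E0 H1 H2 j; rewrite /= => H.
    apply: Rle_trans H _; rewrite Rplus_assoc; apply: Rplus_le_compat_l; apply: Rplus_le_compat_l.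
    apply: Rmult_le_compat_l; first by apply: Rmult_le_pos; lra.
    by rewrite /delta; lra.
  have Hsum : S n.+1 <= \big[Rplus/0]_(j < d) (Rabs (u (tm n) j - Uminus u0 tm Up n j) +
     (C * (tm n.+1 - tm n) * S n.+1 + C * (tm n.+1 - tm n) * delta)).
    by apply: Rsum_le => j _; apply: HC'.
  apply: Rle_trans Hsum _; rewrite big_split Rsum_const_ord /= -/(S n) /K; lra.
have HS := discrete_gronwall K0 delta0 S0 S00 Hstep_ok Hrec (leqnn N).
rewrite mN m0 (_ : t0 + T - t0 = T) in HS; last ring.
apply: Rle_trans (vnorm_le_sum _) _.
apply: Rle_trans (_ : S N <= _); last by move: HS; rewrite -/delta; lra.
apply: Rsum_le => j _; rewrite /Uminus (_ : (N == 0%nat) = false); [exact: Rle_refl|lia].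
Qed.
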